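(* Let $M\subset\mathbb C^{2p}$ be a higher order perturbation of a product quadric. Suppose that $M$ admits the maximum number of deck transformations. Assume that the CR singularity of $M$ has no elliptic components ($e_*=0$). Let $\nu=(\mu_1^{\epsilon_1},\dots,\mu_p^{\epsilon_p})$ with $\epsilon_j\in\{1,-1\}$ and $\nu_{s+s_*}=\bar\nu_s^{-1}$ for $h_*<s\le h_*+s_*$ (i.e. $\epsilon_{s+s_*}=\epsilon_s$). Assume that $$-\sum_k\frac{\log\omega_\nu(k)}{2^k}<\infty,\qquad \omega_\nu(k)=\min_{1<|P|\le2^k,\,P\in\mathbb N^p}\ \min_{1\le i\le p}\bigl\{|\nu^P-\nu_i|,\ |\nu^P-\nu_i^{-1}|\bigr\}.$$ Then $M$ admits an attached complex submanifold (i.e. a convergent one).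
   Context: Let $e_*,h_*,s_*\ge0$, $e_*+h_*+2s_*=p$; indices range over $1\le e\le e_*$, $e_*<h\le e_*+h_*$, $e_*+h_*<s\le p-s_*$; $z=(z',z'')\in\mathbb C^p\times\mathbb C^p$. A product quadric is $z_{p+e}=(z_e+2\gamma_e\bar z_e)^2$, $z_{p+h}=(z_h+2\gamma_h\bar z_h)^2$, $z_{p+s}=(z_s+2\gamma_s\bar z_{s+s_*})^2$, $z_{p+s+s_*}=(z_{s+s_*}+2(1-\bar\gamma_s)\bar z_s)^2$ with $0<\gamma_e<1/2$ (elliptic), $\gamma_h>1/2$ (hyperbolic), $\operatorname{Re}\gamma_s>1/2$, $\operatorname{Im}\gamma_s>0$ (complex). $M\colon z_{p+j}=E_j(z',\bar z')$ (real analytic germ at $0$) is a higher order perturbation of it if $E_j$ equals the corresponding quadratic polynomial plus terms of order $\ge3$. Put $\gamma_h=(\lambda_h+\bar\lambda_h)^{-1}$, $|\lambda_h|=1$, $\arg\lambda_h\in(0,\pi/2)$; $\gamma_s=(1+\lambda_s^{-2})^{-1}$, $|\lambda_s|>1$, $\arg\lambda_s\in(0,\pi/2)$; $\lambda_{s+s_*}=\bar\lambda_s^{-1}$; $\mu_j=\lambda_j^2$. Maximum number of deck transformations: for the complexification $\mathcal M=\{z_{p+j}=E_j(z',w'),\ w_{p+j}=\bar E_j(w',z')\}$ with coordinates $(z',w')$ and $\pi_1(z,w)=z$, there are exactly $2^p$ germs of biholomorphisms $F$ of $(\mathcal M,0)$ with $\pi_1F=\pi_1$. The numbers $\mu_1,\dots,\mu_p,\mu_1^{-1},\dots,\mu_p^{-1}$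 are assumed distinct. A formal complex submanifold $K$ of $\mathbb C^{2p}$ (of dimension $p$, through $0$) is attached to $M$ if $K\cap M$ contains at least two germs of totally real and formal submanifolds of dimension $p$ that intersect transversally at the origin. *)

(* Defs.v *)
From HB Require Import structures.
From mathcomp Require Import all_boot all_order all_algebra.
From mathcomp Require mpoly.

Set Implicit Arguments.
Unset Strict Implicit.
Unset Printing Implicit Defensive.

Import Order.TTheory GRing.Theory Num.Theory.
Local Open Scope ring_scope.

(* The notations of mpoly cannot coexist with those of MathComp-Analysis;
   importing mpoly inside a module keeps them local to it. *)
Module CRGeometry.
Import mpoly.

(* A formal power series in n variables, given by its coefficients. A germ at 0
   of a holomorphic function is a convergent series; a germ at 0 of a
   real analytic function of z' in C^p is the convergent series in the p + p
   variables (z', w') that gives the function at w' = conj z'. *)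
Definition fps (C : numClosedFieldType) (n : nat) := 'X_{1..n} -> C.

(* Absolute convergence at the point (r, ..., r), hence on the closed polydisc
   of radius r; 0 < r forces r to be real. *)
Definition convergent (C : numClosedFieldType) n (f : fps C n) : Prop :=
  exists2 r : C, 0 < r &
  exists B : C, forall d,
    \sum_(m : 'X_{1..n < d}) `|f m| * r ^+ mdeg m <= B.

Definition fps_trunc (C : numClosedFieldType) n (d : nat) (f : fps C n) :
    {mpoly C[n]} :=
  \sum_(m : 'X_{1..n < d.+1}) f m *: 'X_[m].

(* The substitution f(g_1, ..., g_n). It is meaningful only when every g_i has
   zero constant term: the coefficient at m then depends only on the terms of
   degree at most |m| of f and of the g_i. *)
Definition fps_comp (C : numClosedFieldType) n k
    (f : fps C n) (g : 'I_n -> fps C k) : fps C k :=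
  fun m => (comp_mpoly [tuple fps_trunc (mdeg m) (g i) | i < n]
              (fps_trunc (mdeg m) f))@_m.

Definition fps_var (C : numClosedFieldType) n (i : 'I_n) : fps C n :=
  fun m => (m == U_(i)%MM)%:R.

Definition fps_conj (C : numClosedFieldType) n (f : fps C n) : fps C n :=
  fun m => (f m)^*.

Definition vanishes_at0 (C : numClosedFieldType) n k (F : 'I_k -> fps C n) :=
  forall i, F i 0%MM = 0.

Definition jacobian0 (C : numClosedFieldType) n k (F : 'I_k -> fps C n) :
    'M[C]_(k, n) :=
  \matrix_(i, j) F i U_(j)%MM.

Definition biholomorphism (C : numClosedFieldType) n (F : 'I_n -> fps C n) :=
  [/\ vanishes_at0 F, forall i, convergent (F i) &
   exists G : 'I_n -> fps C n,
     [/\ vanishes_at0 G, forall i, convergent (G i),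
         forall i, fps_comp (F i) G =1 fps_var C i &
         forall i, fps_comp (G i) F =1 fps_var C i]].

(* E : 'I_p -> fps C (p + p) stands for M : z_{p+j} = E_j(z', conj z'). In
   C^{2p}, indexed by 'I_(p + p), lshift selects z' and rshift selects z''; as
   arguments of E_j, lshift selects z' and rshift selects w'. *)

(* The map pi_1 on the complexification, in the coordinates (z', w'): the point
   of coordinates (z', w') has z-component (z', E(z', w')). *)
Definition pi1 (C : numClosedFieldType) p (E : 'I_p -> fps C (p + p)) :
    'I_(p + p) -> fps C (p + p) :=
  fun i => match split i with
           | inl a => fps_var C (lshift p a)
           | inr b => E b
           end.

Definition deck_transformation (C : numClosedFieldType) p
    (E : 'I_p -> fps C (p + p)) (F : 'I_(p + p) -> fps C (p + p)) : Prop :=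
  biholomorphism F /\ forall i, fps_comp (pi1 E i) F =1 pi1 E i.

Definition quadric_dim (e h s : nat) : nat := (e + h + (s + s))%N.

Definition idx_e e h s (a : 'I_e) : 'I_(quadric_dim e h s) :=
  lshift (s + s) (lshift h a).
Definition idx_h e h s (a : 'I_h) : 'I_(quadric_dim e h s) :=
  lshift (s + s) (rshift e a).
Definition idx_s e h s (a : 'I_s) : 'I_(quadric_dim e h s) :=
  rshift (e + h) (lshift s a).
(* The index written s + s_* on paper. *)
Definition idx_s' e h s (a : 'I_s) : 'I_(quadric_dim e h s) :=
  rshift (e + h) (rshift s a).

(* In a numClosedFieldType, each of the inequalities on gammae and gammah
   forces the compared number to be real. *)
Definition quadric_parameters (C : numClosedFieldType) e h s
    (gammae : 'I_e -> C) (gammah : 'I_h -> C) (gammas : 'I_s -> C) : Prop :=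
  [/\ forall a, 0 < gammae a < 2^-1,
      forall a, 2^-1 < gammah a &
      forall a, 2^-1 < 'Re (gammas a) /\ 0 < 'Im (gammas a)].

Definition quadric (C : numClosedFieldType) e h s
    (gammae : 'I_e -> C) (gammah : 'I_h -> C) (gammas : 'I_s -> C)
    (j : 'I_(quadric_dim e h s)) :
    {mpoly C[quadric_dim e h s + quadric_dim e h s]} :=
  let p := quadric_dim e h s in
  let z (i : 'I_p) : {mpoly C[p + p]} := 'X_(lshift p i) in
  let w (i : 'I_p) : {mpoly C[p + p]} := 'X_(rshift p i) in
  match split j with
  | inl j1 =>
    match split j1 with
    | inl a => (z (idx_e h s a) + (2 * gammae a) *: w (idx_e h s a)) ^+ 2
    | inr a => (z (idx_h e s a) + (2 * gammah a) *: w (idx_h e s a)) ^+ 2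
    end
  | inr j2 =>
    match split j2 with
    | inl a => (z (idx_s e h a) + (2 * gammas a) *: w (idx_s' e h a)) ^+ 2
    | inr a =>
      (z (idx_s' e h a) + (2 * (1 - (gammas a)^*)) *: w (idx_s e h a)) ^+ 2
    end
  end.

Definition higher_order_perturbation (C : numClosedFieldType) e h s
    (gammae : 'I_e -> C) (gammah : 'I_h -> C) (gammas : 'I_s -> C)
    (E : 'I_(quadric_dim e h s) ->
         fps C (quadric_dim e h s + quadric_dim e h s)) : Prop :=
  (forall j, convergent (E j)) /\
  (forall j m, (mdeg m <= 2)%N -> E j m = (quadric gammae gammah gammas j)@_m).

(* A formal real submanifold of dimension d of C^k through 0 is given by a
   formal parametrization by d real variables, with complex coefficients. *)
Definition real_tangent (C : numClosedFieldType) d k (phi : 'I_k -> fps C d)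
    (v : 'cV[C]_k) : Prop :=
  exists2 t : 'cV[C]_d, t \is a mxOver Num.real & v = jacobian0 phi *m t.

Definition formal_real_submanifold (C : numClosedFieldType) d k
    (phi : 'I_k -> fps C d) : Prop :=
  vanishes_at0 phi /\
  (forall t : 'cV[C]_d,
     t \is a mxOver Num.real -> jacobian0 phi *m t = 0 -> t = 0).

Definition totally_real (C : numClosedFieldType) d k
    (phi : 'I_k -> fps C d) : Prop :=
  forall v, real_tangent phi v -> real_tangent phi ('i *: v) -> v = 0.

Definition contained_in_M (C : numClosedFieldType) p d
    (E : 'I_p -> fps C (p + p)) (phi : 'I_(p + p) -> fps C d) : Prop :=
  let z_zbar (i : 'I_(p + p)) : fps C d :=
    match split i with
    | inl a => phi (lshift p a)
    | inr a => fps_conj (phi (lshift p a))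
    end in
  forall j, phi (rshift p j) =1 fps_comp (E j) z_zbar.

Definition tangent_M (C : numClosedFieldType) p (E : 'I_p -> fps C (p + p))
    (v : 'cV[C]_(p + p)) : Prop :=
  exists u : 'cV[C]_p,
    v = col_mx u (jacobian0 E *m col_mx u (map_mx Num.conj u)).

(* A formal complex submanifold K of dimension p of C^{2p} through 0 is given by
   p formal equations K_k = 0 with independent differentials at 0. *)
Definition formal_complex_submanifold (C : numClosedFieldType) p
    (K : 'I_p -> fps C (p + p)) : Prop :=
  vanishes_at0 K /\ row_free (jacobian0 K).

Definition contained_in_K (C : numClosedFieldType) p d
    (K : 'I_p -> fps C (p + p)) (phi : 'I_(p + p) -> fps C d) : Prop :=
  forall k, fps_comp (K k) phi =1 (fun=> 0).

(* The last clause is transversality inside M, whose real dimension is 2p;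
   inside C^{2p} two submanifolds of real dimension p cannot be transversal. *)
Definition attached (C : numClosedFieldType) p
    (E K : 'I_p -> fps C (p + p)) : Prop :=
  formal_complex_submanifold K /\
  exists phi1 phi2 : 'I_(p + p) -> fps C p,
    [/\ [/\ formal_real_submanifold phi1, totally_real phi1,
            contained_in_M E phi1 & contained_in_K K phi1],
        [/\ formal_real_submanifold phi2, totally_real phi2,
            contained_in_M E phi2 & contained_in_K K phi2] &
        forall v, tangent_M E v <->
          exists v1 v2, [/\ real_tangent phi1 v1, real_tangent phi2 v2 &
                            v = v1 + v2]].

Definition monomial_value (C : numClosedFieldType) n (x : 'I_n -> C)
    (P : 'X_{1..n}) : C :=
  \prod_(i < n) x i ^+ P i.

(* The minimum, over the P with 1 < |P| <= N, of F P; +oo is passed as top. *)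
Definition min_multiindex d (T : porderType d) n (top : T) (N : nat)
    (F : 'X_{1..n} -> T) : T :=
  \big[Order.min/top]_(P : 'X_{1..n < N.+1} | (1 < mdeg P)%N) F P.

End CRGeometry.
Export CRGeometry.

From mathcomp Require Import complex.
From mathcomp Require Import boolp classical_sets cardinality reals.
From mathcomp Require Import constructive_ereal ereal topology sequences.
From mathcomp Require Import exp trigo.

Local Open Scope classical_set_scope.
Local Open Scope card_scope.

Definition max_deck_transformations (C : numClosedFieldType) p
    (E : 'I_p -> fps C (p + p)) : Prop :=
  [set F | deck_transformation E F] #= `I_(2 ^ p).

Definition arg_in_first_quadrant (R : realType) (x : R[i]) : Prop :=
  exists2 theta : R, 0 < theta < pi / 2 &
    x = `|x| * Complex (cos theta) (sin theta).

(* lambda is constrained on the elliptic indices as well, by the usual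
   Moser-Webster normalization, so that it is determined at every index. *)
Definition lambda_parameters (R : realType) e h s
    (gammae : 'I_e -> R[i]) (gammah : 'I_h -> R[i]) (gammas : 'I_s -> R[i])
    (lambda : 'I_(quadric_dim e h s) -> R[i]) : Prop :=
  [/\ forall a, let l := lambda (idx_e h s a) in
        1 < l /\ gammae a = (l + l^-1)^-1,
      forall a, let l := lambda (idx_h e s a) in
        [/\ `|l| = 1, arg_in_first_quadrant l & gammah a = (l + Num.conj l)^-1],
      forall a, let l := lambda (idx_s e h a) in
        [/\ 1 < `|l|, arg_in_first_quadrant l & gammas a = (1 + l ^- 2)^-1] &
      forall a, lambda (idx_s' e h a) = (Num.conj (lambda (idx_s e h a)))^-1].

(* Valued in \bar R so that lne (omega nu k) is -oo when the minimum is 0. The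
   index set of the outer minimum is empty for k = 0. *)
Definition omega (R : realType) p (nu : 'I_p -> R[i]) (k : nat) : \bar R :=
  min_multiindex +oo%E (2 ^ k) (fun P =>
    \big[Order.min/+oo%E]_(i < p)
      Order.min (complex.Re `|monomial_value nu P - nu i|)%:E
                (complex.Re `|monomial_value nu P - (nu i)^-1|)%:E).

Definition bruno_condition (R : realType) p (nu : 'I_p -> R[i]) : Prop :=
  (- \sum_(1 <= k <oo) (lne (omega nu k) * (2 ^- k)%:E) < +oo)%E.

(* Main.v *)
Require Import Defs.
From HB Require Import structures.
From mathcomp Require Import all_boot all_order all_algebra.
From mathcomp Require Import complex reals.
From Stdlib Require Import FunctionalExtensionality.
From mathcomp Require Import zify ring lra.
From mathcomp Require ssrcomplements mpoly.

(* In the coordinates (z', w') of the complexification, let T be the w'-part of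
   the deck transformation that reverses the sign of every linear form whose
   square is the leading part of some E_j. It exists because a deck
   transformation is determined by its p signs and there are 2^p of them. One
   looks for z(xi), w(xi) in C{xi_1, ..., xi_p} with

     w(nu xi) = T(z(xi), w(xi)),    z(nu^-1 xi) = conj T (w(xi), z(xi)).

   At the monomial xi^P this is, for each pair of conjugate coordinates, a 2 x 2
   linear system with determinant nu^-P (nu^P - nu_j) (nu^P - nu_j^-1), so the
   solution is unique once its linear part is given, and invariance of the
   system under conjugation makes w the conjugate of z. Since E(z, T(z, w)) =
   E(z, w), the function E(z(xi), w(xi)) equals E(z(xi), w(nu xi)); its graph
   over z(xi) is the attached manifold K, and K meets M where conj xi = xi and
   where conj xi = nu xi (up to the pairing of the coordinates).

   Convergence: put on power series the norm sum |f_P| r^|P| / delta_P, where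
   delta_P is the largest product of inverse small divisors over the nodes of a
   binary tree with leaves adding up to P. It is submultiplicative and gains
   the small divisor on products, which bounds the solution for small r. By
   Bruno's counting argument the nodes with a divisor of size omega(k) number
   O(|P| / 2^k), so delta_P is at most exponential in |P|. *)

Set Implicit Arguments.
Unset Strict Implicit.
Unset Printing Implicit Defensive.

Import Order.TTheory GRing.Theory Num.Theory.
Local Open Scope ring_scope.

(** Put Phi(xi) = (z(xi), w(xi)), and let sigma_1 and sigma_2 be the maps (z, w) -> (z, T(z, w)) and
    (z, w) -> (conj T(w, z), w). The two equations say that sigma_1 Phi(xi) = (z(xi), w(nu xi)) =
    sigma_2 Phi(nu xi): Phi parametrizes a submanifold of half the dimension, invariant under
    sigma_2^-1 sigma_1, on which this map becomes the diagonal map nu. Its linear part has the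
    eigenvalues nu_i and nu_i^-1; the former are the resonances inside the submanifold, the latter
    those normal to it, hence the two distances in omega. The multipliers have modulus 1 at
    hyperbolic indices and inverse moduli on the two members of a complex pair, so nu is neither a
    contraction nor an expansion and no stable manifold argument gives convergence.

    Convergence means bounded finite sums of moduli, so the estimates are polynomial inequalities on
    truncations, valid over any [numClosedFieldType]. Limits, suprema, exponentials and logarithms
    enter only where the weights are built from the Bruno condition. *)

Module FormalSeries.
Import ssrcomplements mpoly.

(** * Formal power series *)

Section Multinomials.
Context (n : nat).
Implicit Types m : 'X_{1..n}.

Lemma mnm_split m : m != 0%MM -> exists i m', m = (U_(i) + m')%MM.
Proof.
move=> m0; have /existsP[i hi] : [exists i, m i != 0%N].
  rewrite -[X in is_true X]negbK negb_exists; apply: contra m0 => /forallP h.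
  by apply/eqP/mnmP => i; move: (h i); rewrite negbK mnm0E => /eqP.
exists i, (m - U_(i))%MM; apply/mnmP => j; rewrite mnmDE mnmBE mnm1E.
by case: eqP => [<-|_] /=; rewrite ?subn0 ?add0n // subnKC // lt0n.
Qed.

Lemma mnm_ind (P : 'X_{1..n} -> Prop) :
  P 0%MM -> (forall i m, P m -> P (U_(i) + m)%MM) -> forall m, P m.
Proof.
move=> P0 PS m; move: {2}(mdeg m) (erefl (mdeg m)) => d.
elim: d m => [|d IH] m hd; first by move/eqP: hd; rewrite mdeg_eq0 => /eqP ->.
have [|i [m' e]] := @mnm_split m; first by rewrite -mdeg_eq0 hd.
rewrite e; apply/PS/IH.
by move: hd; rewrite e mdegD mdeg1 add1n => -[].
Qed.

End Multinomials.

Section Composition.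
Context (C : numClosedFieldType).

(** Agreement of two polynomials below degree d is expressed as [vanish_order d] of their
    difference. *)
Definition vanish_order n d (f : {mpoly C[n]}) :=
  forall m, (mdeg m < d)%N -> f@_m = 0.

(** This is [comp_mpoly] with the images given by a function instead of a tuple. *)
Definition psubst n k (g : 'I_n -> {mpoly C[k]}) : {mpoly C[n]} -> {mpoly C[k]} :=
  mmap (@mpolyC k C) g.

Section VanishOrder.
Context (n : nat).
Implicit Types f g : {mpoly C[n]}.

Lemma vanish_orderD d f g :
  vanish_order d f -> vanish_order d g -> vanish_order d (f + g).
Proof. by move=> hf hg m hm; rewrite mcoeffD hf // hg // addr0. Qed.

Lemma vanish_orderZ d c f : vanish_order d f -> vanish_order d (c *: f).
Proof. by move=> hf m hm; rewrite mcoeffZ hf // mulr0. Qed.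

Lemma vanish_order_sum d (I : Type) (r : seq I) (P : pred I)
    (F : I -> {mpoly C[n]}) :
  (forall i, P i -> vanish_order d (F i)) ->
  vanish_order d (\sum_(i <- r | P i) F i).
Proof.
move=> h; elim/big_rec: _ => [|i x Pi hx]; first by move=> m _; rewrite mcoeff0.
by apply: vanish_orderD hx; apply: h.
Qed.

Lemma vanish_orderM a b f g :
  vanish_order a f -> vanish_order b g -> vanish_order (a + b) (f * g).
Proof.
move=> hf hg m hm; rewrite mcoeffM big1 // => k /eqP e.
case: (ltnP (mdeg k.1) a) => ha; first by rewrite hf // mul0r.
rewrite hg ?mulr0 //; rewrite e mdegD in hm.
by rewrite -(ltn_add2l a); apply: leq_ltn_trans hm; rewrite leq_add2r.
Qed.

Lemma vanish_order_leq a b f :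
  (b <= a)%N -> vanish_order a f -> vanish_order b f.
Proof. by move=> h hf m hm; apply: hf; apply: leq_trans hm h. Qed.

End VanishOrder.


Lemma mmap1U_add n (S : comNzRingType) (g : 'I_n -> S) i m :
  mmap1 g (U_(i) + m)%MM = g i * mmap1 g m.
Proof. by rewrite commr_mmap1_M ?mmap1U // => a b; rewrite /GRing.comm mulrC. Qed.

Section Substitution.
Context (n k : nat).
Implicit Types (f : {mpoly C[n]}) (g h : 'I_n -> {mpoly C[k]}).

Lemma psubstX g m : psubst g 'X_[m] = mmap1 g m.
Proof. exact: mmapX. Qed.

Lemma psubstE g f : psubst g f = \sum_(m <- msupp f) f@_m *: mmap1 g m.
Proof. by apply: eq_bigr => m _; rewrite mul_mpolyC. Qed.

Lemma psubstZ g c f : psubst g (c *: f) = c *: psubst g f.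
Proof. by rewrite /psubst mmapZ mul_mpolyC. Qed.

Lemma psubst_sum g (I : Type) (r : seq I) (P : pred I) (F : I -> {mpoly C[n]}) :
  psubst g (\sum_(i <- r | P i) F i) = \sum_(i <- r | P i) psubst g (F i).
Proof. exact: raddf_sum. Qed.

Lemma vanish_order_mmap1 g m :
  (forall i, vanish_order 1 (g i)) -> vanish_order (mdeg m) (mmap1 g m).
Proof.
move=> hg; elim/mnm_ind: m => [|i m IH]; first by rewrite mdeg0 => m.
by rewrite mmap1U_add mdegD mdeg1; apply: vanish_orderM.
Qed.

(** Telescoping: exchanging one factor of the monomial contributes order d + 1, and each of the
    other |m| - 1 factors contributes order 1. *)
Lemma vanish_order_mmap1B d g h m :
  (forall i, vanish_order 1 (g i)) -> (forall i, vanish_order 1 (h i)) ->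
  (forall i, vanish_order d.+1 (g i - h i)) ->
  vanish_order (mdeg m + d) (mmap1 g m - mmap1 h m).
Proof.
move=> hg hh hd; elim/mnm_ind: m => [|i m IH].
  by rewrite !mmap11 subrr => m _; rewrite mcoeff0.
have -> : mmap1 g (U_(i) + m)%MM - mmap1 h (U_(i) + m)%MM =
    (g i - h i) * mmap1 g m + h i * (mmap1 g m - mmap1 h m).
  by rewrite !mmap1U_add mulrBl mulrBr addrA subrK.
rewrite mdegD mdeg1; apply: vanish_orderD.
  apply: (@vanish_order_leq _ (d.+1 + mdeg m)); first by rewrite addnC addnS.
  by apply: vanish_orderM => //; apply: vanish_order_mmap1.
by rewrite -addnA; apply: vanish_orderM.
Qed.

Lemma vanish_order_psubst a g f :
  (forall i, vanish_order 1 (g i)) -> vanish_order a f ->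
  vanish_order a (psubst g f).
Proof.
move=> hg hf; rewrite psubstE big_seq; apply: vanish_order_sum => m.
rewrite mcoeff_msupp => hm; apply: vanish_orderZ.
apply: vanish_order_leq _ (vanish_order_mmap1 (m := m) hg).
by rewrite leqNgt; apply: contra hm => /hf ->.
Qed.

Lemma vanish_order_psubstB a d g h f :
  (forall i, vanish_order 1 (g i)) -> (forall i, vanish_order 1 (h i)) ->
  (forall i, vanish_order d.+1 (g i - h i)) -> vanish_order a f ->
  vanish_order (a + d) (psubst g f - psubst h f).
Proof.
move=> hg hh hd hf; rewrite !psubstE -sumrB big_seq; apply: vanish_order_sum => m.
rewrite mcoeff_msupp -scalerBr => hm; apply: vanish_orderZ.
apply: vanish_order_leq _ (vanish_order_mmap1B (m := m) hg hh hd).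
rewrite leq_add2r leqNgt; apply: contra hm => /hf -> //.
Qed.

(** The constant term of f cancels in the difference, and what remains of f has order 1. *)
Lemma vanish_order_psubstB0 d g h f :
  (forall i, vanish_order 1 (g i)) -> (forall i, vanish_order 1 (h i)) ->
  (forall i, vanish_order d (g i - h i)) ->
  vanish_order d (psubst g f - psubst h f).
Proof.
case: d => [|d] hg hh hd //; pose c := f@_(0%MM).
have e u : psubst u f = psubst u (f - c%:MP) + c%:MP :> {mpoly C[k]}.
  by rewrite /psubst mmapB [mmap _ _ _%:MP]mmapC subrK.
rewrite (e g) (e h) opprD addrACA subrr addr0 -add1n; apply: vanish_order_psubstB => //.
move=> m; rewrite ltnS leqn0 mdeg_eq0 => /eqP ->.
by rewrite mcoeffB mcoeffC eqxx mulr1 subrr.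
Qed.

End Substitution.

Lemma psubst_psubst n k l (f : {mpoly C[n]}) (g : 'I_n -> {mpoly C[k]})
    (h : 'I_k -> {mpoly C[l]}) :
  psubst h (psubst g f) = psubst (fun i => psubst h (g i)) f.
Proof.
rewrite (mpolyE f) (psubst_sum g) (psubst_sum h) psubst_sum; apply: eq_bigr => m _.
rewrite !psubstZ !psubstX; congr (_ *: _).
elim/mnm_ind: m => [|i m IH]; first by rewrite !mmap11 [LHS]rmorph1.
by rewrite !mmap1U_add [LHS]rmorphM; congr (_ * _).
Qed.

Lemma map_mpoly_psubst n k (s : {rmorphism C -> C}) (f : {mpoly C[n]})
    (g : 'I_n -> {mpoly C[k]}) :
  map_mpoly s (psubst g f) = psubst (fun i => map_mpoly s (g i)) (map_mpoly s f).
Proof.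
rewrite (mpolyE f) (psubst_sum g) !rmorph_sum psubst_sum; apply: eq_bigr => m _ /=.
rewrite !psubstZ map_mpolyZ map_mpolyZ psubstZ map_mpolyX !psubstX.
congr (_ *: _); elim/mnm_ind: m => [|i m IH]; first by rewrite !mmap11 rmorph1.
by rewrite !mmap1U_add -IH; apply: rmorphM.
Qed.

Section Series.
Implicit Types n k : nat.

Lemma fps_truncE n d (f : fps C n) m :
  (fps_trunc d f)@_m = if (mdeg m <= d)%N then f m else 0.
Proof.
rewrite /fps_trunc raddf_sum /=; case: leqP => hm.
  rewrite (bigD1 (BMultinom (n := n) (bound := d.+1) (bmnm := m) hm)) //=.
  rewrite mcoeffZ mcoeffX eqxx mulr1 big1 ?addr0 // => i hi.
  rewrite mcoeffZ mcoeffX; case: eqP => [e|]; last by rewrite mulr0.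
  by case/eqP: hi; apply: val_inj.
rewrite big1 // => i _; rewrite mcoeffZ mcoeffX; case: eqP; last by rewrite mulr0.
by move=> e; have := bmdeg i; rewrite e ltnNge hm.
Qed.

(** Terms of f or of the g_i beyond degree |m| move the result only beyond degree |m|. The freedom
    to pick any representatives, not just the truncations of [fps_comp], is how polynomial
    identities are carried over to series. *)
Lemma fps_compE n k (f : fps C n) (g : 'I_n -> fps C k) m f0
    (g0 : 'I_n -> {mpoly C[k]}) :
  vanishes_at0 g ->
  (forall q, (mdeg q <= mdeg m)%N -> f0@_q = f q) ->
  (forall i q, (mdeg q <= mdeg m)%N -> (g0 i)@_q = g i q) ->
  fps_comp f g m = (psubst g0 f0)@_m.
Proof.
move=> g_0 hf hg; set d := mdeg m in hf hg *.
have hg1 i : vanish_order 1 (g0 i).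
  by move=> q; rewrite ltnS leqn0 mdeg_eq0 => /eqP ->; rewrite hg ?mdeg0.
pose g1 i := fps_trunc d (g i).
have -> : fps_comp f g m = (psubst g1 (fps_trunc d f))@_m.
  rewrite /fps_comp /comp_mpoly /psubst /mmap; congr (_@__); apply: eq_bigr => q _.
  by congr (_ * _); apply: mmap1_eq => i; rewrite tnth_mktuple.
have hg2 i : vanish_order 1 (g1 i).
  by move=> q; rewrite ltnS leqn0 mdeg_eq0 => /eqP ->; rewrite fps_truncE mdeg0 /= g_0.
apply/eqP; rewrite -subr_eq0 -mcoeffB.
have -> : psubst g1 (fps_trunc d f) - psubst g0 f0 =
   (psubst g1 (fps_trunc d f) - psubst g0 (fps_trunc d f)) +
   psubst g0 (fps_trunc d f - f0) by rewrite [psubst g0 (_ - _)]mmapB addrA subrK.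
rewrite mcoeffD (@vanish_order_psubstB0 _ _ d.+1) ?add0r //.
  rewrite (@vanish_order_psubst _ _ d.+1) // => q hq.
  by have le_qd : (mdeg q <= d)%N := hq; rewrite mcoeffB fps_truncE le_qd hf // subrr.
move=> i q hq; have le_qd : (mdeg q <= d)%N := hq.
by rewrite mcoeffB fps_truncE le_qd hg // subrr.
Qed.

Lemma fps_trunc_coef n d (f : fps C n) m :
  (mdeg m <= d)%N -> (fps_trunc d f)@_m = f m.
Proof. by rewrite fps_truncE => ->. Qed.

Lemma fps_comp_trunc n k (f : fps C n) (g : 'I_n -> fps C k) d m :
  vanishes_at0 g -> (mdeg m <= d)%N ->
  fps_comp f g m = (psubst (fun i => fps_trunc d (g i)) (fps_trunc d f))@_m.
Proof.
by move=> g0 hm; apply: fps_compE => // *; apply: fps_trunc_coef;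
  apply: leq_trans hm.
Qed.

Lemma fps_comp_const n k (f : fps C n) (g : 'I_n -> fps C k) :
  vanishes_at0 g -> fps_comp f g 0%MM = f 0%MM.
Proof.
move=> g0; rewrite (@fps_compE _ _ _ _ _ (f 0%MM)%:MP (fun=> 0)) //.
- by rewrite [psubst _ _]mmapC mcoeffC eqxx mulr1.
- by move=> q; rewrite mdeg0 leqn0 mdeg_eq0 => /eqP ->; rewrite mcoeffC eqxx mulr1.
- by move=> i q; rewrite mdeg0 leqn0 mdeg_eq0 => /eqP ->; rewrite mcoeff0 g0.
Qed.

Lemma vanishes_at0_comp n k l (g : 'I_n -> fps C k) (h : 'I_k -> fps C l) :
  vanishes_at0 g -> vanishes_at0 h -> vanishes_at0 (fun i => fps_comp (g i) h).
Proof. by move=> g0 h0 i; rewrite fps_comp_const. Qed.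

Lemma fps_compA n k l (f : fps C n) (g : 'I_n -> fps C k) (h : 'I_k -> fps C l) :
  vanishes_at0 g -> vanishes_at0 h ->
  fps_comp (fps_comp f g) h = fps_comp f (fun i => fps_comp (g i) h).
Proof.
move=> g0 h0; apply: functional_extensionality => m; pose d := mdeg m.
pose g1 i := fps_trunc d (g i); pose h1 i := fps_trunc d (h i).
rewrite (@fps_compE _ _ (fps_comp f g) h m (psubst g1 (fps_trunc d f)) h1 h0); first last.
- by move=> i q hq; rewrite fps_trunc_coef.
- by move=> q hq; rewrite (fps_comp_trunc f g0 hq).
rewrite psubst_psubst (@fps_compE _ _ f _ m (fps_trunc d f)
  (fun i => psubst h1 (g1 i)) (vanishes_at0_comp g0 h0)) //.
- by move=> q hq; rewrite fps_trunc_coef.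
- by move=> i q hq; rewrite (@fps_comp_trunc _ _ _ _ d).
Qed.

Lemma vanishes_at0_var n : vanishes_at0 (@fps_var C n).
Proof. by move=> i; rewrite /fps_var eq_sym mnm1_eq0. Qed.

Lemma fps_comp_varl n k i (g : 'I_n -> fps C k) :
  vanishes_at0 g -> fps_comp (fps_var C i) g = g i.
Proof.
move=> g0; apply: functional_extensionality => m.
rewrite (@fps_compE _ _ _ _ _ 'X_i (fun i => fps_trunc (mdeg m) (g i))) //.
- by rewrite psubstX mmap1U fps_trunc_coef.
- by move=> q _; rewrite mcoeffX eq_sym.
- by move=> j q; apply: fps_trunc_coef.
Qed.

Lemma fps_comp_varr n (f : fps C n) : fps_comp f (@fps_var C n) = f.
Proof.
apply: functional_extensionality => m.
rewrite (@fps_compE _ _ _ _ _ (fps_trunc (mdeg m) f) (fun i => 'X_i)) //.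
- have -> : psubst (fun i => 'X_i) (fps_trunc (mdeg m) f) = fps_trunc (mdeg m) f.
    by rewrite psubstE [RHS]mpolyE; apply: eq_bigr => q _; rewrite mmap1_id.
  exact: fps_trunc_coef.
- exact: vanishes_at0_var.
- by move=> q; apply: fps_trunc_coef.
- by move=> i q _; rewrite mcoeffX eq_sym.
Qed.

Lemma fps_conj_comp n k (f : fps C n) (g : 'I_n -> fps C k) :
  vanishes_at0 g ->
  fps_conj (fps_comp f g) = fps_comp (fps_conj f) (fun i => fps_conj (g i)).
Proof.
move=> g0; apply: functional_extensionality => m; pose d := mdeg m.
rewrite /fps_conj (@fps_comp_trunc _ _ _ _ d) // -mcoeff_map_mpoly map_mpoly_psubst.
rewrite (@fps_compE _ _ _ _ _ (map_mpoly Num.conj (fps_trunc d f))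
  (fun i => map_mpoly Num.conj (fps_trunc d (g i)))) //.
- by move=> i; rewrite g0 rmorph0.
- by move=> q hq; rewrite mcoeff_map_mpoly fps_trunc_coef.
- by move=> i q hq; rewrite mcoeff_map_mpoly fps_trunc_coef.
Qed.

Lemma fps_conjK n : involutive (@fps_conj C n).
Proof. by move=> f; apply: functional_extensionality => m; rewrite /fps_conj conjCK. Qed.

Lemma fps_comp_linear n k (I : Type) (r : seq I) (c : I -> C) (f : I -> fps C n)
    (g : 'I_n -> fps C k) : vanishes_at0 g ->
  fps_comp (fun m => \sum_(i <- r) c i * f i m) g =
  fun m => \sum_(i <- r) c i * fps_comp (f i) g m.
Proof.
move=> g0; apply: functional_extensionality => m; pose d := mdeg m.
rewrite (@fps_compE _ _ _ _ _ (\sum_(i <- r) c i *: fps_trunc d (f i))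
  (fun i => fps_trunc d (g i))) //.
- rewrite psubst_sum raddf_sum; apply: eq_bigr => i _ /=.
  by rewrite psubstZ mcoeffZ (@fps_comp_trunc _ _ _ _ d).
- move=> q hq; rewrite raddf_sum; apply: eq_bigr => i _ /=.
  by rewrite mcoeffZ fps_trunc_coef.
- by move=> i q hq; rewrite fps_trunc_coef.
Qed.

(** With a = 2, agreement of the arguments up to degree d yields agreement of the compositions up to
    degree d + 1. This gain of one degree makes the recursion below well founded. *)
Lemma fps_comp_agree n k (f : fps C n) (g h : 'I_n -> fps C k) a d m :
  vanishes_at0 g -> vanishes_at0 h ->
  (forall q, (mdeg q < a)%N -> f q = 0) ->
  (forall i q, (mdeg q <= d)%N -> g i q = h i q) ->
  (mdeg m < a + d)%N -> fps_comp f g m = fps_comp f h m.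
Proof.
move=> g0 h0 hf hd hm; pose e := mdeg m.
rewrite (fps_comp_trunc f g0 (leqnn e)) (fps_comp_trunc f h0 (leqnn e)).
apply/eqP; rewrite -subr_eq0 -mcoeffB; apply/eqP.
have v1 (u : 'I_n -> fps C k) : vanishes_at0 u -> forall i, vanish_order 1 (fps_trunc e (u i)).
  move=> u0 i q; rewrite ltnS leqn0 mdeg_eq0 => /eqP ->.
  by rewrite fps_truncE u0 if_same.
apply: (@vanish_order_psubstB _ _ a d) hm; [exact: v1|exact: v1| |].
  by move=> i q hq; rewrite mcoeffB !fps_truncE hd // subrr.
by move=> q hq; rewrite fps_truncE hf // if_same.
Qed.

Lemma fps_comp_vanish n k (f : fps C n) (g : 'I_n -> fps C k) a m :
  vanishes_at0 g -> (forall q, (mdeg q < a)%N -> f q = 0) ->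
  (mdeg m < a)%N -> fps_comp f g m = 0.
Proof.
move=> g0 hf hm; rewrite (fps_comp_trunc f g0 (leqnn _)).
apply: (@vanish_order_psubst _ _ a) hm => [i|] q hq; rewrite fps_truncE.
  by move: hq; rewrite ltnS leqn0 mdeg_eq0 => /eqP ->; rewrite g0 if_same.
by rewrite hf // if_same.
Qed.

Lemma fps_comp_U n k (f : fps C n) (g : 'I_n -> fps C k) j :
  vanishes_at0 g -> fps_comp f g U_(j)%MM = \sum_i f U_(i)%MM * g i U_(j)%MM.
Proof.
move=> g0.
rewrite (@fps_compE _ _ _ _ _ ((f 0%MM)%:MP + \sum_i f U_(i)%MM *: 'X_i)
   (fun i => fps_trunc 1 (g i))) //.
- rewrite /psubst mmapD mmapC mcoeffD mcoeffC mnm1_eq0 mulr0 add0r.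
  rewrite [mmap _ _ _]psubst_sum raddf_sum; apply: eq_bigr => i _ /=.
  by rewrite psubstZ psubstX mmap1U mcoeffZ fps_trunc_coef // mdeg1.
- move=> q; rewrite mdeg1 leq_eqVlt ltnS leqn0 mdeg_eq0 mcoeffD mcoeffC.
  rewrite raddf_sum /=; case/orP => [|/eqP ->]; last first.
    rewrite eqxx mulr1 big1 ?addr0 // => i _.
    by rewrite mcoeffZ mcoeffX mnm1_eq0 mulr0.
  case/mdeg1P => i /eqP ->; rewrite mnm1_eq0 mulr0 add0r (bigD1 i) //=.
  rewrite mcoeffZ mcoeffXU eqxx mulr1 big1 ?addr0 // => l hl.
  by rewrite mcoeffZ mcoeffXU (negbTE hl) mulr0.
- by move=> i q hq; rewrite fps_trunc_coef // -(mdeg1 j).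
Qed.

Lemma jacobian0_comp n k l (F : 'I_l -> fps C n) (g : 'I_n -> fps C k) :
  vanishes_at0 g ->
  jacobian0 (fun i => fps_comp (F i) g) = jacobian0 F *m jacobian0 g.
Proof.
move=> g0; apply/matrixP => i j; rewrite !mxE fps_comp_U //.
by apply: eq_bigr => a _; rewrite !mxE.
Qed.

Definition fps_lin n k (M : 'M[C]_(k, n)) : 'I_k -> fps C n :=
  fun i m => \sum_j M i j * fps_var C j m.

Lemma vanishes_at0_lin n k (M : 'M[C]_(k, n)) : vanishes_at0 (fps_lin M).
Proof. by move=> i; rewrite /fps_lin big1 // => j _; rewrite vanishes_at0_var mulr0. Qed.

Lemma fps_lin_U n k (M : 'M[C]_(k, n)) i j : fps_lin M i U_(j)%MM = M i j.
Proof.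
rewrite /fps_lin (bigD1 j) //= /fps_var eqxx mulr1 big1 ?addr0 // => l hl.
suff /negbTE -> : (U_(j) != U_(l))%MM by rewrite mulr0.
by apply: contra hl => /eqP/mnmP/(_ j); rewrite !mnm1E eqxx; case: eqP.
Qed.

Lemma jacobian0_lin n k (M : 'M[C]_(k, n)) : jacobian0 (fps_lin M) = M.
Proof. by apply/matrixP => i j; rewrite mxE fps_lin_U. Qed.

Lemma fps_lin_deg n k (M : 'M[C]_(k, n)) i m : mdeg m != 1%N -> fps_lin M i m = 0.
Proof.
move=> hm; rewrite /fps_lin big1 // => j _; rewrite /fps_var.
case: eqP => [e|]; last by rewrite mulr0.
by rewrite e mdeg1 in hm.
Qed.

Lemma fps_conj_lin n k (M : 'M[C]_(k, n)) i :
  fps_conj (fps_lin M i) = fps_lin (map_mx Num.conj M) i.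
Proof.
apply: functional_extensionality => m; rewrite /fps_conj /fps_lin rmorph_sum.
by apply: eq_bigr => j _; rewrite rmorphM !mxE /fps_var rmorph_nat.
Qed.

Lemma fps_lin_mul n k l (M : 'M[C]_(k, n)) (N : 'M[C]_(n, l)) i :
  fps_comp (fps_lin M i) (fps_lin N) = fps_lin (M *m N) i.
Proof.
rewrite fps_comp_linear; last exact: vanishes_at0_lin.
apply: functional_extensionality => m.
transitivity (\sum_j \sum_l M i j * (N j l * fps_var C l m)).
  apply: eq_bigr => j _; rewrite fps_comp_varl; last exact: vanishes_at0_lin.
  by rewrite big_distrr.
rewrite exchange_big; apply: eq_bigr => j _ /=.
by rewrite mxE big_distrl; apply: eq_bigr => a _ /=; rewrite mulrA.
Qed.

Lemma fps_lin1 n : fps_lin 1%:M = @fps_var C n.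
Proof.
apply: functional_extensionality => i; apply: functional_extensionality => m.
rewrite /fps_lin (bigD1 i) //= mxE eqxx mul1r big1 ?addr0 // => j hj.
by rewrite mxE eq_sym (negbTE hj) mul0r.
Qed.

Lemma monomial_valueD n (x : 'I_n -> C) P Q :
  monomial_value x (P + Q)%MM = monomial_value x P * monomial_value x Q.
Proof.
by rewrite /monomial_value -big_split; apply: eq_bigr => i _; rewrite mnmDE exprD.
Qed.

Lemma monomial_valueU n (x : 'I_n -> C) i : monomial_value x U_(i)%MM = x i.
Proof.
rewrite /monomial_value (bigD1 i) //= mnm1E eqxx expr1 big1 ?mulr1 // => j hj.
by rewrite mnm1E eq_sym (negbTE hj) expr0.
Qed.

(** Monomials are eigenvectors of a diagonal substitution; this decouples the invariance equations
    monomial by monomial. *)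
Lemma fps_comp_diag n (f : fps C n) (nu : 'rV[C]_n) m :
  fps_comp f (fps_lin (diag_mx nu)) m = monomial_value (nu 0) m * f m.
Proof.
rewrite (@fps_compE _ _ _ _ _ (fps_trunc (mdeg m) f) (fun i => nu 0 i *: 'X_i)) //.
- have e q : mmap1 (fun i => nu 0 i *: 'X_i) q =
      monomial_value (nu 0) q *: 'X_[q] :> {mpoly C[n]}.
    rewrite /mmap1 /monomial_value mpolyXE_id -scaler_prod.
    by apply: eq_bigr => i _; rewrite exprZn.
  rewrite psubstE raddf_sum /=.
  transitivity (\sum_(q <- msupp (fps_trunc (mdeg m) f))
     monomial_value (nu 0) m * ((fps_trunc (mdeg m) f)@_q *: 'X_[q])@_m).
    apply: eq_bigr => q _; rewrite e !mcoeffZ mcoeffX.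
    case: eqP => [->|]; last by rewrite !mulr0.
    by rewrite !mulr1 mulrC.
  rewrite -mulr_sumr; congr (_ * _).
  have <- : (fps_trunc (mdeg m) f)@_m = f m by apply: fps_trunc_coef.
  by rewrite [in RHS](mpolyE (fps_trunc _ _)) raddf_sum.
- exact: vanishes_at0_lin.
- by move=> q; apply: fps_trunc_coef.
- move=> i q _; rewrite mcoeffZ mcoeffX /fps_lin (bigD1 i) //= mxE eqxx mulr1n.
  rewrite big1 ?addr0 /fps_var 1?eq_sym // => j hj.
  by rewrite mxE eq_sym (negbTE hj) mul0r.
Qed.

End Series.
End Composition.

(** * Weighted norms and convergence *)

Section WeightedNorm.
Context (C : numClosedFieldType).

Definition pnorm n (w : 'X_{1..n} -> C) (f : {mpoly C[n]}) : C :=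
  \sum_(m <- msupp f) `|f@_m| * w m.

Section Norm.
Context (n : nat) (w : 'X_{1..n} -> C).
Hypothesis w_ge0 : forall m, 0 <= w m.
Implicit Types f g : {mpoly C[n]}.

Lemma pnormE k f : (msize f <= k)%N ->
  pnorm w f = \sum_(m : 'X_{1..n < k}) `|f@_m| * w m.
Proof.
move=> hk; set I : subFinType _ := 'X_{1..n < k}.
rewrite /pnorm (big_mksub I) ?msupp_uniq //=; first last.
  by move=> x /msize_mdeg_lt /leq_trans; apply.
rewrite big_rmcond //= => j; rewrite mcoeff_msupp negbK => /eqP ->.
by rewrite normr0 mul0r.
Qed.

Lemma pnorm_ge0 f : 0 <= pnorm w f.
Proof. by apply: sumr_ge0 => m _; rewrite mulr_ge0. Qed.

Lemma pnorm0 : pnorm w 0 = 0.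
Proof. by rewrite /pnorm msupp0 big_nil. Qed.

Lemma pnormD f g : pnorm w (f + g) <= pnorm w f + pnorm w g.
Proof.
pose k := (msize f + msize g + msize (f + g))%N.
rewrite !(@pnormE k) /k; [|lia..].
rewrite -big_split; apply: ler_sum => m _ /=.
by rewrite -mulrDl mcoeffD ler_wpM2r ?ler_normD.
Qed.

Lemma pnorm_sum (I : Type) (r : seq I) (P : pred I) (F : I -> {mpoly C[n]}) :
  pnorm w (\sum_(i <- r | P i) F i) <= \sum_(i <- r | P i) pnorm w (F i).
Proof.
elim/big_rec2: _ => [|i y x _ h]; first by rewrite pnorm0.
by apply: le_trans (pnormD _ _) _; rewrite lerD2l.
Qed.

Lemma pnormZX c m : pnorm w (c *: 'X_[m]) = `|c| * w m.
Proof.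
have [->|c0] := eqVneq c 0; first by rewrite scale0r pnorm0 normr0 mul0r.
by rewrite /pnorm msuppMCX // big_seq1 mcoeffZ mcoeffX eqxx mulr1.
Qed.

Lemma pnormZ c f : pnorm w (c *: f) = `|c| * pnorm w f.
Proof.
pose k := (msize f + msize (c *: f))%N.
rewrite !(@pnormE k) /k; [|lia..].
by rewrite mulr_sumr; apply: eq_bigr => m _; rewrite mcoeffZ normrM mulrA.
Qed.

Lemma partial_sum_pnorm d f :
  \sum_(m : 'X_{1..n < d}) `|f@_m| * w m <= pnorm w f.
Proof.
pose F (m : 'X_{1..n}) := `|f@_m| * w m.
have F0 m : 0 <= F m by rewrite mulr_ge0.
rewrite -/(pnorm w f) (pnormE (k := maxn d (msize f))) ?leq_maxr //.
have hd (m : 'X_{1..n}) : (mdeg m < d)%N -> (mdeg m < maxn d (msize f))%N.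
  by move=> h; apply: leq_trans h _; rewrite leq_maxl.
rewrite (big_sub_widen 'X_{1..n < d} 'X_{1..n < maxn d (msize f)} predT F hd) /=.
rewrite [leRHS](bigID (fun m : 'X_{1..n < _} => (mdeg m < d)%N)) /=.
by rewrite lerDl; apply: sumr_ge0 => m _; apply: F0.
Qed.

Lemma pnorm_truncE d (f : fps C n) :
  pnorm w (fps_trunc d f) = \sum_(m : 'X_{1..n < d.+1}) `|f m| * w m.
Proof.
rewrite (@pnormE d.+1); last first.
  rewrite msizeE; apply/bigmax_leqP_seq => m; rewrite mcoeff_msupp fps_truncE ltnS.
  by case: (mdeg m <= d)%N => [_ _|]; rewrite ?eqxx.
by apply: eq_bigr => m _; rewrite fps_trunc_coef // -ltnS bmdeg.
Qed.

End Norm.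

Section NormProduct.
Context (n : nat) (w w2 : 'X_{1..n} -> C).
Hypothesis w2_ge0 : forall m, 0 <= w2 m.

Lemma pnormM (f g : {mpoly C[n]}) :
  (forall a b, a \in msupp f -> b \in msupp g -> w2 (a + b)%MM <= w a * w b) ->
  pnorm w2 (f * g) <= pnorm w f * pnorm w g.
Proof.
move=> hw; rewrite {1}(mpolyE f) {1}(mpolyE g) mulr_suml.
apply: le_trans; first exact: pnorm_sum w2_ge0 _ _ _ _.
rewrite [leRHS]mulr_suml big_seq [leRHS]big_seq; apply: ler_sum => a ha.
rewrite mulr_sumr; apply: le_trans; first exact: pnorm_sum w2_ge0 _ _ _ _.
rewrite mulr_sumr big_seq [leRHS]big_seq; apply: ler_sum => b hb.
rewrite -scalerAl -scalerAr scalerA -mpolyXD pnormZX // normrM.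
by rewrite mulrACA ler_wpM2l ?mulr_ge0 // hw.
Qed.

End NormProduct.

(* A weight that is submultiplicative on nonconstant monomials makes [pnorm] an
   algebra norm on polynomials without constant term. *)
Definition submult n (w w2 : 'X_{1..n} -> C) :=
  forall a b, a != 0%MM -> b != 0%MM -> w2 (a + b)%MM <= w a * w b.

Lemma vanish_order1_supp n (f : {mpoly C[n]}) m :
  vanish_order 1 f -> m \in msupp f -> m != 0%MM.
Proof. by move=> hf; rewrite mcoeff_msupp; apply: contra => /eqP ->; rewrite hf ?mdeg0. Qed.

Section SubstitutionNorm.
Context (n k : nat) (w w2 : 'X_{1..k} -> C) (x : C) (g : 'I_n -> {mpoly C[k]}).
Hypotheses (w_ge0 : forall m, 0 <= w m) (w2_ge0 : forall m, 0 <= w2 m).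
Hypotheses (ww : submult w w) (ww2 : submult w w2).
Hypothesis gx : forall i, pnorm w (g i) <= x.
Hypothesis g1 : forall i, vanish_order 1 (g i).

Lemma pnorm_mmap1 m : m != 0%MM -> pnorm w (mmap1 g m) <= x ^+ mdeg m.
Proof.
elim/mnm_ind: m => [|i m IH _]; first by rewrite eqxx.
rewrite mmap1U_add mdegD mdeg1 exprS.
have [->|m0] := eqVneq m 0%MM; first by rewrite mmap11 mulr1 mdeg0 mulr1.
apply: le_trans (pnormM w_ge0 _) _ => [a b ha hb|]; last first.
  by apply: ler_pM; [exact: pnorm_ge0|exact: pnorm_ge0|exact: gx|exact: IH].
apply: ww; first exact: vanish_order1_supp ha.
apply: vanish_order1_supp hb; apply: vanish_order_leq _ (vanish_order_mmap1 g1).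
by rewrite lt0n mdeg_eq0.
Qed.

(** The weight [w2] is gained once, at the outermost product; the factor [g i] and the rest of the
    monomial, nonconstant because the degree exceeds 1, are both measured in [w]. *)
Lemma pnorm_mmap1_2 m : (1 < mdeg m)%N -> pnorm w2 (mmap1 g m) <= x ^+ mdeg m.
Proof.
elim/mnm_ind: m => [|i m _]; first by rewrite mdeg0.
rewrite mmap1U_add mdegD mdeg1 exprS add1n ltnS lt0n mdeg_eq0 => m0.
apply: le_trans (pnormM w2_ge0 _) _ => [a b ha hb|]; last first.
  by apply: ler_pM; [exact: pnorm_ge0|exact: pnorm_ge0|exact: gx|exact: pnorm_mmap1].
apply: ww2; first exact: vanish_order1_supp ha.
apply: vanish_order1_supp hb; apply: vanish_order_leq _ (vanish_order_mmap1 g1).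
by rewrite lt0n mdeg_eq0.
Qed.

Lemma pnorm_psubst2 f : vanish_order 2 f ->
  pnorm w2 (psubst g f) <= pnorm (fun m => x ^+ mdeg m) f.
Proof.
move=> f2; rewrite psubstE; apply: le_trans; first exact: pnorm_sum w2_ge0 _ _ _ _.
rewrite /pnorm big_seq [leRHS]big_seq; apply: ler_sum => m; rewrite mcoeff_msupp => hm.
rewrite -/(pnorm w2 _) pnormZ // ler_wpM2l // pnorm_mmap1_2 //.
by rewrite ltnNge; apply: contra hm => h; rewrite f2.
Qed.

Lemma pnorm_psubst f : w 0%MM <= 1 ->
  pnorm w (psubst g f) <= pnorm (fun m => x ^+ mdeg m) f.
Proof.
move=> w01; rewrite psubstE; apply: le_trans; first exact: pnorm_sum w_ge0 _ _ _ _.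
apply: ler_sum => m _; rewrite pnormZ // ler_wpM2l //.
have [->|m0] := eqVneq m 0%MM; last exact: pnorm_mmap1.
by rewrite mmap11 mdeg0 -mpolyX0 -[X in pnorm w X]scale1r pnormZX normr1 mul1r.
Qed.

End SubstitutionNorm.

Section Convergence.

Definition bounded_at n (f : fps C n) (r B : C) :=
  forall d, \sum_(m : 'X_{1..n < d}) `|f m| * r ^+ mdeg m <= B.

Lemma bounded_at_ge0 n (f : fps C n) r B : bounded_at f r B -> 0 <= B.
Proof. by move=> /(_ 0%N); apply: le_trans; apply: sumr_ge0 => -[m hm]. Qed.

Lemma bounded_at_le n (f : fps C n) r s B :
  0 <= s -> s <= r -> bounded_at f r B -> bounded_at f s B.
Proof.
move=> s0 sr hf d; apply: le_trans (hf d); apply: ler_sum => m _.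
by rewrite ler_wpM2l // lerXn2r ?nnegrE //; apply: le_trans s0 sr.
Qed.

Lemma bounded_at_trunc n (f : fps C n) r B d : bounded_at f r B ->
  0 <= r -> pnorm (fun m => r ^+ mdeg m) (fps_trunc d f) <= B.
Proof. by move=> hf r0; rewrite pnorm_truncE // => m; rewrite exprn_ge0. Qed.

Lemma convergent_family n k (f : 'I_k -> fps C n) :
  (forall i, convergent (f i)) ->
  exists r, 0 < r /\ exists B, 0 <= B /\ forall i, bounded_at (f i) r B.
Proof.
elim: k f => [|k IH] f hf.
  by exists 1; split; rewrite ?ltr01 //; exists 0; split => // -[].
have [r [r0 [B [B0 hB]]]] := IH (fun i => f (lift ord0 i)) (fun i => hf _).
have [s s0 [D hD]] := hf ord0.
have D0 := bounded_at_ge0 hD.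
(* A common radius below r and s that avoids a minimum in the partially ordered field. *)
have t0 : 0 < r * s / (r + s) by rewrite divr_gt0 ?mulr_gt0 ?addr_gt0.
have tr : r * s / (r + s) <= r.
  by rewrite -mulrA ler_piMr ?ler_pdivrMr ?addr_gt0 ?mul1r ?lerDr // ltW.
have ts : r * s / (r + s) <= s.
  by rewrite mulrC mulrA ler_piMl ?(ltW s0) // mulrC ler_pdivrMr ?addr_gt0 // mul1r lerDl ltW.
exists (r * s / (r + s)); split => //; exists (B + D); split; first exact: addr_ge0.
move=> i; case: (unliftP ord0 i) => [j|] -> d.
  by apply: le_trans (bounded_at_le (ltW t0) tr (hB j) d) _; rewrite lerDl.
by apply: le_trans (bounded_at_le (ltW t0) ts hD d) _; rewrite lerDr.
Qed.

(** Schwarz's lemma for majorants: each term has degree at least a, so it shrinks at least by (s /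
    r)^a when the radius goes from r to s. *)
Lemma bounded_at_vanish n (f : fps C n) r s B a :
  0 < r -> 0 <= s -> s <= r -> (forall m, (mdeg m < a)%N -> f m = 0) ->
  bounded_at f r B -> bounded_at f s ((s / r) ^+ a * B).
Proof.
move=> r0 s0 sr fa hf d; apply: le_trans (ler_wpM2l _ (hf d)); last first.
  by rewrite exprn_ge0 // divr_ge0 // ltW.
rewrite mulr_sumr; apply: ler_sum => m _; rewrite mulrCA.
case: (ltnP (mdeg m) a) => h; first by rewrite fa // normr0 !mul0r.
rewrite ler_wpM2l // expr_div_n -(subnK h) !exprD.
rewrite [r ^+ _ * _]mulrC mulrA divfK; last by rewrite expf_neq0 // gt_eqF.
rewrite mulrC ler_wpM2l ?exprn_ge0 // lerXn2r ?nnegrE //.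
by rewrite ltW.
Qed.

Lemma convergent_comp n k (f : fps C n) (g : 'I_n -> fps C k) :
  vanishes_at0 g -> convergent f -> (forall i, convergent (g i)) ->
  convergent (fps_comp f g).
Proof.
move=> g0 [s s0 [D hD]] /convergent_family [r [r0 [B [B0 hB]]]].
have sB : 0 < s + B by apply: ltr_wpDr.
(* By Schwarz's lemma at order 1 the norm of [g i] at radius t is at most t B / r, which this choice
   keeps below s, the radius at which f is bounded. *)
pose t := r * s / (s + B).
have t0 : 0 < t by rewrite divr_gt0 ?mulr_gt0.
have tr : t <= r.
  by rewrite /t -mulrA ler_piMr ?ler_pdivrMr ?mul1r ?lerDl // ltW.
exists t => //; exists D => -[|d].
  by rewrite big1 ?(bounded_at_ge0 hD) // => -[m].
have tm m : 0 <= t ^+ @mdeg k m by rewrite exprn_ge0 // ltW.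
have tt : submult (fun m : 'X_{1..k} => t ^+ mdeg m) (fun m => t ^+ mdeg m).
  by move=> a b _ _; rewrite mdegD exprD.
apply: le_trans (bounded_at_trunc d hD (ltW s0)).
have gs i : pnorm (fun m => t ^+ mdeg m) (fps_trunc d (g i)) <= s.
  have g1 m : (mdeg m < 1)%N -> g i m = 0.
    by rewrite ltnS leqn0 mdeg_eq0 => /eqP ->.
  have := bounded_at_trunc d (bounded_at_vanish r0 (ltW t0) tr g1 (hB i)) (ltW t0).
  move=> h; apply: le_trans h _; rewrite expr1 /t [r * s]mulrC [_ / r]mulrAC mulfK ?gt_eqF // -mulrA.
  by rewrite ler_piMr ?(ltW s0) // mulrC ler_pdivrMr // mul1r lerDr ltW.
have g1 i : vanish_order 1 (fps_trunc d (g i)).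
  by move=> m; rewrite ltnS leqn0 mdeg_eq0 => /eqP ->; rewrite fps_truncE g0 if_same.
have t1 : t ^+ @mdeg k 0%MM <= 1 by rewrite mdeg0.
apply: le_trans (pnorm_psubst tm tt gs g1 (fps_trunc d f) t1).
apply: le_trans (partial_sum_pnorm tm d.+1 _).
by apply: ler_sum => m _; rewrite -fps_comp_trunc // -ltnS bmdeg.
Qed.

Lemma convergentB n (f g : fps C n) :
  convergent f -> convergent g -> convergent (fun m => f m - g m).
Proof.
move=> hf hg.
have fg (i : 'I_2) : convergent (if i == ord0 then f else g) by case: ifP.
have [r [r0 [B [B0 hB]]]] := convergent_family fg.
exists r => //; exists (B + B) => d.
apply: le_trans (lerD (hB ord0 d) (hB ord_max d)).
rewrite -big_split; apply: ler_sum => m _ /=.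
by rewrite -mulrDl ler_wpM2r ?exprn_ge0 ?(ltW r0) // ler_normB.
Qed.

Lemma convergent_poly n (f : fps C n) D :
  (forall m, (D < mdeg m)%N -> f m = 0) -> convergent f.
Proof.
move=> hf; exists 1; first exact: ltr01.
exists (pnorm (fun=> 1) (fps_trunc D f)) => d.
apply: le_trans (partial_sum_pnorm (fun=> ler01) d _).
apply: ler_sum => m _; rewrite expr1n fps_truncE.
by case: leqP => // /hf ->; rewrite normr0.
Qed.

Lemma convergent_lin n k (M : 'M[C]_(k, n)) i : convergent (fps_lin M i).
Proof. by apply: (@convergent_poly _ _ 1) => m hm; rewrite fps_lin_deg // gtn_eqF. Qed.

Lemma convergent_var n (i : 'I_n) : convergent (fps_var C i).
Proof. by rewrite -fps_lin1; apply: convergent_lin. Qed.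

Lemma convergent_conj n (f : fps C n) : convergent f -> convergent (fps_conj f).
Proof.
case=> r r0 [B hB]; exists r => //; exists B => d; apply: le_trans (hB d).
by apply: ler_sum => m _; rewrite /fps_conj norm_conjC.
Qed.

End Convergence.

End WeightedNorm.

(** * Recursively defined series *)

Section Solver.
Context (C : numClosedFieldType) (n N : nat).
Context (G : 'I_N -> fps C N) (L : 'I_N -> fps C n).
Context (solve : 'X_{1..n} -> ('I_N -> C) -> 'I_N -> C).
Hypothesis G2 : forall j m, (mdeg m < 2)%N -> G j m = 0.
Hypothesis L1 : forall i m, mdeg m != 1%N -> L i m = 0.

(* The degree-m part of u is determined by lower degrees, G having order 2. *)
Definition recursive_solution (u : 'I_N -> fps C n) :=
  forall i m, u i m = if (1 < mdeg m)%N then solve m (fun j => fps_comp (G j) u m) i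
                      else L i m.

Fixpoint iterate_solution (d : nat) : 'I_N -> fps C n :=
  if d is d.+1 then
    fun i m => if (1 < mdeg m)%N
               then solve m (fun j => fps_comp (G j) (iterate_solution d) m) i
               else L i m
  else L.

Lemma linear_vanish : vanishes_at0 L.
Proof. by move=> i; rewrite L1 ?mdeg0. Qed.

Lemma iterate_vanish d : vanishes_at0 (iterate_solution d).
Proof. by case: d => [|d] i /=; rewrite ?mdeg0 /= linear_vanish. Qed.

Lemma comp_agree_low (u v : 'I_N -> fps C n) m j : vanishes_at0 u -> vanishes_at0 v ->
  (forall i q, (mdeg q < mdeg m)%N -> u i q = v i q) ->
  fps_comp (G j) u m = fps_comp (G j) v m.
Proof.
move=> u0 v0 uv; case: (posnP (mdeg m)) => [/eqP|m0].
  by rewrite mdeg_eq0 => /eqP ->; rewrite !fps_comp_const.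
apply: (@fps_comp_agree _ _ _ _ u v 2 (mdeg m).-1) => //; first exact: G2.
  by move=> i q hq; apply: uv; rewrite -(prednK m0) ltnS.
by rewrite -{1}(prednK m0).
Qed.

Lemma recursive_solution_unique u v :
  recursive_solution u -> recursive_solution v -> u = v.
Proof.
move=> hu hv.
have u0 : vanishes_at0 u by move=> i; rewrite hu mdeg0 /= linear_vanish.
have v0 : vanishes_at0 v by move=> i; rewrite hv mdeg0 /= linear_vanish.
suff h d i m : (mdeg m < d)%N -> u i m = v i m.
  by do 2![apply: functional_extensionality => ?]; apply: h (ltnSn _).
elim: d i m => // d IH i m hm; rewrite hu hv; case: ifP => // _.
congr (solve m _ i); apply: functional_extensionality => j.
apply: comp_agree_low => // l q hq; apply: IH; apply: leq_trans hq _; lia.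
Qed.

Lemma iterate_agree d i m : (mdeg m <= d)%N ->
  iterate_solution d i m = iterate_solution (mdeg m) i m.
Proof.
suff h c d' i' m' : (mdeg m' < c)%N -> (mdeg m' <= d')%N ->
    iterate_solution d'.+1 i' m' = iterate_solution d' i' m'.
  move=> hd; rewrite -(subnK hd); elim: (d - mdeg m)%N => // a IH.
  by rewrite addSn (h (mdeg m).+1) ?IH // leq_addl.
elim: c d' i' m' => // c IH d' i' m' hc hd /=.
case: (ltnP 1 (mdeg m')) => hm; last first.
  by case: d' hd => [|d'] _ //=; rewrite ltnNge hm.
case: d' hd => [|d'] hd; first by lia.
rewrite [RHS]/= hm; congr (solve m' _ i'); apply: functional_extensionality => j.
apply: comp_agree_low => [||l q hq]; [exact: iterate_vanish|exact: iterate_vanish|].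
by apply: IH; lia.
Qed.

Lemma recursive_solution_exists : exists u, recursive_solution u.
Proof.
(* Diagonal choice: the coefficient at m is stationary from the |m|-th iterate on. *)
exists (fun i m => iterate_solution (mdeg m) i m) => i m.
case: ifP => hm; last first.
  by case: {1}(mdeg m) => [|d] //=; rewrite hm.
have [d E] : exists d, mdeg m = d.+1 by exists (mdeg m).-1; rewrite prednK // ltnW.
have -> : iterate_solution (mdeg m) i m = iterate_solution d.+1 i m by rewrite E.
rewrite [LHS]/= hm; congr (solve m _ i); apply: functional_extensionality => j.
apply: comp_agree_low.
- exact: iterate_vanish.
- by move=> l; rewrite mdeg0 /= linear_vanish.
- by move=> l q; rewrite E ltnS => hq; apply: iterate_agree.
Qed.

Section Estimate.
Context (u : 'I_N -> fps C n) (hu : recursive_solution u).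
Context (v v2 : 'X_{1..n} -> C) (K : C).
Hypotheses (v_ge0 : forall m, 0 <= v m) (v2_ge0 : forall m, 0 <= v2 m).
Hypotheses (vv : submult v v) (vv2 : submult v v2) (K_ge0 : 0 <= K).
Hypothesis solveP : forall m b i, (1 < mdeg m)%N ->
  `|solve m b i| * v m <= K * v2 m * \sum_j `|b j|.
Hypothesis G_conv : forall j, convergent (G j).

Let u0 : vanishes_at0 u. Proof. by move=> i; rewrite hu mdeg0 /= linear_vanish. Qed.

Lemma submult_scale (a b : 'X_{1..n} -> C) r : 0 <= r -> submult a b ->
  submult (fun m => a m * r ^+ mdeg m) (fun m => b m * r ^+ mdeg m).
Proof.
move=> r0 hab x y hx hy; rewrite mdegD exprD mulrACA ler_wpM2r ?hab //.
by rewrite mulr_ge0 // exprn_ge0.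
Qed.

(* With x = 2 Lam r, the quadratic term A x^2 is at most Lam r. *)
Lemma solution_bound : exists r, 0 < r /\ exists B, forall i d,
  \sum_(m : 'X_{1..n < d}) `|u i m| * (v m * r ^+ mdeg m) <= B.
Proof.
have [s [s0 [B [B0 hB]]]] := convergent_family G_conv.
(* The summand 1 keeps [Lam] positive even if the linear part vanishes. *)
pose Lam := 1 + \sum_i pnorm v (fps_trunc 1 (L i)).
have Lam_ge i : pnorm v (fps_trunc 1 (L i)) <= Lam.
  rewrite /Lam (bigD1 i) //= addrCA lerDl addr_ge0 ?ler01 // sumr_ge0 // => j _.
  exact: pnorm_ge0.
have Lam0 : 0 < Lam.
  by rewrite ltr_pwDl ?ltr01 // sumr_ge0 // => j _; apply: pnorm_ge0.
clearbody Lam; pose A := K * (N%:R * (B / s ^+ 2)).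
have A0 : 0 <= A by rewrite !mulr_ge0 ?ler0n ?invr_ge0 ?exprn_ge0 // ltW.
(* The radius is r = 1 / D. The first summand gives 4 A Lam r <= 1, hence A x^2 <= Lam r; the second
   gives x = 2 Lam r <= s, so that the bound on G at radius s applies at x. *)
pose D := 4 * A * Lam + 2 * Lam / s.
have AL0 : 0 <= 4 * A * Lam := mulr_ge0 (mulr_ge0 (ler0n _ 4) A0) (ltW Lam0).
have D0 : 0 < D.
  by apply: ltr_wpDl => //; rewrite divr_gt0 ?mulr_gt0 ?ltr0n.
pose r := D^-1; have r0 : 0 < r by rewrite invr_gt0.
pose x := 2 * Lam * r.
have x0 : 0 < x by rewrite !mulr_gt0 ?ltr0n.
have Dr : D * r = 1 by rewrite /r mulfV // gt_eqF.
clearbody r; have xs : x <= s.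
  rewrite -[s]mulr1 -Dr mulrA /x ler_pM2r // /D mulrDr.
  rewrite [X in _ + X]mulrC divfK ?gt_eqF // lerDr.
  exact: mulr_ge0 (ltW s0) AL0.
have hx : Lam * r + A * x ^+ 2 <= x.
  have -> : A * x ^+ 2 = (4 * A * Lam * r) * (Lam * r) by rewrite /x; ring.
  have -> : x = Lam * r + 1 * (Lam * r) by rewrite /x; ring.
  rewrite lerD2l ler_pM2r ?mulr_gt0 //.
  rewrite -[leRHS]Dr /D [leRHS]mulrDl lerDl.
  by rewrite !mulr_ge0 ?ler0n ?invr_ge0 ?(ltW s0) ?(ltW r0) ?(ltW Lam0).
exists r; split => //; exists x.
pose w m := v m * r ^+ mdeg m; pose w2 m := v2 m * r ^+ mdeg m.
have w_ge0 m : 0 <= w m by rewrite mulr_ge0 // exprn_ge0 // ltW.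
have w2_ge0 m : 0 <= w2 m by rewrite mulr_ge0 // exprn_ge0 // ltW.
have ww : submult w w by apply: submult_scale; rewrite ?ltW.
have ww2 : submult w w2 by apply: submult_scale; rewrite ?ltW.
(* The inequality Lam r + A x^2 <= x makes the ball of radius x stable, so the bound passes from the
   truncation at d to the one at d + 1. *)
suff h d i : pnorm w (fps_trunc d (u i)) <= x.
  move=> i [|d]; first by rewrite big1 ?ltW // => -[m].
  by rewrite -[leLHS](pnorm_truncE w).
elim: d i => [|d IH] i.
  rewrite pnorm_truncE big1 ?ltW // => m _.
  have := bmdeg m; rewrite ltnS leqn0 mdeg_eq0 => /eqP ->.
  by rewrite u0 normr0 mul0r.
have t1 j : vanish_order 1 (fps_trunc d (u j)).
  by move=> m; rewrite ltnS leqn0 mdeg_eq0 => /eqP ->; rewrite fps_truncE u0 if_same.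
have G2' j : vanish_order 2 (fps_trunc d.+1 (G j)).
  by move=> m hm; rewrite fps_truncE G2 // if_same.
pose H j := psubst (fun l => fps_trunc d (u l)) (fps_trunc d.+1 (G j)).
have hH j : pnorm w2 (H j) <= B / s ^+ 2 * x ^+ 2.
  apply: le_trans (pnorm_psubst2 w_ge0 w2_ge0 ww ww2 IH t1 (G2' j)) _.
  have := bounded_at_trunc d.+1 (bounded_at_vanish s0 (ltW x0) xs (@G2 j) (hB j)) (ltW x0).
  by rewrite expr_div_n mulrC -mulrA [_ / _ in leRHS]mulrC mulrA [leRHS]mulrC mulrA.
have compE j m : (mdeg m <= d.+1)%N -> fps_comp (G j) u m = (H j)@_m.
  (* Up to degree d + 1, G(u) involves u only up to degree d, so the truncation of u may stand for
     u. *)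
  move=> hm; pose ud l : fps C n := fun q => (fps_trunc d (u l))@_q.
  have ud0 : vanishes_at0 ud by move=> l; rewrite /ud t1 ?mdeg0.
  rewrite (@comp_agree_low u ud) // => [|l q hq]; last first.
    by rewrite /ud fps_trunc_coef //; lia.
  by apply: fps_compE => // q hq; rewrite fps_trunc_coef //; lia.
have step (m : 'X_{1..n < d.+2}) : `|u i m| * w m <=
   `|(fps_trunc 1 (L i))@_m| * v m * r + K * \sum_j `|(H j)@_m| * w2 m.
  rewrite hu; case: ifP => hm.
    apply: ler_wpDl; first by rewrite !mulr_ge0 // ltW.
    rewrite mulrA -mulr_suml mulrA.
    apply: le_trans (ler_wpM2r _ (solveP _ _ hm)) _; first by rewrite exprn_ge0 // ltW.
    rewrite le_eqVlt; apply/orP; left; apply/eqP.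
    have -> : \sum_j `|fps_comp (G j) u m| = \sum_j `|(H j)@_m|.
      by apply: eq_bigr => j _; rewrite compE // -ltnS bmdeg.
    by rewrite /w2; ring.
  apply: ler_wpDr.
    by apply: mulr_ge0 => //; apply: sumr_ge0 => j _; rewrite mulr_ge0.
  rewrite fps_truncE leqNgt hm /=.
  have [e|ne] := eqVneq (mdeg m) 1%N; first by rewrite /w e expr1 mulrA.
  by rewrite L1 // normr0 !mul0r.
rewrite pnorm_truncE; apply: le_trans (ler_sum _ (fun m _ => step m)) _.
apply: le_trans hx; rewrite big_split /= -mulr_suml -mulr_sumr; apply: lerD.
  by rewrite ler_wpM2r ?(ltW r0) //; apply: le_trans (Lam_ge i); apply: partial_sum_pnorm.
rewrite /A -mulrA ler_wpM2l // exchange_big /= -mulrA mulr_natl.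
apply: le_trans (_ : \sum_(j < N) B / s ^+ 2 * x ^+ 2 <= _).
  apply: ler_sum => j _; apply: le_trans (hH j); exact: partial_sum_pnorm.
by rewrite sumr_const card_ord.
Qed.

Lemma solution_convergent rho : 0 < rho ->
  (forall m, rho ^+ mdeg m <= v m) -> forall i, convergent (u i).
Proof.
move=> rho0 hv i; have [r [r0 [B hB]]] := solution_bound.
exists (rho * r); first exact: mulr_gt0.
exists B => d; apply: le_trans (hB i d); apply: ler_sum => m _.
by rewrite ler_wpM2l // exprMn ler_wpM2r ?hv // exprn_ge0 // ltW.
Qed.

End Estimate.
End Solver.

(** * The inverse function theorem for convergent series *)

Section InverseFunction.
Context (C : numClosedFieldType).

Lemma fps_compD n k (f h : fps C n) (g : 'I_n -> fps C k) : vanishes_at0 g ->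
  fps_comp (fun m => f m + h m) g = fun m => fps_comp f g m + fps_comp h g m.
Proof.
move=> g0.
have := fps_comp_linear [:: true; false] (fun=> 1) (fun b : bool => if b then f else h) g0.
have -> : (fun m => \sum_(i <- [:: true; false]) 1 * (if i then f else h) m) =
    (fun m => f m + h m).
  by apply: functional_extensionality => m; rewrite big_cons big_seq1 !mul1r.
by move=> ->; apply: functional_extensionality => m; rewrite big_cons big_seq1 !mul1r.
Qed.

Lemma fps_comp_lin n k l (M : 'M[C]_(l, n)) i (g : 'I_n -> fps C k) :
  vanishes_at0 g ->
  fps_comp (fps_lin M i) g = fun m => \sum_j M i j * g j m.
Proof.
move=> g0; rewrite fps_comp_linear //; apply: functional_extensionality => m.
by apply: eq_bigr => j _; rewrite fps_comp_varl.
Qed.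

Section Nonlinear.
Context (n k : nat) (F : 'I_k -> fps C n).

Definition nonlinear_part (j : 'I_k) : fps C n :=
  fun m => F j m - fps_lin (jacobian0 F) j m.

Lemma nonlinear_part_low j m : vanishes_at0 F -> (mdeg m < 2)%N ->
  nonlinear_part j m = 0.
Proof.
move=> F0; rewrite /nonlinear_part ltnS leq_eqVlt => /orP[/mdeg1P[i /eqP ->]|].
  by rewrite fps_lin_U mxE subrr.
by rewrite ltnS leqn0 mdeg_eq0 => /eqP ->; rewrite F0 vanishes_at0_lin subrr.
Qed.

Lemma convergent_nonlinear_part j : convergent (F j) -> convergent (nonlinear_part j).
Proof. by move=> hF; apply: convergentB => //; apply: convergent_lin. Qed.

Lemma fps_comp_nonlinear l (g : 'I_n -> fps C l) j m : vanishes_at0 g ->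
  fps_comp (F j) g m =
  \sum_i jacobian0 F j i * g i m + fps_comp (nonlinear_part j) g m.
Proof.
move=> g0.
have {1}-> : F j = fun m => fps_lin (jacobian0 F) j m + nonlinear_part j m.
  by apply: functional_extensionality => q; rewrite addrC subrK.
by rewrite fps_compD // fps_comp_lin.
Qed.

End Nonlinear.

(** With J the Jacobian and N the nonlinear part of z, the equation z(g) = id reads g = J^-1 (id -
    N(g)). This is a recursive system without small divisors, so constant weights suffice. *)
Lemma fps_right_inverse p (z : 'I_p -> fps C p) :
  vanishes_at0 z -> (forall i, convergent (z i)) -> jacobian0 z \in unitmx ->
  exists g : 'I_p -> fps C p,
    [/\ vanishes_at0 g, forall i, convergent (g i), jacobian0 g = invmx (jacobian0 z) &
        forall i, fps_comp (z i) g = fps_var C i].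
Proof.
move=> z0 zc Ju; set J := jacobian0 z in Ju *.
pose solve (m : 'X_{1..p}) (b : 'I_p -> C) i := - \sum_j invmx J i j * b j.
have G2 j m : (mdeg m < 2)%N -> nonlinear_part z j m = 0.
  exact: nonlinear_part_low.
have L1 (i : 'I_p) (m : 'X_{1..p}) : mdeg m != 1%N -> fps_lin (invmx J) i m = 0.
  exact: fps_lin_deg.
have [g hg] := recursive_solution_exists solve G2 L1.
have g0 : vanishes_at0 g by move=> i; rewrite hg mdeg0 /= vanishes_at0_lin.
exists g; split => //.
- pose K := \sum_i \sum_j `|invmx J i j|.
  have K0 : 0 <= K by apply: sumr_ge0 => i _; apply: sumr_ge0.
  have s11 : submult (fun=> 1 : C) (fun=> 1 : C) (n := p) by move=> *; rewrite mulr1.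
  apply: (@solution_convergent _ _ _ _ _ _ G2 L1 g hg (fun=> 1) (fun=> 1) K
    (fun=> ler01) (fun=> ler01) s11 s11 K0 _ _ 1) => //; last first.
  - by move=> m; rewrite expr1n.
  - by move=> j; apply: convergent_nonlinear_part.
  move=> m b i _; rewrite !mulr1 normrN.
  apply: le_trans (ler_norm_sum _ _ _) _; rewrite mulr_sumr; apply: ler_sum => j _.
  rewrite normrM ler_wpM2r // /K (bigD1 i) //= (bigD1 j) //= -addrA lerDl.
  by rewrite addr_ge0 ?sumr_ge0 // => *; rewrite ?sumr_ge0.
- apply/matrixP => i j; rewrite mxE hg mdeg1 /= fps_lin_U //.
move=> i; apply: functional_extensionality => m; rewrite fps_comp_nonlinear //.
case: (ltnP 1 (mdeg m)) => hm.
  have -> : fps_var C i m = 0.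
    by rewrite /fps_var; case: eqP => // e; rewrite e mdeg1 in hm.
  transitivity (\sum_j J i j * g j m + \sum_j 1%:M i j * fps_comp (nonlinear_part z j) g m).
    congr (_ + _); rewrite (bigD1 i) //= mxE eqxx mul1r big1 ?addr0 // => j hj.
    by rewrite mxE eq_sym (negbTE hj) mul0r.
  rewrite -(mulmxV Ju).
  under [X in _ + X]eq_bigr do rewrite mxE mulr_suml.
  rewrite exchange_big -big_split big1 // => j _ /=.
  rewrite hg hm /solve; under [X in _ + X]eq_bigr do rewrite -mulrA.
  by rewrite -mulr_sumr mulrN addNr.
have -> : fps_comp (nonlinear_part z i) g m = 0.
  by apply: (fps_comp_vanish g0 (@G2 i)); rewrite ltnS.
rewrite addr0 -fps_lin1 -(mulmxV Ju) -fps_lin_mul fps_comp_lin; last exact: vanishes_at0_lin.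
by apply: eq_bigr => j _; rewrite hg ltnNge hm.
Qed.

(** The right inverse g of z has a right inverse h of its own, and z = z(g(h)) = h; so g is also a
    left inverse. *)
Lemma fps_inverse p (z : 'I_p -> fps C p) :
  vanishes_at0 z -> (forall i, convergent (z i)) -> jacobian0 z \in unitmx ->
  exists g : 'I_p -> fps C p,
    [/\ vanishes_at0 g, forall i, convergent (g i) &
        forall i, fps_comp (g i) z = fps_var C i].
Proof.
move=> z0 zc Ju; have [g [g0 gc Jg zg]] := fps_right_inverse z0 zc Ju.
have [h [h0 hc _ gh]] : exists h : 'I_p -> fps C p,
    [/\ vanishes_at0 h, forall i, convergent (h i), jacobian0 h = invmx (jacobian0 g) &
        forall i, fps_comp (g i) h = fps_var C i].
  by apply: fps_right_inverse; rewrite ?Jg ?unitmx_inv.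
exists g; split => //.
suff -> : z = h by [].
apply: functional_extensionality => i; rewrite -[LHS]fps_comp_varr.
have -> : @fps_var C p = fun i => fps_comp (g i) h.
  by apply: functional_extensionality => j; rewrite gh.
by rewrite -fps_compA // zg fps_comp_varl.
Qed.

End InverseFunction.

(** * Counting small divisors in trees *)

Section Trees.
Context (n : nat).

Inductive btree := Leaf of 'I_n | Node of btree & btree.

Fixpoint tree_index t : 'X_{1..n} :=
  match t with Leaf i => U_(i)%MM | Node a b => (tree_index a + tree_index b)%MM end.

Fixpoint tree_count (sp : pred 'X_{1..n}) t : nat :=
  match t with
  | Leaf _ => 0
  | Node a b => sp (tree_index t) + (tree_count sp a + tree_count sp b)
  end.

Lemma mdeg_tree_index t : (0 < mdeg (tree_index t))%N.
Proof. by elim: t => [i|a ha b hb] /=; rewrite ?mdeg1 // mdegD addn_gt0 ha. Qed.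

Lemma tree_index_neq0 t : tree_index t != 0%MM.
Proof. by rewrite -mdeg_eq0 -lt0n mdeg_tree_index. Qed.

Lemma tree_exists (P : 'X_{1..n}) : P != 0%MM -> exists t, tree_index t = P.
Proof.
elim/mnm_ind: P => [|i m IH _]; first by rewrite eqxx.
have [->|/IH[t ht]] := eqVneq m 0%MM; first by exists (Leaf i); rewrite addm0.
by exists (Node (Leaf i) t); rewrite /= ht.
Qed.

(* Two exceptional multi-indices, one above the other, are far apart; so a
   chain of nodes descending from an exceptional one loses degree m before the
   next exceptional one. *)
Lemma tree_count_bound (m : nat) (sp : pred 'X_{1..n}) t :
  (forall P, sp P -> (m < mdeg P)%N) ->
  (forall P Q, Q != 0%MM -> sp P -> sp (P + Q)%MM -> (m <= mdeg Q)%N) ->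
  (m * tree_count sp t <= 2 * mdeg (tree_index t))%N.
Proof.
move=> s1 s2.
(* The induction carries a surplus. When the root is exceptional and only one child is large, the
   root costs one extra m; the third clause provides it, since that child lies below an exceptional
   index. Two large children supply it by their own surpluses. *)
suff h : [/\ (mdeg (tree_index t) <= m)%N -> tree_count sp t = 0%N,
    (m < mdeg (tree_index t))%N ->
      (m * (tree_count sp t).+1 <= 2 * mdeg (tree_index t))%N &
    forall Q, Q != 0%MM -> sp (tree_index t + Q)%MM -> (m < mdeg (tree_index t))%N ->
      (m * (tree_count sp t).+2 <= 2 * mdeg (tree_index t + Q))%N].
  have [h1 h2 _] := h.
  case: (leqP (mdeg (tree_index t)) m) => [/h1 ->|/h2]; first by rewrite muln0.
  by apply: leq_trans; rewrite leq_mul2l leqnSn orbT.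
elim: t => [i|a [a1 a2 a3] b [b1 b2 b3]] /=.
  rewrite mdeg1; split => // [hm|Q hQ hs hm].
    by case: m hm {s1 s2} => // _; rewrite mul0n.
  by case: m hm {s1 s2} => // _; rewrite mul0n.
have pa := mdeg_tree_index a; have pb := mdeg_tree_index b.
have na := tree_index_neq0 a; have nb := tree_index_neq0 b.
move: a1 a2 a3 b1 b2 b3 pa pb na nb.
set A := tree_index a; set B := tree_index b.
set ca := tree_count sp a; set cb := tree_count sp b.
move=> a1 a2 a3 b1 b2 b3 pa pb na nb.
have C2 : (m < mdeg (A + B))%N ->
    (m * (sp (A + B)%MM + (ca + cb)).+1 <= 2 * mdeg (A + B))%N.
  rewrite mdegD => hm.
  case: (leqP (mdeg A) m) => hA; case: (leqP (mdeg B) m) => hB.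
  - by rewrite a1 // b1 //; case: (sp _); nia.
  - rewrite a1 //; case hs: (sp (A + B)%MM); last by have := b2 hB; lia.
    by have := b3 A na; rewrite addmC hs mdegD => /(_ isT hB); lia.
  - rewrite b1 // addn0; case hs: (sp (A + B)%MM); last by have := a2 hA; lia.
    by have := a3 B nb; rewrite hs mdegD => /(_ isT hA); lia.
  - by have := a2 hA; have := b2 hB; case: (sp _); nia.
split => [|//|Q hQ hs hm].
  rewrite mdegD => hm; rewrite a1 ?b1; [|lia..].
  by case hs: (sp _) => //; have := s1 _ hs; rewrite mdegD; lia.
case hAB: (sp (A + B)%MM).
  have := s2 _ _ hQ hAB hs; have := C2 hm; rewrite hAB !mdegD; nia.
(* The root is not exceptional: a single large child inherits the exceptional index above it, its
   sibling being absorbed into Q. *)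
move: hm; rewrite !mdegD add0n => hm.
case: (leqP (mdeg A) m) => hA; case: (leqP (mdeg B) m) => hB.
- by rewrite a1 // b1 //; nia.
- have := b3 (A + Q)%MM; rewrite a1 // add0n.
  have -> : (B + (A + Q))%MM = (A + B + Q)%MM by rewrite addmA [(B + A)%MM]addmC.
  rewrite hs !mdegD => /(_ _ isT hB); apply.
  by rewrite mnmD_eq0 negb_and na.
- have := a3 (B + Q)%MM; rewrite b1 // addn0.
  rewrite addmA hs !mdegD => /(_ _ isT hA); apply.
  by rewrite mnmD_eq0 negb_and nb.
- by have := a2 hA; have := b2 hB; nia.
Qed.

Section Cost.
Context (R : realFieldType) (T : finType) (cost : 'X_{1..n} -> R).

Fixpoint tree_cost t : R :=
  match t with
  | Leaf _ => 0
  | Node a b => cost (tree_index t) + (tree_cost a + tree_cost b)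
  end.

(** By [tree_count_bound] with m = 2^k, each target x accounts for at most 2 |P| / 2^k exceptional
    nodes of scale k, each charged b k. Summing over the targets and scales gives 2 #|T| B |P|, and
    b0 is paid at every node. *)
Lemma tree_cost_bound (sp : nat -> T -> pred 'X_{1..n}) (b0 B : R) (b : nat -> R) t :
  0 <= b0 -> (forall k, 0 <= b k) ->
  (forall k x P, sp k x P -> (2 ^ k < mdeg P)%N) ->
  (forall k x P Q, Q != 0%MM -> sp k x P -> sp k x (P + Q)%MM ->
     (2 ^ k <= mdeg Q)%N) ->
  (forall P K, (1 < mdeg P)%N -> (mdeg P <= 2 ^ K)%N ->
     cost P <= b0 + \sum_(1 <= k < K) b k * \sum_x (sp k x P)%:R) ->
  (forall K, \sum_(1 <= k < K) b k / 2 ^+ k <= B) ->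
  tree_cost t <= (b0 + 2 * #|T|%:R * B) * (mdeg (tree_index t))%:R.
Proof.
move=> b00 b_ge0 s1 s2 hcost hB.
(* The extra b0 on the left reflects that a tree with |P| leaves has |P| - 1 nodes. *)
have step K t' : (mdeg (tree_index t') <= 2 ^ K)%N ->
    tree_cost t' + b0 <= b0 * (mdeg (tree_index t'))%:R +
      \sum_(1 <= k < K) b k * \sum_x (tree_count (sp k x) t')%:R.
  elim: t' => [i|a IHa c IHc] /= hK.
    rewrite mdeg1 mulr1 add0r lerDl sumr_ge0 // => k _.
    by rewrite mulr_ge0 // sumr_ge0.
  have pa := mdeg_tree_index a; have pc := mdeg_tree_index c.
  have := hK; rewrite mdegD => hK'.
  have ha := IHa (leq_trans (leq_addr _ _) hK').
  have hc := IHc (leq_trans (leq_addl _ _) hK').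
  have h1 : (1 < mdeg (tree_index a + tree_index c))%N.
    by rewrite mdegD; apply: (leq_add pa pc).
  have hP := hcost _ K h1 hK.
  have -> : \sum_(1 <= k < K) b k * \sum_x
      (sp k x (tree_index a + tree_index c)%MM +
        (tree_count (sp k x) a + tree_count (sp k x) c))%:R =
     \sum_(1 <= k < K) b k * \sum_x (sp k x (tree_index a + tree_index c)%MM)%:R +
     (\sum_(1 <= k < K) b k * \sum_x (tree_count (sp k x) a)%:R +
      \sum_(1 <= k < K) b k * \sum_x (tree_count (sp k x) c)%:R).
    rewrite -!big_split; apply: eq_bigr => k _ /=; rewrite -!mulrDr; congr (_ * _).
    by rewrite -!big_split; apply: eq_bigr => x _ /=; rewrite !natrD.
  rewrite natrD mulrDr; lra.
set d := mdeg _; have hd : (d <= 2 ^ d)%N by apply: ltnW; apply: ltn_expl.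
apply: le_trans (_ : tree_cost t + b0 <= _); first by rewrite lerDl.
apply: le_trans (step d t hd) _; rewrite -/d mulrDl lerD2l.
rewrite mulrAC; apply: le_trans (ler_wpM2l _ (hB d)); last first.
  by rewrite !mulr_ge0 ?ler0n.
rewrite mulr_sumr; apply: ler_sum => k _; rewrite mulrCA ler_wpM2l //.
have -> : 2 * #|T|%:R * d%:R / 2 ^+ k = \sum_(x : T) (2 * d%:R / 2 ^+ k) :> R.
  by rewrite sumr_const -[RHS]mulr_natl !mulrA [2 * _]mulrC.
apply: ler_sum => x _; rewrite ler_pdivlMr ?exprn_gt0 ?ltr0n //.
rewrite -natrX -!natrM ler_nat mulnC.
by apply: tree_count_bound => [P|P Q]; [apply: s1|apply: s2].
Qed.

End Cost.
End Trees.

(** * Deck transformations *)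

Section DeckTransformations.
Context (C : numClosedFieldType).

(** The monomial order is graded, so [mlast] has minimal degree in the support, and the product of
    the two last terms cannot cancel: the order of a product is the sum of the orders. *)
Lemma vanish_order_divr n a b (f g : {mpoly C[n]}) m :
  (mdeg m <= b)%N -> g@_m != 0 -> vanish_order (a + b) (f * g) -> vanish_order a f.
Proof.
move=> mb gm fg m' hm'; apply: contraTeq isT => fm'.
have g0 : g != 0 by apply: contraNneq gm => ->; rewrite mcoeff0.
have f0 : f != 0 by apply: contraNneq fm' => ->; rewrite mcoeff0.
have df : (mdeg (mlast f) < a)%N.
  by apply: leq_ltn_trans hm'; apply: lemc_mdeg; rewrite mlast_lemc // mcoeff_msupp.
have dg : (mdeg (mlast g) <= b)%N.
  by apply: leq_trans mb; apply: lemc_mdeg; rewrite mlast_lemc // mcoeff_msupp.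
have : (f * g)@_(mlast f + mlast g)%MM = 0 by apply: fg; rewrite mdegD; lia.
rewrite mcoeffM.
have h1 : (mdeg (mlast f) < (mdeg (mlast f + mlast g)).+1)%N by rewrite mdegD; lia.
have h2 : (mdeg (mlast g) < (mdeg (mlast f + mlast g)).+1)%N by rewrite mdegD; lia.
rewrite (bigD1 (BMultinom h1, BMultinom h2)) //= big1 ?addr0 => [/eqP|].
  by rewrite mulf_eq0 -[_ == 0]negbK -[g@__ == 0]negbK -!mcoeff_msupp !mlast_supp.
move=> [k1 k2] /= /andP[/eqP e ne].
case: (ltP (val k1) (mlast f)) => [h|h1'].
  by rewrite mcoeff_lt_mlast ?mul0r.
case: (ltP (val k2) (mlast g)) => [h|h2'].
  by rewrite [X in _ * X]mcoeff_lt_mlast ?mulr0.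
move: h1'; rewrite le_eqVlt => /orP[/eqP ek1|h].
  move: e; rewrite -ek1 => /addmI ek2; case/negP: ne.
  by rewrite xpair_eqE -!val_eqE /= -ek1 -ek2 !eqxx.
by have := ltmc_le_add h h2'; rewrite -e ltxx.
Qed.

Section Deck.
Context (p : nat) (tau : 'I_p -> 'I_p) (c : 'I_p -> C) (E : 'I_p -> fps C (p + p)).
Hypotheses (tauK : involutive tau) (c_neq0 : forall j, c j != 0).

Definition lform j : {mpoly C[p + p]} := 'X_(lshift p j) + c j *: 'X_(rshift p (tau j)).

Hypothesis E2 : forall j m, (mdeg m <= 2)%N -> E j m = (lform j ^+ 2)@_m.

(** The linear coefficients of [lform j] composed with F. *)
Definition lform_image (F : 'I_(p + p) -> fps C (p + p)) j i : C :=
  F (lshift p j) U_(i)%MM + c j * F (rshift p (tau j)) U_(i)%MM.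

Let A (F : 'I_(p + p) -> fps C (p + p)) d j : {mpoly C[p + p]} :=
  fps_trunc d (F (lshift p j)) + c j *: fps_trunc d (F (rshift p (tau j))).

Let A_lform F d j : psubst (fun i => fps_trunc d (F i)) (lform j) = A F d j.
Proof. by rewrite /psubst mmapD -!/(psubst _ _) psubstZ !psubstX !mmap1U. Qed.

Let A_U F d j i : (A F d.+1 j)@_U_(i) = lform_image F j i.
Proof. by rewrite mcoeffD mcoeffZ !fps_trunc_coef ?mdeg1. Qed.

Lemma vanish_order_lform j : vanish_order 1 (lform j).
Proof.
move=> m; rewrite ltnS leqn0 mdeg_eq0 => /eqP ->.
by rewrite mcoeffD mcoeffZ !mcoeffX !mnm1_eq0 mulr0 addr0.
Qed.

Lemma lform_Ul j i : (lform j)@_U_(lshift p i) = (i == j)%:R.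
Proof.
by rewrite mcoeffD mcoeffZ !mcoeffXU eq_sym eq_lshift eq_rlshift mulr0 addr0.
Qed.

Lemma lform_Ur j i : (lform j)@_U_(rshift p i) = c j * (i == tau j)%:R.
Proof.
by rewrite mcoeffD mcoeffZ !mcoeffXU eq_lrshift eq_rshift add0r [i == _]eq_sym.
Qed.

Lemma comp_quadratic_split F d j m : vanishes_at0 F -> (mdeg m <= d.+2)%N ->
  fps_comp (E j) F m = (A F d.+2 j ^+ 2)@_m +
    (psubst (fun i => fps_trunc d.+2 (F i)) (fps_trunc d.+2 (E j) - lform j ^+ 2))@_m.
Proof.
move=> F0 hm; rewrite (fps_comp_trunc _ F0 hm) -mcoeffD; congr (_@__).
rewrite [psubst _ (_ - _)]mmapB [mmap _ _ (_ ^+ 2)]rmorphXn /=.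
by rewrite -!/(psubst _ _) A_lform addrC subrK.
Qed.

Lemma cubic_remainder d j : vanish_order 3 (fps_trunc d.+2 (E j) - lform j ^+ 2).
Proof.
move=> m hm; rewrite mcoeffB fps_trunc_coef; last by lia.
by rewrite E2 ?subrr //; lia.
Qed.

Lemma vanish_order_trunc F d : vanishes_at0 F ->
  forall i : 'I_(p + p), vanish_order 1 (fps_trunc d (F i : fps C (p + p))).
Proof.
move=> F0 i m; rewrite ltnS leqn0 mdeg_eq0 => /eqP ->.
by rewrite fps_truncE F0 if_same.
Qed.

(** In degree 2, invariance of E_j reads L^2 = l^2, where l is the linear form and L its image. Thus
    (L + l)(L - l) has order 3, and a nonzero linear part of one factor forces that of the other to
    vanish. *)
Lemma deck_lin_sign F j : vanishes_at0 F -> fps_comp (E j) F = E j ->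
  (forall i, lform_image F j i = (lform j)@_U_(i)) \/
  (forall i, lform_image F j i = - (lform j)@_U_(i)).
Proof.
move=> F0 hF; case: (boolP [forall i, lform_image F j i == (lform j)@_U_(i)]) => [/forallP h|].
  by left => i; apply/eqP.
rewrite negb_forall => /existsP[i0 hi0]; right => i.
have h3 : vanish_order (2 + 1) ((A F 2 j + lform j) * (A F 2 j - lform j)).
  move=> m hm; rewrite mulrC -subr_sqr mcoeffB.
  have := @comp_quadratic_split F 0 j m F0 hm; rewrite hF E2 // => ->.
  by rewrite (vanish_order_psubst (vanish_order_trunc 2 F0) (@cubic_remainder 0 j)) // addr0 subrr.
have : vanish_order 2 (A F 2 j + lform j).
  apply: (@vanish_order_divr _ 2 1 _ _ U_(i0)%MM _ _ h3); first by rewrite mdeg1.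
  by rewrite mcoeffB A_U subr_eq0.
move=> /(_ U_(i)%MM); rewrite mdeg1 mcoeffD A_U => /(_ isT) /eqP.
by rewrite addr_eq0 => /eqP.
Qed.

(** If F and G agree up to degree d + 1, the cubic remainders of E_j(F) and E_j(G) agree up to
    degree d + 3, hence so do the squares of the images of the linear form. The sum of these images
    has linear part 2 L, which is nonzero, so dividing by it gives agreement of the images up to
    degree d + 2. The z-components being equal, this is agreement of the w-components. *)
Lemma deck_unique F G : vanishes_at0 F -> vanishes_at0 G ->
  (forall i, F (lshift p i) = G (lshift p i)) ->
  (forall j, fps_comp (E j) F = E j) -> (forall j, fps_comp (E j) G = E j) ->
  (forall j i, lform_image F j i = lform_image G j i) -> F = G.
Proof.
move=> F0 G0 FGl hF hG hl.
have F0U j : F (lshift p j) 0%MM = 0 by [].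
suff h d j m : (mdeg m <= d.+1)%N -> F (rshift p j) m = G (rshift p j) m.
  apply: functional_extensionality => i; apply: functional_extensionality => m.
  by case: (split_ordP i) => j ->; [rewrite FGl|apply: (h (mdeg m))].
elim: d j m => [|d IH] j m.
  rewrite leq_eqVlt ltnS leqn0 mdeg_eq0 => /orP[/mdeg1P[i /eqP ->]|/eqP ->]; last first.
    by rewrite F0 G0.
  have := hl (tau j) i; rewrite /lform_image tauK FGl => /addrI.
  exact: (mulfI (c_neq0 _)).
have [i hi] : exists i, (A F d.+3 (tau j) + A G d.+3 (tau j))@_U_(i) != 0.
  have e i : (A F d.+3 (tau j) + A G d.+3 (tau j))@_U_(i) = lform_image F (tau j) i *+ 2.
    by rewrite mcoeffD !A_U hl mulr2n.
  exists (lshift p (tau j)); rewrite e mulrn_eq0 /=.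
  by case: (deck_lin_sign F0 (hF (tau j))) => ->;
    rewrite ?oppr_eq0 lform_Ul eqxx oner_eq0.
have h3 : vanish_order (d.+3 + 1)
    ((A F d.+3 (tau j) - A G d.+3 (tau j)) * (A F d.+3 (tau j) + A G d.+3 (tau j))).
  move=> q; rewrite addn1 ltnS => hq; rewrite -subr_sqr mcoeffB.
  have eF := @comp_quadratic_split F d.+1 (tau j) q F0 hq.
  have eG := @comp_quadratic_split G d.+1 (tau j) q G0 hq.
  rewrite hF in eF; rewrite hG in eG; set RG := (X in _ + X) in eG.
  apply/eqP; rewrite subr_eq0; apply/eqP; apply: (addIr RG); rewrite -eG eF.
  congr (_ + _); apply/eqP; rewrite /RG -subr_eq0 -mcoeffB; apply/eqP.
  apply: (@vanish_order_psubstB _ _ _ 3 d.+1 _ _ _ (vanish_order_trunc d.+3 G0) (vanish_order_trunc d.+3 F0)).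
  - move=> l q' hq'; rewrite mcoeffB !fps_trunc_coef; [|lia..].
    by case: (split_ordP l) => a ->; rewrite ?FGl ?(IH a) ?subrr.
  - exact: cubic_remainder.
  - lia.
have h2 : vanish_order d.+3 (A F d.+3 (tau j) - A G d.+3 (tau j)).
  by apply: (@vanish_order_divr _ _ 1 _ _ U_(i)%MM _ hi h3); rewrite mdeg1.
move=> hm; have := h2 m hm.
rewrite /A tauK FGl opprD addrACA subrr add0r -scalerBr mcoeffZ mcoeffB.
move=> /eqP; rewrite mulf_eq0 (negbTE (c_neq0 _)) /= subr_eq0 => /eqP.
by rewrite !fps_trunc_coef //; lia.
Qed.

End Deck.
End DeckTransformations.

(** * The invariant manifold *)

Section InvariantManifold.
Context (C : numClosedFieldType).

(** The condition on q makes the map sending k to the family conj (k (tau j)) / q j an antilinear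
    involution, and r plus its image is a fixed point. Starting from r = 1 it is nonzero unless q j
    = -1, where r = 'i is taken instead. *)
Lemma antilinear_scale p (tau : 'I_p -> 'I_p) (q : 'I_p -> C) :
  involutive tau -> (forall j, q j * (q (tau j))^* = 1) ->
  exists k : 'I_p -> C, forall j, k j != 0 /\ (k (tau j))^* = q j * k j.
Proof.
move=> tauK hq.
have q0 j : q j != 0.
  by apply/eqP => h; have := hq j; rewrite h mul0r => /esym/eqP; rewrite oner_eq0.
have qt j : (q (tau j))^* = (q j)^-1.
  by rewrite -[LHS]mul1r -(mulVf (q0 j)) -mulrA hq mulr1.
pose r j : C := if q j == -1 then 'i else 1.
have r_tau j : r (tau j) = r j.
  suff e : (q (tau j) == -1) = (q j == -1) by rewrite /r e.
  rewrite -(inj_eq (inv_inj (@conjCK C))) qt rmorphN rmorph1 -(inj_eq (@invr_inj C)).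
  by rewrite invrK invrN invr1.
exists (fun j => r j + (r j)^* / q j) => j; split.
  rewrite /r; case: (q j =P -1) => [->|/eqP hj].
    by rewrite conjCi invrN invr1 mulrNN mulr1 -mulr2n mulrn_eq0 neq0Ci.
  apply: contra hj; rewrite rmorph1 mul1r addrC addr_eq0 => /eqP h.
  by rewrite -[q j]invrK h invrN invr1.
rewrite r_tau rmorphD rmorphM /= conjCK fmorphV /= qt invrK mulrDr mulrCA divff //.
by rewrite mulr1 addrC [r j * q j]mulrC.
Qed.

Section PartialFractions.
Context (x a b w w2 : C).
Hypotheses (w_ge0 : 0 <= w) (ww2 : w <= w2) (ab : a != b) (xa : x != a) (xb : x != b).
Hypotheses (ha : `|x - a|^-1 * w <= w2) (hb : `|x - b|^-1 * w <= w2).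

(** The three summands in the bracket serve the exponents 0, 1, 2 of [fraction_bound]; the leading 1
    is the polynomial part at exponent 2. *)
Definition fraction_const (a b : C) : C :=
  1 + `|a - b|^-1 * (1 + 1 + (`|a| + `|b|) + (`|a| ^+ 2 + `|b| ^+ 2)).

Let nz : (a - b != 0) * (x - a != 0) * (x - b != 0).
Proof. by rewrite !subr_eq0 ab xa xb. Qed.

Lemma fraction_bound0 s t : `|s / (x - a) - t / (x - b)| * w <= (`|s| + `|t|) * w2.
Proof.
apply: le_trans (ler_wpM2r w_ge0 (ler_normB _ _)) _.
by rewrite !mulrDl; apply: lerD; rewrite normrM normfV -mulrA ler_wpM2l.
Qed.

(** Partial fractions: a and b are distinct, so the product of two divisors is traded for a
    difference in which each term has a single divisor, and the weights absorb only one divisor at a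
    time. *)
Lemma fraction_bound e : (e <= 2)%N ->
  `|x ^+ e / ((x - a) * (x - b))| * w <= fraction_const a b * w2.
Proof.
have L0 : 0 <= `|a - b|^-1 by rewrite invr_ge0.
have w20 : 0 <= w2 := le_trans w_ge0 ww2.
have pos1 : 0 <= `|a| + `|b| by rewrite addr_ge0.
have pos2 : 0 <= `|a| ^+ 2 + `|b| ^+ 2 by rewrite addr_ge0 ?exprn_ge0.
have two : 0 <= 1 + 1 :> C by rewrite addr_ge0 ?ler01.
have key s t y : 0 <= y -> `|s| + `|t| = y ->
    `|(a - b)^-1 * (s / (x - a) - t / (x - b))| * w <= `|a - b|^-1 * y * w2.
  by move=> y0 <-; rewrite normrM normfV -!mulrA ler_wpM2l // fraction_bound0.
case: e => [|[|[|//]]] _.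
- have -> : x ^+ 0 / ((x - a) * (x - b)) =
      (a - b)^-1 * (1 / (x - a) - 1 / (x - b)) by field; rewrite !nz.
  apply: le_trans (key _ _ (1 + 1) _ _) _; rewrite ?normr1 //.
  rewrite ler_wpM2r // /fraction_const; apply: ler_wpDl => //.
  by rewrite ler_wpM2l // -addrA lerDl addr_ge0.
- have -> : x ^+ 1 / ((x - a) * (x - b)) =
      (a - b)^-1 * (a / (x - a) - b / (x - b)) by field; rewrite !nz.
  apply: le_trans (key a b _ pos1 erefl) _.
  rewrite ler_wpM2r // /fraction_const; apply: ler_wpDl => //.
  by rewrite ler_wpM2l // -addrA addrCA lerDl addr_ge0.
- have -> : x ^+ 2 / ((x - a) * (x - b)) =
      1 + (a - b)^-1 * (a ^+ 2 / (x - a) - b ^+ 2 / (x - b)) by field; rewrite !nz.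
  apply: le_trans (ler_wpM2r w_ge0 (ler_normD _ _)) _.
  rewrite /fraction_const [leLHS]mulrDl [leRHS]mulrDl normr1 !mul1r; apply: lerD => //.
  have e2 : `|a ^+ 2| + `|b ^+ 2| = `|a| ^+ 2 + `|b| ^+ 2 by rewrite !normrX.
  apply: le_trans (key _ _ _ pos2 e2) _.
  by rewrite ler_wpM2r // ler_wpM2l // lerDr addr_ge0.
Qed.

End PartialFractions.

End InvariantManifold.

Section InvariantManifold.
Context (C : numClosedFieldType) (p : nat) (tau : 'I_p -> 'I_p) (g nu : 'I_p -> C).
Context (T : 'I_p -> fps C (p + p)).
Hypotheses (tauK : involutive tau) (nu_neq0 : forall j, nu j != 0).
Hypotheses (nu_conj : forall j, (nu (tau j))^* = (nu j)^-1)
  (nu_neqV : forall j, nu j != (nu j)^-1)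
  (g_nu : forall j, g j * (g (tau j))^* = (1 + nu j) * (1 + (nu j)^-1)).
Hypotheses (T0 : vanishes_at0 T) (T_conv : forall l, convergent (T l))
  (T_Ul : forall l i, T l U_(lshift p i)%MM = - g (tau l) * (i == tau l)%:R)
  (T_Ur : forall l i, T l U_(rshift p i)%MM = - (i == l)%:R).

Definition swap_half (i : 'I_(p + p)) : 'I_(p + p) :=
  match split i with inl a => rshift p a | inr b => lshift p b end.

Lemma swap_halfl a : swap_half (lshift p a) = rshift p a.
Proof. by rewrite /swap_half (unsplitK (inl a)). Qed.

Lemma swap_halfr a : swap_half (rshift p a) = lshift p a.
Proof. by rewrite /swap_half (unsplitK (inr a)). Qed.

Lemma swap_halfK : involutive swap_half.
Proof.
by move=> l; case: (split_ordP l) => a ->; rewrite ?swap_halfl ?swap_halfr ?swap_halfl.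
Qed.

Definition swap_vars (i : 'I_(p + p)) : fps C (p + p) := fps_var C (swap_half i).

(* T read on the other factor of the complexification: conj (T_j) (w, z). *)
Definition conj_swap j : fps C (p + p) := fps_comp (fps_conj (T j)) swap_vars.

Lemma swap_vars0 : vanishes_at0 swap_vars.
Proof. by move=> i; apply: vanishes_at0_var. Qed.

Lemma fps_var_U n (i j : 'I_n) : fps_var C i U_(j)%MM = (i == j)%:R.
Proof. by rewrite -fps_lin1 fps_lin_U mxE. Qed.

Lemma conj_swap0 : vanishes_at0 conj_swap.
Proof. by move=> j; rewrite /conj_swap fps_comp_const ?/fps_conj ?T0 ?rmorph0 //; apply: swap_vars0. Qed.

Lemma conj_swap_U j i : conj_swap j U_(i)%MM = (T j U_(swap_half i)%MM)^*.
Proof.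
rewrite /conj_swap fps_comp_U; last exact: swap_vars0.
rewrite (bigD1 (swap_half i)) //= /swap_vars swap_halfK fps_var_U eqxx mulr1 big1 ?addr0 //.
by move=> l hl; rewrite fps_var_U (can2_eq swap_halfK swap_halfK) (negbTE hl) mulr0.
Qed.

Lemma conj_swap_conv j : convergent (conj_swap j).
Proof.
apply: convergent_comp; [exact: swap_vars0|exact: convergent_conj|].
by move=> i; apply: convergent_var.
Qed.

Let gs j := (g (tau j))^*.

Definition nonlin (i : 'I_(p + p)) : fps C (p + p) :=
  match split i with
  | inl j => nonlinear_part conj_swap j
  | inr l => nonlinear_part T l
  end.

Lemma nonlinl j : nonlin (lshift p j) = nonlinear_part conj_swap j.
Proof. by rewrite /nonlin (unsplitK (inl j)). Qed.

Lemma nonlinr l : nonlin (rshift p l) = nonlinear_part T l.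
Proof. by rewrite /nonlin (unsplitK (inr l)). Qed.

Lemma nonlin_low i m : (mdeg m < 2)%N -> nonlin i m = 0.
Proof.
case: (split_ordP i) => a ->; rewrite ?nonlinl ?nonlinr; apply: nonlinear_part_low => //.
exact: conj_swap0.
Qed.

Lemma nonlin_conv i : convergent (nonlin i).
Proof.
case: (split_ordP i) => a ->; rewrite ?nonlinl ?nonlinr; apply: convergent_nonlinear_part => //.
exact: conj_swap_conv.
Qed.

Definition det2 j x := (1 + x) * (1 + x^-1) - g j * gs j.

Lemma det2E j x : x != 0 -> det2 j x = (x - nu j) * (x - (nu j)^-1) / x.
Proof. by move=> x0; rewrite /det2 g_nu; field; rewrite x0 nu_neq0. Qed.

Lemma det2_neq0 j x : x != 0 -> x != nu j -> x != (nu j)^-1 -> det2 j x != 0.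
Proof. by move=> x0 h1 h2; rewrite det2E // !mulf_neq0 ?invr_eq0 ?subr_eq0. Qed.

(** Cramer's rule for the unknowns z_j and w_(tau j), which the equations couple; w_l therefore
    belongs to the system of index [tau l]. *)
Definition solve_pair (m : 'X_{1..p}) (b : 'I_(p + p) -> C) (i : 'I_(p + p)) : C :=
  let x := monomial_value nu m in
  match split i with
  | inl j => ((1 + x) * b (lshift p j) - gs j * b (rshift p (tau j))) / det2 j x
  | inr l => ((1 + x^-1) * b (rshift p l) - g (tau l) * b (lshift p (tau l))) / det2 (tau l) x
  end.

Lemma solve_pairl m b j : let x := monomial_value nu m in
  solve_pair m b (lshift p j) =
  ((1 + x) * b (lshift p j) - gs j * b (rshift p (tau j))) / det2 j x.
Proof. by rewrite /solve_pair (unsplitK (inl j)). Qed.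

Lemma solve_pairr m b l : let x := monomial_value nu m in
  solve_pair m b (rshift p l) =
  ((1 + x^-1) * b (rshift p l) - g (tau l) * b (lshift p (tau l))) / det2 (tau l) x.
Proof. by rewrite /solve_pair (unsplitK (inr l)). Qed.

Lemma monomial_value_neq0 m : monomial_value nu m != 0.
Proof. by apply/prodf_neq0 => i _; rewrite expf_neq0. Qed.

Context (v v2 : 'X_{1..p} -> C) (rho : C).
Hypotheses (v_ge0 : forall m, 0 <= v m) (v2_ge0 : forall m, 0 <= v2 m)
  (vv : submult v v) (vv2 : submult v v2) (rho_gt0 : 0 < rho)
  (rho_v : forall m, rho ^+ mdeg m <= v m).
Hypothesis small_div : forall m, (1 < mdeg m)%N -> v m <= v2 m /\ forall i,
  [/\ monomial_value nu m != nu i, monomial_value nu m != (nu i)^-1,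
      `|monomial_value nu m - nu i|^-1 * v m <= v2 m &
      `|monomial_value nu m - (nu i)^-1|^-1 * v m <= v2 m].

(** Since 1 / det2 is x over the product of the two divisors, the entries of the inverse matrix are
    combinations of the fractions with numerator 1, x or x^2. This makes the bound uniform in x =
    nu^m, whose modulus may be arbitrarily large or small. *)
Lemma solve_bound : exists2 K, 0 <= K & forall m b i, (1 < mdeg m)%N ->
  `|solve_pair m b i| * v m <= K * v2 m * \sum_j `|b j|.
Proof.
pose Kj j := fraction_const (nu j) (nu j)^-1 * (2 + `|g j| + `|gs j|).
have fc0 j : 0 <= fraction_const (nu j) (nu j)^-1.
  by rewrite /fraction_const addr_ge0 ?ler01 // mulr_ge0 ?invr_ge0 // !addr_ge0 ?ler01 ?exprn_ge0.
have Kj0 j : 0 <= Kj j by rewrite mulr_ge0 // !addr_ge0 ?ler0n.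
have K_ge j : Kj j <= \sum_l Kj l.
  by rewrite (bigD1 j) //= lerDl sumr_ge0.
exists (\sum_j Kj j); first exact: sumr_ge0.
move=> m b i hm; have [vm hdiv] := small_div hm.
set x := monomial_value nu m in hdiv *; have x0 : x != 0 := monomial_value_neq0 m.
have b_le l : `|b l| <= \sum_j `|b j| by rewrite (bigD1 l) //= lerDl sumr_ge0.
have S0 : 0 <= \sum_j `|b j| by apply: sumr_ge0.
have gen j (s t y : C) (l k : 'I_(p + p)) :
    `|s| * v m <= 2 * fraction_const (nu j) (nu j)^-1 * v2 m ->
    `|t| * v m <= y * fraction_const (nu j) (nu j)^-1 * v2 m -> y <= `|g j| + `|gs j| ->
    `|s * b l - t * b k| * v m <= (\sum_j Kj j) * v2 m * \sum_j `|b j|.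
  move=> hs ht hy.
  apply: le_trans (ler_wpM2r (v_ge0 m) (ler_normB _ _)) _; rewrite mulrDl.
  apply: (@le_trans _ _ (Kj j * v2 m * \sum_j `|b j|)); last first.
    by rewrite !ler_wpM2r // v2_ge0.
  have -> : Kj j * v2 m * \sum_j `|b j| =
     2 * fraction_const (nu j) (nu j)^-1 * v2 m * (\sum_j `|b j|) +
     (`|g j| + `|gs j|) * fraction_const (nu j) (nu j)^-1 * v2 m * (\sum_j `|b j|).
    by rewrite /Kj; ring.
  apply: lerD.
    rewrite normrM mulrAC; apply: ler_pM => //; by rewrite mulr_ge0.
  rewrite normrM mulrAC; apply: ler_pM => //; first by rewrite mulr_ge0.
  by apply: le_trans ht _; rewrite !ler_wpM2r ?v2_ge0.
have frac j e : (e <= 2)%N ->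
    `|x ^+ e / ((x - nu j) * (x - (nu j)^-1))| * v m <= fraction_const (nu j) (nu j)^-1 * v2 m.
  by case: (hdiv j) => h1 h2 h3 h4; apply: fraction_bound.
have dE j e : x ^+ e / det2 j x = x ^+ e.+1 / ((x - nu j) * (x - (nu j)^-1)).
  by rewrite det2E // invf_div mulrA -exprSr.
have dE' j : x^-1 / det2 j x = x ^+ 0 / ((x - nu j) * (x - (nu j)^-1)).
  by rewrite det2E // invf_div mulrA mulVf.
have gfrac j (y : C) e : (e <= 2)%N -> `|y * (x ^+ e / ((x - nu j) * (x - (nu j)^-1)))| * v m <=
    `|y| * fraction_const (nu j) (nu j)^-1 * v2 m.
  by move=> he; rewrite normrM -!mulrA ler_wpM2l //; apply: frac.
have sum2 j e e' : (e <= 2)%N -> (e' <= 2)%N ->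
    `|x ^+ e / ((x - nu j) * (x - (nu j)^-1)) + x ^+ e' / ((x - nu j) * (x - (nu j)^-1))| * v m
    <= 2 * fraction_const (nu j) (nu j)^-1 * v2 m.
  move=> he he'; apply: le_trans (ler_wpM2r (v_ge0 m) (ler_normD _ _)) _.
  have -> : 2 * fraction_const (nu j) (nu j)^-1 * v2 m =
    fraction_const (nu j) (nu j)^-1 * v2 m + fraction_const (nu j) (nu j)^-1 * v2 m by ring.
  by rewrite mulrDl; apply: lerD; apply: frac.
have gs_frac j (y : C) : y / det2 j x = y * (x ^+ 1 / ((x - nu j) * (x - (nu j)^-1))).
  by rewrite -(dE j 0) expr0 mul1r.
case: (split_ordP i) => j ->.
  rewrite solve_pairl -/x mulrBl mulrAC [gs j * _ / _]mulrAC.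
  apply: (gen j _ _ `|gs j|); last by rewrite lerDr.
    have -> : (1 + x) / det2 j x = x ^+ 1 / ((x - nu j) * (x - (nu j)^-1)) +
        x ^+ 2 / ((x - nu j) * (x - (nu j)^-1)).
      by rewrite -!dE expr0 expr1 mulrDl.
    exact: sum2.
  by rewrite gs_frac; apply: gfrac.
rewrite solve_pairr -/x mulrBl mulrAC [g _ * _ / _]mulrAC.
apply: (gen (tau j) _ _ `|g (tau j)|); last by rewrite lerDl.
  have -> : (1 + x^-1) / det2 (tau j) x =
      x ^+ 1 / ((x - nu (tau j)) * (x - (nu (tau j))^-1)) +
      x ^+ 0 / ((x - nu (tau j)) * (x - (nu (tau j))^-1)).
    by rewrite -dE -dE' expr0 mulrDl.
  exact: sum2.
by rewrite gs_frac; apply: gfrac.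
Qed.

Context (a : 'I_p -> C).
Hypothesis a_eq : forall j, (1 + nu j) * (a (tau j))^* = - g j * a j.

Lemma a_eq' j : (1 + (nu j)^-1) * a j = - gs j * (a (tau j))^*.
Proof.
have := congr1 Num.conj (a_eq (tau j)).
by rewrite !rmorphM rmorphD rmorphN /= rmorph1 nu_conj tauK conjCK.
Qed.

(** At the monomial xi_j the value x = nu j annihilates the determinant. The linear part is taken in
    the kernel, with its w-component conjugate to its z-component; [a_eq] is the kernel
    condition. *)
Definition linear_part : 'M[C]_(p + p, p) :=
  \matrix_(i, k) match split i with
                 | inl j => a j * (k == j)%:R
                 | inr l => (a l)^* * (k == tau l)%:R
                 end.

Lemma linear_partl j k : linear_part (lshift p j) k = a j * (k == j)%:R.
Proof. by rewrite mxE (unsplitK (inl j)). Qed.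

Lemma linear_partr l k : linear_part (rshift p l) k = (a l)^* * (k == tau l)%:R.
Proof. by rewrite mxE (unsplitK (inr l)). Qed.

Definition diag_sub (f : 'I_p -> C) : 'I_p -> fps C p := fps_lin (diag_mx (\row_j f j)).

Lemma fps_comp_diag_sub (f : fps C p) (c : 'I_p -> C) m :
  fps_comp f (diag_sub c) m = monomial_value c m * f m.
Proof.
rewrite fps_comp_diag; congr (_ * _).
by apply: eq_bigr => i _; rewrite mxE.
Qed.

Lemma monomial_valueV m :
  monomial_value (fun j => (nu j)^-1) m = (monomial_value nu m)^-1.
Proof. by rewrite /monomial_value -prodfV; apply: eq_bigr => i _; rewrite exprVn. Qed.

Implicit Types u : 'I_(p + p) -> fps C p.

Lemma comp_T u l m : vanishes_at0 u ->
  fps_comp (T l) u m = - g (tau l) * u (lshift p (tau l)) m - u (rshift p l) m +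
                       fps_comp (nonlin (rshift p l)) u m.
Proof.
move=> u0; rewrite nonlinr fps_comp_nonlinear // big_split_ord /=; congr (_ + _ + _).
  rewrite (bigD1 (tau l)) //= mxE T_Ul eqxx mulr1 big1 ?addr0 // => i hi.
  by rewrite mxE T_Ul (negbTE hi) mulr0 mul0r.
rewrite (bigD1 l) //= mxE T_Ur eqxx mulN1r big1 ?addr0 // => i hi.
by rewrite mxE T_Ur (negbTE hi) oppr0 mul0r.
Qed.

Lemma comp_conj_swap u j m : vanishes_at0 u ->
  fps_comp (conj_swap j) u m = - u (lshift p j) m - gs j * u (rshift p (tau j)) m +
                       fps_comp (nonlin (lshift p j)) u m.
Proof.
move=> u0; rewrite nonlinl fps_comp_nonlinear // big_split_ord /=; congr (_ + _ + _).
  rewrite (bigD1 j) //= mxE conj_swap_U swap_halfl T_Ur eqxx rmorphN rmorph1 mulN1r.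
  rewrite big1 ?addr0 // => i hi.
  by rewrite mxE conj_swap_U swap_halfl T_Ur (negbTE hi) oppr0 rmorph0 mul0r.
rewrite (bigD1 (tau j)) //= mxE conj_swap_U swap_halfr T_Ul eqxx mulr1 rmorphN mulNr.
rewrite big1 ?addr0 // => i hi.
by rewrite mxE conj_swap_U swap_halfr T_Ul (negbTE hi) mulr0 rmorph0 mul0r.
Qed.

Definition invariance_equations u :=
  (forall l, fps_comp (u (rshift p l)) (diag_sub nu) = fps_comp (T l) u) /\
  (forall j, fps_comp (u (lshift p j)) (diag_sub (fun j => (nu j)^-1)) =
             fps_comp (conj_swap j) u).

Lemma solve_sys j x (Z W N1 N2 : C) : x != 0 -> x != nu j -> x != (nu j)^-1 ->
  (x * W = - g j * Z - W + N1 /\ x^-1 * Z = - Z - gs j * W + N2) <->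
  (Z = ((1 + x) * N2 - gs j * N1) / det2 j x /\
   W = ((1 + x^-1) * N1 - g j * N2) / det2 j x).
Proof.
move=> x0 h1 h2; have d0 := det2_neq0 x0 h1 h2; split.
  move=> [e1 e2].
  have -> : N1 = (1 + x) * W + g j * Z.
    by rewrite mulrDl mul1r e1; ring.
  have -> : N2 = (1 + x^-1) * Z + gs j * W.
    by rewrite mulrDl mul1r e2; ring.
  by split; apply: (mulIf d0); rewrite divfK // /det2; ring.
move=> [-> ->].
have e1 : (1 + x) * ((1 + x^-1) * N1 - g j * N2) + g j * ((1 + x) * N2 - gs j * N1) =
    N1 * det2 j x by rewrite /det2; ring.
have e2 : gs j * ((1 + x^-1) * N1 - g j * N2) + (1 + x^-1) * ((1 + x) * N2 - gs j * N1) =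
    N2 * det2 j x by rewrite /det2; ring.
move: e1 e2; set Y := _ - g j * N2; set V := _ - gs j * N1 => e1 e2; split.
  by rewrite -[N1](mulfK d0) -e1; ring.
by rewrite -[N2](mulfK d0) -e2; ring.
Qed.

Section Solution.
Context (u : 'I_(p + p) -> fps C p).
Hypothesis hu : recursive_solution nonlin (fps_lin linear_part) solve_pair u.

Lemma solution0 : vanishes_at0 u.
Proof. by move=> i; rewrite hu mdeg0 /= vanishes_at0_lin. Qed.

Lemma solution_U i k : u i U_(k)%MM = linear_part i k.
Proof. by rewrite hu mdeg1 /= fps_lin_U. Qed.

Lemma low_cases (P : 'X_{1..p} -> Prop) : P 0%MM -> (forall k, P U_(k)%MM) ->
  (forall m, (1 < mdeg m)%N -> P m) -> forall m, P m.
Proof.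
move=> P0 P1 P2 m; case: (ltnP 1 (mdeg m)) => [/P2 //|].
rewrite leq_eqVlt => /orP[/mdeg1P[k /eqP ->] //|].
by rewrite ltnS leqn0 mdeg_eq0 => /eqP ->.
Qed.

Lemma solution_pair j m : (1 < mdeg m)%N ->
  let x := monomial_value nu m in
  let W := u (rshift p (tau j)) m in let Z := u (lshift p j) m in
  x * W = - g j * Z - W + fps_comp (nonlin (rshift p (tau j))) u m /\
  x^-1 * Z = - Z - gs j * W + fps_comp (nonlin (lshift p j)) u m.
Proof.
move=> hm x W Z; have [_ /(_ j)[h1 h2 _ _]] := small_div hm.
apply/(solve_sys _ _ _ _ (monomial_value_neq0 m)) => //.
by rewrite /Z /W !hu hm solve_pairl solve_pairr tauK.
Qed.

Lemma solution_equations : invariance_equations u.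
Proof.
have u0 := solution0.
split=> l; apply: functional_extensionality; apply: low_cases.
- by rewrite fps_comp_diag_sub !fps_comp_const // u0 mulr0 T0.
- move=> k; rewrite fps_comp_diag_sub comp_T // !solution_U linear_partl linear_partr.
  rewrite (fps_comp_vanish u0 (@nonlin_low _)) ?mdeg1 // addr0 monomial_valueU.
  case: eqP => [->|_]; last by rewrite !mulr0 !oppr0 ?addr0 ?mulr0.
  rewrite !mulr1.
  have := a_eq (tau l); rewrite tauK mulrDl mul1r => <-.
  by rewrite addrAC subrr add0r.
- move=> m hm; rewrite fps_comp_diag_sub comp_T //.
  by have [] := solution_pair (tau l) hm; rewrite tauK.
- by rewrite fps_comp_diag_sub !fps_comp_const // u0 mulr0 conj_swap0.
- move=> k; rewrite fps_comp_diag_sub comp_conj_swap // !solution_U linear_partl linear_partr tauK.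
  rewrite (fps_comp_vanish u0 (@nonlin_low _)) ?mdeg1 // addr0 monomial_valueU.
  case: eqP => [->|_]; last by rewrite !mulr0 !oppr0 ?addr0 ?mulr0.
  rewrite !mulr1.
  by rewrite -mulNr -a_eq' mulrDl mul1r addrA addNr add0r.
- move=> m hm; rewrite fps_comp_diag_sub monomial_valueV comp_conj_swap //.
  by have [] := solution_pair l hm.
Qed.

End Solution.

(** This converse of [solution_equations] opens the uniqueness of the recursion to a series known
    only through the equations, namely the conjugate solution. *)
Lemma equations_solution u : vanishes_at0 u ->
  (forall i k, u i U_(k)%MM = linear_part i k) -> invariance_equations u ->
  recursive_solution nonlin (fps_lin linear_part) solve_pair u.
Proof.
move=> u0 uU [eW eZ] i; apply: low_cases.
- by rewrite mdeg0 /= vanishes_at0_lin u0.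
- by move=> k; rewrite mdeg1 /= fps_lin_U uU.
move=> m hm; rewrite hm; have [_ hdiv] := small_div hm.
have pair j : u (lshift p j) m = solve_pair m (fun i => fps_comp (nonlin i) u m) (lshift p j) /\
    u (rshift p (tau j)) m = solve_pair m (fun i => fps_comp (nonlin i) u m) (rshift p (tau j)).
  rewrite solve_pairl solve_pairr tauK; case: (hdiv j) => h1 h2 _ _.
  apply/(solve_sys _ _ _ _ (monomial_value_neq0 m) h1 h2); split.
    have := congr1 (fun f => f m) (eW (tau j)).
    by rewrite /= fps_comp_diag_sub comp_T // tauK.
  have := congr1 (fun f => f m) (eZ j).
  by rewrite /= fps_comp_diag_sub monomial_valueV comp_conj_swap.
case: (split_ordP i) => j ->; first by case: (pair j).
by case: (pair (tau j)); rewrite tauK.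
Qed.

Definition flip_mx : 'M[C]_p := \matrix_(i, j) (j == tau i)%:R.

(** The conjugate of f on the real form conj xi_j = xi_(tau j), written again as a series in xi. *)
Definition conj_flip (f : fps C p) : fps C p := fps_comp (fps_conj f) (fps_lin flip_mx).

Lemma fps_comp_lin_lin n k l (f : fps C n) (M : 'M[C]_(n, k)) (N : 'M[C]_(k, l)) :
  fps_comp (fps_comp f (fps_lin M)) (fps_lin N) = fps_comp f (fps_lin (M *m N)).
Proof.
rewrite fps_compA; [|exact: vanishes_at0_lin|exact: vanishes_at0_lin].
by congr (fps_comp f _); apply: functional_extensionality => i; rewrite fps_lin_mul.
Qed.

Lemma fps_conj_comp_lin n k (f : fps C n) (M : 'M[C]_(n, k)) :
  fps_conj (fps_comp f (fps_lin M)) = fps_comp (fps_conj f) (fps_lin (map_mx Num.conj M)).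
Proof.
rewrite fps_conj_comp; last exact: vanishes_at0_lin.
by congr (fps_comp _ _); apply: functional_extensionality => i; rewrite fps_conj_lin.
Qed.

Lemma mul_flip_mx n (M : 'M[C]_(p, n)) i j : (flip_mx *m M) i j = M (tau i) j.
Proof.
rewrite mxE (bigD1 (tau i)) //= mxE eqxx mul1r big1 ?addr0 // => l hl.
by rewrite mxE (negbTE hl) mul0r.
Qed.

Lemma flip_diag (b c : 'I_p -> C) : (forall j, b (tau j) = (c j)^*) ->
  flip_mx *m diag_mx (\row_j b j) = map_mx Num.conj (diag_mx (\row_j c j)) *m flip_mx.
Proof.
move=> h; apply/matrixP => i j; rewrite mul_flip_mx [RHS]mxE (bigD1 i) //= big1 => [|l hl].
  rewrite !mxE !eqxx mulr1n h addr0 [j == _]eq_sym.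
  by case: eqP => _; rewrite ?mulr1n ?mulr0n ?mulr1 ?mulr0.
by rewrite !mxE eq_sym (negbTE hl) rmorph0 mul0r.
Qed.

Lemma fps_conj_var n i : fps_conj (fps_var C i) = fps_var C i :> fps C n.
Proof. by apply: functional_extensionality => m; rewrite /fps_conj /fps_var rmorph_nat. Qed.

Lemma vanishes_at0_conj n k (F : 'I_k -> fps C n) :
  vanishes_at0 F -> vanishes_at0 (fun i => fps_conj (F i)).
Proof. by move=> F0 i; rewrite /fps_conj F0 rmorph0. Qed.

(** * Reality of the solution *)

Section Reality.
Context (u : 'I_(p + p) -> fps C p).
Hypothesis hu : recursive_solution nonlin (fps_lin linear_part) solve_pair u.

Definition conj_solution i : fps C p := conj_flip (u (swap_half i)).

Let u0 : vanishes_at0 u := solution0 hu.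

Lemma conj_solution0 : vanishes_at0 conj_solution.
Proof.
move=> i; rewrite /conj_solution /conj_flip fps_comp_const; last exact: vanishes_at0_lin.
exact: (vanishes_at0_conj u0).
Qed.

Lemma conj_solution_U i k : conj_solution i U_(k)%MM = linear_part i k.
Proof.
rewrite /conj_solution /conj_flip fps_comp_U; last exact: vanishes_at0_lin.
have -> : \sum_j fps_conj (u (swap_half i)) U_(j)%MM * fps_lin flip_mx j U_(k)%MM =
   (u (swap_half i) U_(tau k)%MM)^*.
  rewrite (bigD1 (tau k)) //= fps_lin_U mxE tauK eqxx mulr1 big1 ?addr0 // => l hl.
  by rewrite fps_lin_U mxE -(can2_eq tauK tauK) eq_sym (negbTE hl) mulr0.
rewrite (solution_U hu); case: (split_ordP i) => j ->.
  rewrite swap_halfl linear_partl linear_partr rmorphM /= conjCK rmorph_nat.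
  by rewrite (inj_eq (inv_inj tauK)).
by rewrite swap_halfr linear_partl linear_partr rmorphM rmorph_nat (can2_eq tauK tauK).
Qed.

Lemma conj_solution_eq (f : fps C p) (b c : 'I_p -> C) (H : fps C (p + p)) :
  (forall j, b (tau j) = (c j)^*) -> fps_comp f (diag_sub c) = fps_comp H u ->
  fps_comp (conj_flip f) (diag_sub b) =
    fps_comp (fps_conj H) (fun i => conj_solution (swap_half i)).
Proof.
move=> hbc hf; rewrite /conj_flip /diag_sub fps_comp_lin_lin (flip_diag hbc).
rewrite -fps_comp_lin_lin -fps_conj_comp_lin -/(diag_sub c) hf fps_conj_comp //.
rewrite fps_compA; [|exact: vanishes_at0_conj|exact: vanishes_at0_lin].
congr (fps_comp _ _); apply: functional_extensionality => i.
by rewrite /conj_solution swap_halfK.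
Qed.

(** Conjugation with the flip exchanges the two invariance equations, because the conjugate of (nu
    j)^-1 is nu (tau j), and it preserves the linear part. *)
Lemma conj_solutionE : conj_solution = u.
Proof.
have [eW eZ] := solution_equations hu.
apply: (recursive_solution_unique nonlin_low _ _ hu).
  by move=> i m hm; apply: fps_lin_deg.
apply: equations_solution; [exact: conj_solution0|exact: conj_solution_U|split=> j].
  rewrite /conj_solution swap_halfr (conj_solution_eq (c := fun j => (nu j)^-1) _ (eZ j)).
    rewrite /conj_swap fps_conj_comp ?fps_conjK; last exact: swap_vars0.
    have -> : (fun i => fps_conj (swap_vars i)) = swap_vars.
      by apply: functional_extensionality => i; rewrite /swap_vars fps_conj_var.
    have sw0 : vanishes_at0 (fun i => conj_solution (swap_half i)).
      by move=> i; apply: conj_solution0.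
    rewrite fps_compA; [|exact: swap_vars0|exact: sw0].
    congr (fps_comp _ _); apply: functional_extensionality => i.
    by rewrite fps_comp_varl // swap_halfK.
  by move=> k; rewrite fmorphV /= -[X in (nu X)^*]tauK nu_conj invrK.
rewrite /conj_solution swap_halfl (conj_solution_eq (c := nu) _ (eW j)).
  rewrite /conj_swap fps_compA; [|exact: swap_vars0|exact: conj_solution0].
  congr (fps_comp _ _); apply: functional_extensionality => i.
  by rewrite fps_comp_varl //; apply: conj_solution0.
by move=> k; rewrite -nu_conj tauK.
Qed.

End Reality.

Definition with_conj (z : 'I_p -> fps C p) (i : 'I_(p + p)) : fps C p :=
  match split i with inl j => z j | inr l => conj_flip (z l) end.

Lemma with_conjl z j : with_conj z (lshift p j) = z j.
Proof. by rewrite /with_conj (unsplitK (inl j)). Qed.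

Lemma with_conjr z l : with_conj z (rshift p l) = conj_flip (z l).
Proof. by rewrite /with_conj (unsplitK (inr l)). Qed.

Lemma invariant_manifold : exists z : 'I_p -> fps C p,
  [/\ vanishes_at0 z, forall j, convergent (z j),
      jacobian0 z = diag_mx (\row_j a j) &
      forall l, fps_comp (conj_flip (z l)) (diag_sub nu) = fps_comp (T l) (with_conj z)].
Proof.
have L1 i m : mdeg m != 1%N -> fps_lin linear_part i m = 0 by apply: fps_lin_deg.
have [u hu] := recursive_solution_exists solve_pair nonlin_low L1.
have uE i : u i = conj_flip (u (swap_half i)) by rewrite -{1}(conj_solutionE hu).
pose z j := u (lshift p j).
have uz : u = with_conj z.
  apply: functional_extensionality => i; case: (split_ordP i) => j ->.
    by rewrite with_conjl.
  by rewrite with_conjr uE swap_halfr.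
exists z; split.
- by move=> j; apply: (solution0 hu).
- move=> j; have [K K0 hK] := solve_bound.
  exact: (solution_convergent nonlin_low L1 hu v_ge0 v2_ge0 vv vv2 K0 hK nonlin_conv rho_gt0 rho_v).
- apply/matrixP => i j; rewrite !mxE /z (solution_U hu) linear_partl.
  by rewrite eq_sym; case: eqP => _; rewrite ?mulr1 ?mulr0.
move=> l; have [eW _] := solution_equations hu.
by rewrite -uz -eW -(with_conjr z l) -uz.
Qed.

End InvariantManifold.

(** * The attached submanifold *)

Section Attached.
Context (C : numClosedFieldType) (p : nat) (tau : 'I_p -> 'I_p) (nu a : 'I_p -> C).
Context (E T : 'I_p -> fps C (p + p)) (z : 'I_p -> fps C p).
Hypotheses (tauK : involutive tau) (nu_neq1 : forall j, nu j != 1)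
  (nu_conj : forall j, nu j * (nu (tau j))^* = 1) (a_neq0 : forall j, a j != 0).
Hypotheses (E_conv : forall j, convergent (E j))
  (E_low : forall j m, (mdeg m < 2)%N -> E j m = 0).
Hypotheses (T0 : vanishes_at0 T).

Definition with_T (i : 'I_(p + p)) : fps C (p + p) :=
  match split i with inl j => fps_var C (lshift p j) | inr l => T l end.

Hypothesis ET : forall j, fps_comp (E j) with_T = E j.
Hypotheses (z0 : vanishes_at0 z) (z_conv : forall j, convergent (z j))
  (z_jac : jacobian0 z = diag_mx (\row_j a j)).

Local Notation S := (flip_mx C tau).
Local Notation flipped := (conj_flip tau).
Local Notation zw := (with_conj tau z).

Hypothesis z_T : forall l, fps_comp (flipped (z l)) (diag_sub nu) = fps_comp (T l) zw.

Definition zpp j : fps C p := fps_comp (E j) zw.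

Lemma zw0 : vanishes_at0 zw.
Proof.
move=> i; case: (split_ordP i) => j ->; rewrite ?with_conjl ?with_conjr //.
rewrite /conj_flip fps_comp_const; last exact: vanishes_at0_lin.
by rewrite /fps_conj z0 rmorph0.
Qed.

Lemma E_vanishes : vanishes_at0 E. Proof. by move=> j; rewrite E_low ?mdeg0. Qed.

Lemma zpp0 : vanishes_at0 zpp.
Proof. by move=> j; rewrite /zpp fps_comp_const ?E_vanishes //; apply: zw0. Qed.

Lemma zpp_conv j : convergent (zpp j).
Proof.
apply: convergent_comp => //; first exact: zw0.
move=> i; case: (split_ordP i) => l ->; rewrite ?with_conjl ?with_conjr //.
apply: convergent_comp; [exact: vanishes_at0_lin|exact: convergent_conj|].
by move=> k; apply: convergent_lin.
Qed.

Lemma E_jacobian0 : jacobian0 E = 0.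
Proof. by apply/matrixP => i j; rewrite !mxE E_low ?mdeg1. Qed.

Lemma zpp_jacobian0 : jacobian0 zpp = 0.
Proof. by rewrite /zpp jacobian0_comp ?E_jacobian0 ?mul0mx //; apply: zw0. Qed.

(* The points (z (xi), w (D xi)) of the fibre, for the two choices D = 1 and D = nu. *)
Definition fibre (D : 'M[C]_p) (i : 'I_(p + p)) : fps C p :=
  match split i with
  | inl j => z j
  | inr l => fps_comp (flipped (z l)) (fps_lin D)
  end.

Lemma zpp_fibre_nu j : zpp j = fps_comp (E j) (fibre (diag_mx (\row_j nu j))).
Proof.
rewrite /zpp -{1}ET fps_compA.
- congr (fps_comp _ _); apply: functional_extensionality => i.
  rewrite /with_T /fibre; case: (split i) => l; last by rewrite -z_T.
  by rewrite fps_comp_varl ?with_conjl //; apply: zw0.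
- move=> i; case: (split_ordP i) => l ->; rewrite /with_T ?(unsplitK (inl l)) ?(unsplitK (inr l)) //.
  exact: vanishes_at0_var.
- exact: zw0.
Qed.

Lemma zpp_fibre_1 j : zpp j = fps_comp (E j) (fibre 1%:M).
Proof.
rewrite /zpp; congr (fps_comp _ _); apply: functional_extensionality => i.
by rewrite /fibre /with_conj; case: (split i) => l //; rewrite fps_lin1 fps_comp_varr.
Qed.

Definition param (A : 'M[C]_p) (i : 'I_(p + p)) : fps C p :=
  match split i with
  | inl j => fps_comp (z j) (fps_lin A)
  | inr l => fps_comp (zpp l) (fps_lin A)
  end.

Lemma paraml A j : param A (lshift p j) = fps_comp (z j) (fps_lin A).
Proof. by rewrite /param (unsplitK (inl j)). Qed.

Lemma paramr A l : param A (rshift p l) = fps_comp (zpp l) (fps_lin A).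
Proof. by rewrite /param (unsplitK (inr l)). Qed.

Lemma param0 A : vanishes_at0 (param A).
Proof.
move=> i; case: (split_ordP i) => j ->; rewrite ?paraml ?paramr fps_comp_const //;
  by [apply: vanishes_at0_lin|apply: zpp0].
Qed.

Lemma param_jac A : jacobian0 (param A) = col_mx (diag_mx (\row_j a j) *m A) 0.
Proof.
have hz := jacobian0_comp z (vanishes_at0_lin A).
have hQ := jacobian0_comp zpp (vanishes_at0_lin A).
rewrite jacobian0_lin z_jac in hz; rewrite jacobian0_lin zpp_jacobian0 mul0mx in hQ.
apply/matrixP => i j; rewrite mxE; case: (split_ordP i) => l ->.
  by rewrite paraml col_mxEu -hz mxE.
by rewrite paramr col_mxEd -hQ mxE.
Qed.

(** For xi = A t with t real, the matrix condition says conj xi = S D xi; the conjugate of z(xi) is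
    then the w-component of [fibre D] at xi. *)
Lemma param_in_M (D A : 'M[C]_p) : (forall j, zpp j = fps_comp (E j) (fibre D)) ->
  S *m D *m A = map_mx Num.conj A -> contained_in_M E (param A).
Proof.
move=> hQ hA z_zbar j m; rewrite paramr hQ; apply: (congr1 (fun f : fps C p => f m)).
rewrite fps_compA; last exact: vanishes_at0_lin.
  congr (fps_comp _ _); apply: functional_extensionality => i.
  rewrite /z_zbar /fibre; case: (split i) => l; first by rewrite paraml.
  rewrite paraml fps_conj_comp_lin -hA /conj_flip !fps_comp_lin_lin.
  by rewrite mulmxA.
move=> i; rewrite /fibre; case: (split i) => l //.
rewrite /conj_flip !fps_comp_const; [|exact: vanishes_at0_lin..].
by rewrite /fps_conj z0 rmorph0.
Qed.

(** The graph z'' = zpp(z^-1(z')), with [gi] in the role of z^-1. *)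
Definition attached_equations (gi : 'I_p -> fps C p) (k : 'I_p) : fps C (p + p) :=
  fun m => fps_var C (rshift p k) m -
    fps_comp (fps_comp (zpp k) gi) (fun i => fps_var C (lshift p i)) m.

Let var_l0 : vanishes_at0 (fun i : 'I_p => fps_var C (lshift p i)).
Proof. by move=> i; apply: vanishes_at0_var. Qed.

Let a_unit : diag_mx (\row_j a j) \in unitmx.
Proof.
rewrite unitmxE det_diag unitfE; apply/prodf_neq0 => i _.
by rewrite mxE.
Qed.

Section Unit.
Context (A : 'M[C]_p).
Hypothesis A_unit : A \in unitmx.

Let aA_inj (t : 'cV[C]_p) : diag_mx (\row_j a j) *m A *m t = 0 -> t = 0.
Proof.
move=> h; have uAA : diag_mx (\row_j a j) *m A \in unitmx by rewrite unitmx_mul a_unit.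
by rewrite -[t](mulKmx uAA) h mulmx0.
Qed.

Lemma param_real_submanifold : formal_real_submanifold (param A).
Proof.
split; first exact: param0.
move=> t _; rewrite param_jac mul_col_mx mul0mx -[X in _ = X -> _]col_mx0 => /eq_col_mx[h _].
exact: aA_inj.
Qed.

Lemma param_totally_real : totally_real (param A).
Proof.
move=> v [t tr ->] [s sr]; rewrite param_jac !mul_col_mx !mul0mx scale_col_mx.
move=> /eq_col_mx[h _].
have h2 : 'i *: t - s = 0.
  by apply: aA_inj; rewrite mulmxBr -scalemxAr h subrr.
suff -> : t = 0 by rewrite mulmx0 col_mx0.
apply/matrixP => i j; rewrite mxE; move/matrixP/(_ i j): h2; rewrite !mxE => h2.
move/mxOverP/(_ i j): tr => tr; move/mxOverP/(_ i j): sr => sr.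
have := congr1 (fun x => 'Im x) h2.
by rewrite raddfB /= ImMil raddf0 /= (Creal_ReP _ tr) (Creal_ImP _ sr) subr0.
Qed.

End Unit.

Lemma param_in_K gi A : (forall i, fps_comp (gi i) z = fps_var C i) -> vanishes_at0 gi ->
  contained_in_K (attached_equations gi) (param A).
Proof.
move=> gz gi0 k m.
have lin0 := @vanishes_at0_lin C _ _ A; have pA0 := param0 A.
pose H := fps_comp (fps_comp (zpp k) gi) (fun i => fps_var C (lshift p i)).
have := fps_comp_linear [:: true; false] (fun b : bool => if b then 1 else -1)
  (fun b => if b then fps_var C (rshift p k) else H) pA0.
have -> : (fun m => \sum_(i <- [:: true; false]) (if i then 1 else -1) *
     (if i then fps_var C (rshift p k) else H) m) = attached_equations gi k.
  by apply: functional_extensionality => q; rewrite big_cons big_seq1 mul1r mulN1r.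
move=> ->; rewrite big_cons big_seq1 mul1r mulN1r fps_comp_varl // paramr.
suff -> : fps_comp H (param A) = fps_comp (zpp k) (fps_lin A) by rewrite subrr.
rewrite /H fps_compA //.
have -> : (fun i => fps_comp (fps_var C (lshift p i)) (param A)) =
    (fun i => fps_comp (z i) (fps_lin A)).
  by apply: functional_extensionality => i; rewrite fps_comp_varl // paraml.
have zA0 : vanishes_at0 (fun i => fps_comp (z i) (fps_lin A)) by apply: vanishes_at0_comp.
rewrite fps_compA //; congr (fps_comp _ _); apply: functional_extensionality => i.
by rewrite -fps_compA // gz fps_comp_varl.
Qed.

(** E has order 2, so at the CR singularity the tangent space of M is the complex space z'' = 0. *)
Lemma tangent_MP v : tangent_M E v <-> exists u, v = col_mx u 0.
Proof.
by split=> -[u ->]; exists u; rewrite E_jacobian0 mul0mx.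
Qed.

Lemma attached_equations_submanifold gi : vanishes_at0 gi ->
  formal_complex_submanifold (attached_equations gi).
Proof.
move=> gi0; have QG : vanishes_at0 (fun k => fps_comp (zpp k) gi).
  by apply: vanishes_at0_comp => //; apply: zpp0.
have jac : jacobian0 (attached_equations gi) = row_mx 0 1%:M.
  apply/matrixP => k i; rewrite mxE /attached_equations.
  have -> : fps_comp (fps_comp (zpp k) gi) (fun i => fps_var C (lshift p i)) U_(i)%MM = 0.
    have := jacobian0_comp (fun k => fps_comp (zpp k) gi) var_l0.
    rewrite (jacobian0_comp zpp gi0) zpp_jacobian0 !mul0mx => /matrixP/(_ k i).
    by rewrite !mxE.
  rewrite subr0 fps_var_U; case: (split_ordP i) => l ->.
    by rewrite row_mxEl mxE eq_rlshift.
  by rewrite row_mxEr mxE eq_rshift.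
split.
  move=> k; rewrite /attached_equations fps_comp_const // QG subr0.
  exact: vanishes_at0_var.
by rewrite jac /row_free rank_row_0mx mxrank1.
Qed.

Lemma flip_mxK : S *m S = 1%:M.
Proof.
by apply/matrixP => i j; rewrite mul_flip_mx !mxE tauK eq_sym.
Qed.

Lemma real_form_mx : exists2 A : 'M[C]_p, A \in unitmx & S *m A = map_mx Num.conj A.
Proof.
(* On the eigenspaces 1 and -1 of S this A is w + conj w = 2 and w - conj w = 2 'i, hence
   invertible; 4 'i in the inverse is w^2 - (conj w)^2. *)
pose w : C := 1 + 'i; pose A := w%:M + w^* *: S.
have wJ : w^* = 1 - 'i by rewrite rmorphD rmorph1 /= conjCi.
exists A.
  have h : A *m ((w / (4 * 'i))%:M - (w^* / (4 * 'i)) *: S) = 1%:M.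
    have i0 : 'i != 0 :> C := neq0Ci C.
    rewrite /A mulmxDl mul_scalar_mx -scalemxAl mulmxBr mul_mx_scalar -scalemxAr flip_mxK.
    apply/matrixP => i j; rewrite !mxE.
    set d := (i == j)%:R; set s := (j == tau i)%:R.
    by rewrite wJ /w; field.
  by case: (mulmx1_unit h).
rewrite /A mulmxDr -scalemxAr flip_mxK mul_mx_scalar map_mxD map_scalar_mx map_mxZ /= conjCK.
rewrite addrC scalemx1; congr (_ + w *: _).
by apply/matrixP => i j; rewrite !mxE rmorph_nat.
Qed.

(** * Transversality of the two real forms *)

Section Transversality.
Context (A : 'M[C]_p) (kappa : 'I_p -> C).
Hypotheses (A_unit : A \in unitmx) (A_conj : S *m A = map_mx Num.conj A).
Hypothesis kappaP : forall j, kappa j != 0 /\ (kappa (tau j))^* = nu j * kappa j.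

Lemma real_coordinates (x : 'cV[C]_p) : S *m x = map_mx Num.conj x ->
  exists2 t : 'cV[C]_p, t \is a mxOver Num.real & A *m t = x.
Proof.
move=> hx; exists (invmx A *m x); last by rewrite mulKVmx.
set t := invmx A *m x; have At : A *m t = x by rewrite mulKVmx.
have uJ : map_mx Num.conj A \in unitmx by rewrite map_unitmx.
have : map_mx Num.conj t = t.
  apply: (can_inj (mulKmx uJ)); rewrite -map_mxM At -hx -At mulmxA A_conj.
  by [].
move=> tJ; apply/mxOverP => i j; apply/CrealP.
by move/matrixP/(_ i j): tJ; rewrite mxE.
Qed.

Let B := diag_mx (\row_j kappa j) *m A.

Lemma kappa_unit : diag_mx (\row_j kappa j) \in unitmx.
Proof.
rewrite unitmxE det_diag unitfE; apply/prodf_neq0 => i _.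
by rewrite mxE; case: (kappaP i).
Qed.

Lemma second_mx_conj : S *m diag_mx (\row_j nu j) *m B = map_mx Num.conj B.
Proof.
have e : S *m diag_mx (\row_j (nu j * kappa j)) =
    map_mx Num.conj (diag_mx (\row_j kappa j)) *m S.
  apply: flip_diag => // j.
  by case: (kappaP (tau j)) => _ <-; rewrite tauK.
rewrite /B map_mxM -A_conj [RHS]mulmxA -e -!mulmxA; congr (_ *m _); rewrite mulmxA; congr (_ *m _).
by rewrite mulmx_diag; congr diag_mx; apply/rowP => j; rewrite !mxE.
Qed.

(** Write x = y + b with conj (y (tau i)) = y i and conj (b (tau i)) = nu i * b i. Conjugating gives
    conj (x (tau i)) = y i + nu i * b i, whence b i = (conj (x (tau i)) - x i) / (nu i - 1); this is
    where nu i differs from 1. *)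
Lemma real_decomposition (x : 'cV[C]_p) : exists t s : 'cV[C]_p,
  [/\ t \is a mxOver Num.real, s \is a mxOver Num.real & x = A *m t + B *m s].
Proof.
pose cx i := (x (tau i) 0)^*.
have nu1 i : nu i - 1 != 0 by rewrite subr_eq0.
have nu0 i : nu i != 0.
  by apply/eqP => h; have := nu_conj i; rewrite h mul0r => /esym/eqP; rewrite oner_eq0.
have nut i : (nu (tau i))^* = (nu i)^-1.
  by rewrite -[LHS]mul1r -(mulVf (nu0 i)) -mulrA nu_conj mulr1.
pose b : 'cV[C]_p := \col_i ((cx i - x i 0) / (nu i - 1)).
have cb i : (b (tau i) 0)^* = nu i * b i 0.
  rewrite !mxE fmorph_div /= !rmorphB /= rmorph1 nut /cx tauK conjCK.
  have n1 : 1 - nu i != 0 by rewrite -opprB oppr_eq0.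
  by field; rewrite nu1 nu0 mulN1r n1.

have [t tr ht] : exists2 t : 'cV[C]_p, t \is a mxOver Num.real & A *m t = x - b.
  apply: real_coordinates; apply/matrixP => i j; rewrite mul_flip_mx (ord1 j) {j}.
  have := cb (tau i); rewrite tauK => e.
  have -> : (map_mx Num.conj (x - b)) i 0 = cx (tau i) - nu (tau i) * b (tau i) 0.
    by rewrite -e /cx tauK [LHS]mxE [in LHS]mxE [X in _ + X]mxE -/b rmorphB.
  have eb : cx (tau i) - x (tau i) 0 = b (tau i) 0 * (nu (tau i) - 1).
    by rewrite [X in _ = X * _]mxE divfK.
  have -> : cx (tau i) = b (tau i) 0 * (nu (tau i) - 1) + x (tau i) 0.
    by rewrite -eb subrK.
  rewrite [LHS]mxE [X in _ + X]mxE; ring.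
(* Division by [kappa] carries the second real form onto the first. *)
have [s sr hs] : exists2 s : 'cV[C]_p, s \is a mxOver Num.real &
    A *m s = \col_i (b i 0 / kappa i).
  apply: real_coordinates; apply/matrixP => i j; rewrite mul_flip_mx [RHS]mxE [LHS]mxE.
  have := cb (tau i); rewrite tauK => e.
  have [k0 ek] := kappaP (tau i); rewrite tauK in ek.
  by rewrite [X in Num.conj X]mxE fmorph_div /= e ek -mulf_div divff // mul1r.
exists t, s; split => //; rewrite /B -mulmxA hs ht.
suff -> : diag_mx (\row_j kappa j) *m (\col_i (b i 0 / kappa i)) = b by rewrite subrK.
apply/matrixP => i j; rewrite mul_diag_mx !mxE mulrC divfK //.
by case: (kappaP i).
Qed.

End Transversality.

Lemma attached_exists : exists K, attached E K /\ forall k, convergent (K k).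
Proof.
have [A A_unit A_conj] := real_form_mx.
have [kappa kappaP] := antilinear_scale tauK nu_conj.
have z_unit : jacobian0 z \in unitmx by rewrite z_jac.
have [gi [gi0 gi_conv giz]] := fps_inverse z0 z_conv z_unit.
pose B := diag_mx (\row_j kappa j) *m A.
have B_unit : B \in unitmx by rewrite unitmx_mul (kappa_unit kappaP).
exists (attached_equations gi); split; last first.
  move=> k; apply: convergentB; first exact: convergent_var.
  apply: convergent_comp => // [|i]; last exact: convergent_var.
  by apply: convergent_comp => //; apply: zpp_conv.
split; first exact: attached_equations_submanifold.
exists (param A), (param B); split.
- split; [exact: param_real_submanifold|exact: param_totally_real| |exact: param_in_K].
  by apply: (param_in_M zpp_fibre_1); rewrite mulmx1.
- split; [exact: param_real_submanifold|exact: param_totally_real| |exact: param_in_K].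
  by apply: (param_in_M zpp_fibre_nu); apply: second_mx_conj.
move=> v; rewrite tangent_MP; split.
  move=> [u ->].
  have [t [s [tr sr e]]] := real_decomposition A_unit A_conj kappaP
    (invmx (diag_mx (\row_j a j)) *m u).
  exists (jacobian0 (param A) *m t), (jacobian0 (param B) *m s); split.
  - by exists t.
  - by exists s.
  rewrite !param_jac !mul_col_mx !mul0mx add_col_mx addr0; congr col_mx.
  by rewrite -[_ *m A *m t]mulmxA -[_ *m B *m s]mulmxA -mulmxDr -e mulKVmx.
move=> [v1 [v2 [[t _ ->] [s _ ->] ->]]].
exists (diag_mx (\row_j a j) *m A *m t + diag_mx (\row_j a j) *m B *m s).
by rewrite !param_jac !mul_col_mx !mul0mx add_col_mx addr0.
Qed.

End Attached.

End FormalSeries.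
Import FormalSeries.

From mathcomp Require Import -(notations) mpoly.
From mathcomp Require Import boolp classical_sets functions cardinality.
From mathcomp Require Import constructive_ereal ereal topology normedtype sequences exp.
Import numFieldNormedType.Exports.
Local Open Scope classical_set_scope.
Local Open Scope card_scope.

(** * The Bruno condition *)

Section BrunoSeries.
Context (R : realType).

(** A term of the Bruno series is positive when omega exceeds 1, so its partial sums are monotone
    only from some index on. *)
Lemma limn_le_nonincreasing (S : nat -> \bar R) n0 :
  (forall n, (n0 <= n)%N -> (S n.+1 <= S n)%E) ->
  forall n, (n0 <= n)%N -> (limn S <= S n)%E.
Proof.
move=> hS n hn; pose T n := S (n + n0)%N.
have T_dec : {homo T : i j / (i <= j)%N >-> (j <= i)%E}.
  by apply/nonincreasing_seqP => k; rewrite /T addSn hS // leq_addl.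
have : T @ \oo --> ereal_inf (range T) by apply: ereal_nonincreasing_cvgn.
rewrite cvg_shiftn => /cvg_lim ->; last by [].
apply: ereal_inf_lbound; exists (n - n0)%N => //.
by rewrite /T subnK.
Qed.

(** If every O k is 1 there is nothing to sum. Otherwise om stays below 1 from some k0 on and equals
    O there, so the remaining terms are at most 0 and the limit bounds all later partial sums. A
    zero minimum would make a term, hence the limit, equal to -oo. *)
Lemma bruno_real_bound (om : nat -> \bar R) (O : nat -> R) :
  (forall k, (0 < k)%N -> Order.min 1%:E (om k) = (O k)%:E) ->
  (forall k, (0 < k)%N -> (om k < +oo)%E) ->
  (forall k, 0 <= O k) ->
  (forall i j, (i <= j)%N -> O j <= O i) ->
  (- \sum_(1 <= k <oo) (lne (om k) * (2 ^- k)%:E) < +oo)%E ->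
  (forall k, (0 < k)%N -> 0 < O k) /\
  exists B, forall K, \sum_(1 <= k < K) - ln (O k) / 2 ^+ k <= B.
Proof.
move=> omO om_fin O_ge0 O_dec hlim.
pose a k := (lne (om k) * (2 ^- k)%:E)%E.
have om_eq k : (0 < k)%N -> O k < 1 -> om k = (O k)%:E.
  move=> k0 Ok; have := omO k k0; rewrite minEle; case: ifP => // _ [e].
  by move: Ok; rewrite -e ltxx.
have O_le1 k : (0 < k)%N -> O k <= 1.
  by move=> k0; rewrite -lee_fin -omO // ge_min lexx.
case: (pselect (forall k, (0 < k)%N -> O k = 1)) => [O1|].
  split; first by move=> k /O1 ->.
  exists 0 => K; rewrite big_nat_cond big1 // => k /andP[/andP[k0 _] _].
  by rewrite O1 // ln1 oppr0 mul0r.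
move=> /existsNP[k0] /not_implyP[k0_gt0 Ok0].
have Ok0_lt1 : O k0 < 1 by rewrite lt_neqAle O_le1 // andbT; apply/eqP.
have a_le0 k : (k0 <= k)%N -> (a k <= 0)%E.
  move=> hk; have k_gt0 : (0 < k)%N by apply: leq_trans hk.
  apply: mule_le0_ge0; last by rewrite lee_fin invr_ge0 exprn_ge0.
  apply: ltW; rewrite lne_lt0 om_eq // ?lte_fin; apply: le_lt_trans Ok0_lt1; exact: O_dec.
pose S n := (\sum_(1 <= k < n) a k)%E.
have S_dec n : (k0 <= n)%N -> (S n.+1 <= S n)%E.
  move=> hn; rewrite /S big_nat_recr /=; last exact: leq_trans hn.
  by rewrite -[leRHS]adde0 leeD2l // a_le0.
have lim_le := limn_le_nonincreasing S_dec.
have lim_fin : (-oo < limn S)%E.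
  by move: hlim; rewrite lteNl.
have a_neqNy k : (0 < k)%N -> a k != -oo%E.
  move=> k_gt0; apply: contraTneq lim_fin => ak.
  rewrite -leNgt; apply: le_trans (lim_le (k + k0)%N (leq_addl _ _)) _.
  suff -> : S (k + k0)%N = -oo%E by [].
  by apply/esum_eqNyP; exists k; split => //; rewrite mem_index_iota k_gt0 -addn1 leq_add2l.
have O_gt0 k : (0 < k)%N -> 0 < O k.
  move=> k_gt0; rewrite lt_neqAle O_ge0 andbT; apply/eqP => Ok.
  have := a_neqNy k k_gt0; rewrite /a om_eq // -?Ok ?ltr01 //= lexx.
  by rewrite gt0_mulNye ?eqxx // lte_fin invr_gt0 exprn_gt0.
split => //.
pose al k := fine (a k).
have aE k : (0 < k)%N -> a k = (al k)%:E.
  move=> k_gt0; rewrite fineK // fin_numE a_neqNy //=; apply/eqP => ak.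
  have : (a k < +oo)%E; last by rewrite ak.
  rewrite /a; have := om_fin k k_gt0; case: (om k) => [r| |] //= _.
    by case: ifP => _; rewrite ?gt0_mulNye ?ltNyr ?ltry // lte_fin invr_gt0 exprn_gt0.
  by rewrite gt0_mulNye ?ltNyr // lte_fin invr_gt0 exprn_gt0.
have al_ln k : (k0 <= k)%N -> al k = ln (O k) / 2 ^+ k.
  move=> hk; have k_gt0 : (0 < k)%N by apply: leq_trans hk.
  rewrite /al /a om_eq //; last by apply: le_lt_trans Ok0_lt1; apply: O_dec.
  by rewrite lne_EFin ?O_gt0.
have SE n : S n = (\sum_(1 <= k < n) al k)%:E.
  rewrite -sumEFin /S; apply: eq_big_nat => k /andP[k_gt0 _].
  exact: aE.
have [l hl] : exists l, limn S = l%:E.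
  exists (fine (limn S)); rewrite fineK // fin_numE -ltNye lim_fin /=.
  apply/eqP => hS; have := lim_le k0 (leqnn _); rewrite hS SE.
  by rewrite leye_eq.
have l_le n : (k0 <= n)%N -> l <= \sum_(1 <= k < n) al k.
  by move=> hn; rewrite -lee_fin -hl -SE lim_le.
have d_ge0 k : (0 < k)%N -> 0 <= - ln (O k) / 2 ^+ k.
  by move=> hk; rewrite divr_ge0 ?exprn_ge0 // oppr_ge0 ln_le0 // O_le1.
exists (\sum_(1 <= k < k0) - ln (O k) / 2 ^+ k + (\sum_(1 <= k < k0) al k - l)) => K.
case: (leqP k0 K) => hK.
  rewrite (big_cat_nat k0_gt0 hK) /= lerD2l.
  have := l_le K hK; rewrite (big_cat_nat k0_gt0 hK) /=.
  have -> : \sum_(k0 <= k < K) al k = - \sum_(k0 <= k < K) - ln (O k) / 2 ^+ k.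
    rewrite -sumrN; apply: eq_big_nat => k /andP[hk _].
    by rewrite al_ln // mulNr opprK.
  lra.
have := l_le k0 (leqnn _); rewrite -subr_ge0 => h.
case: (posnP K) => [->|K0].
  rewrite big_geq // addr_ge0 // big_nat_cond sumr_ge0 // => k /andP[/andP[hk _] _].
  exact: d_ge0.
rewrite [X in _ <= X + _](big_cat_nat K0 (ltnW hK)) /= -addrA lerDl addr_ge0 //.
rewrite big_nat_cond sumr_ge0 // => k /andP[/andP[hk _] _].
by apply: d_ge0; apply: leq_trans hk.
Qed.

End BrunoSeries.

Lemma min_bigmin (R : realType) (I : Type) (r : seq I) (P : pred I)
    (F : I -> \bar R) (f : I -> R) :
  (forall i, P i -> Order.min 1%:E (F i) = (f i)%:E) ->
  Order.min 1%:E (\big[Order.min/+oo%E]_(i <- r | P i) F i) =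
  (\big[Order.min/1]_(i <- r | P i) f i)%:E.
Proof.
move=> h; elim/big_rec2: _ => [|i y x Pi IH]; first by rewrite minEle leey.
by rewrite EFin_min -IH -(h i Pi) minACA minxx.
Qed.

(** * Weights that absorb the small divisors *)

Section BrunoWeights.
Context (R : realType) (p : nat) (nu : 'I_p -> R[i]).
Hypotheses (p_gt0 : (0 < p)%N) (nu_neq0 : forall i, nu i != 0).
Hypothesis hbruno : bruno_condition nu.

Local Notation X := (multinom p).
Local Notation "a +m b" := (mnm_add a b) (at level 50).


Let rnorm (z : R[i]) : R := complex.Re `|z|.

Lemma rnormE z : `|z| = (rnorm z)%:C%C.
Proof. by rewrite RRe_real // normr_real. Qed.

Lemma rnorm_ge0 z : 0 <= rnorm z.
Proof. by rewrite -ler0c -rnormE. Qed.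

Lemma rnormM z w : rnorm (z * w) = rnorm z * rnorm w.
Proof. by apply: complexI; rewrite rmorphM -!rnormE normrM. Qed.

Lemma rnormD z w : rnorm (z + w) <= rnorm z + rnorm w.
Proof. by rewrite -lecR rmorphD -!rnormE ler_normD. Qed.

Lemma rnorm_distrC z w : rnorm (z - w) = rnorm (w - z).
Proof. by apply: complexI; rewrite -!rnormE distrC. Qed.

Lemma rnorm_eq0 z : (rnorm z == 0) = (z == 0).
Proof. by rewrite -(inj_eq (@complexI R)) -rnormE normr_eq0. Qed.

Let target (x : 'I_p * bool) : R[i] := if x.2 then nu x.1 else (nu x.1)^-1.
Let dist x (P : X) : R := rnorm (monomial_value nu P - target x).
(** The truncation at 1 makes the cost - ln nonnegative. *)
Let divisor (P : X) : R :=
  \big[Order.min/1]_(i < p) Order.min 1 (Order.min (dist (i, true) P) (dist (i, false) P)).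
Let Om (k : nat) : R :=
  \big[Order.min/1]_(P : bmultinom p (2 ^ k).+1 | (1 < mdeg P)%N) divisor P.

Lemma target_neq0 x : target x != 0.
Proof. by rewrite /target; case: x.2; rewrite ?invr_eq0. Qed.

Lemma divisor_le1 P : divisor P <= 1.
Proof. exact: bigmin_le_id. Qed.

Lemma divisor_le_dist x P : divisor P <= dist x P.
Proof.
case: x => i b; apply: (@le_trans _ _ (Order.min 1 (Order.min (dist (i, true) P) (dist (i, false) P)))).
  exact: bigmin_le_cond.
by case: b; rewrite !ge_min lexx !orbT.
Qed.

Lemma divisor_ge0 P : 0 <= divisor P.
Proof. by apply: le_bigmin => // i _; rewrite !le_min ler01 !rnorm_ge0. Qed.

Lemma divisor_cases P : divisor P = 1 \/ exists x, divisor P = dist x P.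
Proof.
rewrite /divisor; elim/big_ind: _ => [|x y hx hy|i _]; first by left.
  by rewrite minEle; case: ifP.
rewrite minEle; case: ifP => _; first by left.
by right; rewrite minEle; case: ifP => _; [exists (i, true)|exists (i, false)].
Qed.

Lemma Om_le1 k : Om k <= 1. Proof. exact: bigmin_le_id. Qed.

Lemma Om_ge0 k : 0 <= Om k.
Proof. by apply: le_bigmin => // P _; apply: divisor_ge0. Qed.

Lemma Om_le_divisor k P : (1 < mdeg P)%N -> (mdeg P <= 2 ^ k)%N -> Om k <= divisor P.
Proof.
move=> h1 h2.
exact: (@bigmin_le_cond _ _ _ _ (BMultinom (h2 : (mdeg P < (2 ^ k).+1)%N))).
Qed.

Lemma Om_dec i j : (i <= j)%N -> Om j <= Om i.
Proof.
move=> hij; apply: le_bigmin; first exact: Om_le1.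
move=> P hP; apply: Om_le_divisor => //; have := bmdeg P; rewrite ltnS => h.
by apply: leq_trans h _; rewrite leq_exp2l.
Qed.

Lemma min_omega k : Order.min 1%:E (omega nu k) = (Om k)%:E.
Proof.
apply: min_bigmin => P _; apply: min_bigmin => i _.
by rewrite -!EFin_min.
Qed.

Lemma omega_fin k : (0 < k)%N -> (omega nu k < +oo)%E.
Proof.
move=> k0; pose i0 : 'I_p := Ordinal p_gt0.
pose P := (mnm1 i0 +m mnm1 i0).
have dP : mdeg P = 2%N by rewrite mdegD mdeg1.
have hP : (mdeg P < (2 ^ k).+1)%N by rewrite dP ltnS -{1}(expn1 2) leq_exp2l.
rewrite /omega /min_multiindex.
apply: le_lt_trans (bigmin_le_cond _ (j := BMultinom hP) _ _) _.
  by rewrite /= dP.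
apply: le_lt_trans (bigmin_le_cond _ (j := i0) _ _) _ => //.
by rewrite -EFin_min ltry.
Qed.

Let bruno_Om := bruno_real_bound (fun k _ => min_omega k) omega_fin Om_ge0 Om_dec hbruno.

Lemma Om_gt0 k : (0 < k)%N -> 0 < Om k.
Proof. by case: bruno_Om => h _; apply: h. Qed.

Lemma divisor_gt0 P : (1 < mdeg P)%N -> 0 < divisor P.
Proof.
move=> hP; apply: lt_le_trans (Om_le_divisor hP (ltnW (ltn_expl _ _))) => //.
by apply: Om_gt0; apply: ltnW.
Qed.

Let i0 : 'I_p := Ordinal p_gt0.
Let T : R := \big[Order.min/1]_x rnorm (target x).
(** Tuned for [special_apart]: two kappa Om k-close values at a common target, where |nu^P| >= T /
    2, give |nu^Q - 1| < 4 kappa Om k / T, and then |nu^Q - 1| |nu_0| < Om k. *)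
Let kappa : R := T / (2 + 4 * rnorm (nu i0)).

Lemma target_min_le x : T <= rnorm (target x). Proof. exact: bigmin_le_cond. Qed.

Lemma target_min_gt0 : 0 < T.
Proof.
rewrite /T; elim/big_ind: _ => // [x y hx hy|x _]; first by rewrite lt_min hx.
by rewrite lt_neqAle rnorm_ge0 eq_sym rnorm_eq0 target_neq0.
Qed.

Lemma kappa_den : 0 < 2 + 4 * rnorm (nu i0).
Proof. by have := rnorm_ge0 (nu i0); lra. Qed.

Lemma kappa_gt0 : 0 < kappa.
Proof. by rewrite divr_gt0 ?target_min_gt0 ?kappa_den. Qed.

Lemma kappa_le : 2 * kappa <= T.
Proof.
have e : kappa * (2 + 4 * rnorm (nu i0)) = T by rewrite divfK // gt_eqF ?kappa_den.
by have := rnorm_ge0 (nu i0); have := kappa_gt0; nra.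
Qed.

Lemma kappa_le1 : kappa <= 1.
Proof.
have : T <= 1 by apply: bigmin_le_id.
by have := kappa_le; have := kappa_gt0; lra.
Qed.

Let special k x (P : X) := (1 < mdeg P)%N && (dist x P < kappa * Om k).

Lemma special_deg k x P : special k x P -> (2 ^ k < mdeg P)%N.
Proof.
case/andP => h1 h2; rewrite ltnNge; apply/negP => h3.
have := Om_le_divisor h1 h3; have := divisor_le_dist x P; have := kappa_le1.
have := Om_ge0 k; nra.
Qed.

(* If nu^P and nu^(P+Q) are both close to the same target, then nu^Q is close
   to 1, so Q + e_0 has a small divisor. *)
Lemma special_apart k x P Q : Q != mnm0 -> special k x P -> special k x (P +m Q) ->
  (2 ^ k <= mdeg Q)%N.
Proof.
move=> Q0 /andP[_ h1] /andP[_ h2]; rewrite leqNgt; apply/negP => hQ.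
have dQ : (0 < mdeg Q)%N by rewrite lt0n mdeg_eq0.
have k_gt0 : (0 < k)%N.
  by case: k hQ {h1 h2} => // hQ; move: dQ; rewrite lt0n; move: hQ; rewrite expn0 ltnS leqn0 => /eqP ->.
have dQ1 : mdeg (Q +m mnm1 i0) = (mdeg Q).+1.
  by rewrite mdegD mdeg1 addn1.
have := Om_le_divisor (P := Q +m mnm1 i0) (k := k).
rewrite dQ1 ltnS => /(_ dQ hQ) hO.
have := le_trans hO (divisor_le_dist (i0, true) _).
rewrite /dist /target /= monomial_valueD monomial_valueU.
have -> : monomial_value nu Q * nu i0 - nu i0 = (monomial_value nu Q - 1) * nu i0.
  by rewrite mulrBl mul1r.
rewrite rnormM.
set y := monomial_value nu Q; set z := monomial_value nu P.
have hz : T <= rnorm z + kappa * Om k.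
  have := rnormD z (target x - z); rewrite addrC subrK => ht.
  have := target_min_le x; move: h1; rewrite /dist rnorm_distrC -/z; lra.
have hyz : rnorm z * rnorm (y - 1) < 2 * (kappa * Om k).
  rewrite -rnormM mulrBr mulr1.
  have -> : z * y - z = (z * y - target x) + (target x - z) by rewrite addrA subrK.
  have := rnormD (z * y - target x) (target x - z).
  move: h1 h2; rewrite /dist monomial_valueD -/y -/z [rnorm (z - _)]rnorm_distrC; lra.
have := rnorm_ge0 (y - 1); have := rnorm_ge0 (nu i0); have := Om_gt0 k_gt0.
have := Om_le1 k; have := kappa_le; have := kappa_gt0; have := target_min_gt0.
have : kappa * (2 + 4 * rnorm (nu i0)) = T by rewrite divfK // gt_eqF ?kappa_den.
set N := rnorm (nu i0); set d := rnorm (y - 1); set O := Om k => e T0 k0 k2 O1 O0 N0 d0 hd.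
rewrite -/O -/d in hz hyz hd.
have kO : kappa * O <= kappa by rewrite ler_piMr // ltW.
have h3 : T / 2 <= rnorm z by lra.
have h4 : T / 2 * d < 2 * (kappa * O) by apply: le_lt_trans hyz; rewrite ler_wpM2r.
have h5 : kappa * ((1 + 2 * N) * d) < kappa * (2 * O).
  by move: h4; rewrite -e; lra.
rewrite ltr_pM2l // in h5.
by nra.
Qed.

Let cost P : R := - ln (divisor P).

Lemma cost_ge0 P : 0 <= cost P.
Proof. by rewrite oppr_ge0 ln_le0 // divisor_le1. Qed.

Lemma kappa_Om_gt0 k : 0 < kappa * Om k.+1.
Proof. by rewrite mulr_gt0 ?kappa_gt0 ?Om_gt0. Qed.

Lemma kappa_Om_le1 k : kappa * Om k <= 1.
Proof. by rewrite mulr_ile1 ?(ltW kappa_gt0) ?Om_ge0 ?kappa_le1 ?Om_le1. Qed.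

Let b k : R := - ln (kappa * Om k.+1).

Lemma scale_cost_ge0 k : 0 <= b k.
Proof. by rewrite oppr_ge0 ln_le0 // kappa_Om_le1. Qed.

(** The whole cost is charged to the last scale k at which P is special: not being special at k + 1,
    P has a divisor of at least kappa Om (k + 1), which explains the shift in [b]. Without such a
    scale, b 0 pays. *)
Lemma cost_le P K : (1 < mdeg P)%N -> kappa * Om K.+1 <= divisor P ->
  cost P <= b 0 + \sum_(1 <= k < K.+1) b k * \sum_x (special k x P)%:R.
Proof.
move=> hP; have eP := divisor_gt0 hP.
elim: K => [|K IH] hK.
  by rewrite big_geq // addr0 lerN2 ler_ln ?posrE ?kappa_Om_gt0.
rewrite big_nat_recr //= addrA.
case: (leP (kappa * Om K.+1) (divisor P)) => [/IH h|hlt].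
  by apply: le_trans h _; rewrite lerDl mulr_ge0 ?scale_cost_ge0 // sumr_ge0.
have [x hx] : exists x, divisor P = dist x P.
  case: (divisor_cases P) => // e; move: hlt; rewrite e => hlt.
  by have := kappa_Om_le1 K.+1; rewrite leNgt hlt.
have spx : special K.+1 x P by rewrite /special hP -hx.
apply: le_trans (_ : b K.+1 * \sum_y (special K.+1 y P)%:R <= _); last first.
  rewrite lerDr addr_ge0 ?scale_cost_ge0 // sumr_ge0 // => k _.
  by rewrite mulr_ge0 ?scale_cost_ge0 // sumr_ge0.
rewrite (bigD1 x) //= spx mulrDr mulr1.
apply: le_trans (_ : b K.+1 <= _).
  by rewrite lerN2 ler_ln ?posrE ?kappa_Om_gt0.
by rewrite lerDl mulr_ge0 ?scale_cost_ge0 // sumr_ge0.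
Qed.

(** The part - ln kappa sums to a geometric series, and the shift of index in [b] at most doubles
    the Bruno sum. *)
Lemma scale_cost_sum : exists B, forall K, \sum_(1 <= k < K) b k / 2 ^+ k <= B.
Proof.
have [_ [B hB]] := bruno_Om.
have B0 : 0 <= B by have := hB 0%N; rewrite big_geq.
have kap0 : 0 <= - ln kappa by rewrite oppr_ge0 ln_le0 // kappa_le1.
exists (- ln kappa + 2 * B) => -[|K]; first by rewrite big_geq // addr_ge0 // mulr_ge0.
have geom : \sum_(1 <= k < K.+1) (- ln kappa) / 2 ^+ k = - ln kappa - (- ln kappa) / 2 ^+ K.
  elim: K => [|K IH]; first by rewrite big_geq // expr0 divr1 subrr.
  rewrite big_nat_recr //= IH exprS; field.
  by rewrite expf_neq0 // pnatr_eq0.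
have bE k : b k / 2 ^+ k = (- ln kappa) / 2 ^+ k + 2 * (- ln (Om k.+1) / 2 ^+ k.+1).
  rewrite /b lnM ?posrE ?kappa_gt0 ?Om_gt0 // exprS; field.
  by rewrite expf_neq0 // pnatr_eq0.
under eq_bigr do rewrite bE.
rewrite big_split /= geom -mulr_sumr; apply: lerD.
  by rewrite lerBlDr lerDl divr_ge0 // exprn_ge0.
rewrite ler_wpM2l //; apply: le_trans (hB K.+2).
rewrite [leRHS]big_nat_recl //= lerDr.
by rewrite divr_ge0 ?exprn_ge0 // oppr_ge0 ln_le0 // Om_le1.
Qed.

Lemma tree_cost_linear : exists c, forall t : btree p,
  tree_cost cost t <= c * (mdeg (tree_index t))%:R.
Proof.
have [B hB] := scale_cost_sum.
exists (b 0 + 2 * #|{: 'I_p * bool}|%:R * B) => t.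
apply: (@tree_cost_bound _ _ _ _ special (b 0) B b) => //.
- exact: scale_cost_ge0.
- exact: scale_cost_ge0.
- by move=> k x P; apply: special_deg.
- by move=> k x P Q; apply: special_apart.
move=> P [|K] h1 h2; first by move: (leq_trans h1 h2); rewrite expn0 ltnn.
apply: cost_le => //; apply: le_trans (Om_le_divisor h1 h2).
by rewrite ler_piMl ?Om_ge0 // kappa_le1.
Qed.

(** With D P the supremum of the costs of the trees of index P, the weights are exp (- D) and exp
    (cost - D). Joining a tree of index P and one of index Q under a new root gives D (P + Q) >=
    cost (P + Q) + D P + D Q, which is submultiplicativity; the linear bound c on tree costs gives
    rho = exp (- c). *)
Lemma bruno_weights : exists (v v2 : X -> R[i]) (rho : R[i]),
  [/\ [/\ forall m, 0 <= v m, forall m, 0 <= v2 m, submult v v & submult v v2],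
    0 < rho, forall m, rho ^+ mdeg m <= v m &
    forall m, (1 < mdeg m)%N -> v m <= v2 m /\ forall i,
      [/\ monomial_value nu m != nu i, monomial_value nu m != (nu i)^-1,
          `|monomial_value nu m - nu i|^-1 * v m <= v2 m &
          `|monomial_value nu m - (nu i)^-1|^-1 * v m <= v2 m]].
Proof.
have [c hc] := tree_cost_linear.
pose S (P : X) := [set x | exists2 t, tree_index t = P & x = tree_cost cost t].
pose D P := sup (S P).
have S_ub P : ubound (S P) (c * (mdeg P)%:R) by move=> x [t <- ->].
have D_le P : D P <= c * (mdeg P)%:R.
  (* No tree has index 0, and the supremum of the empty set is 0 by default. *)
  have [->|P0] := eqVneq P (mnm0 (n := p)).
    rewrite mdeg0 mulr0 /D; suff -> : S (mnm0 (n := p)) = set0 by rewrite sup0.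
    rewrite predeqE => x; split => // -[t ht _].
    by have := tree_index_neq0 t; rewrite ht eqxx.
  have [t ht] := tree_exists P0.
  by apply: ge_sup => //; exists (tree_cost cost t); exists t.
have D_ge t : tree_cost cost t <= D (tree_index t).
  apply: ub_le_sup; last by exists t.
  by exists (c * (mdeg (tree_index t))%:R); apply: S_ub.
have D_add P Q : P != mnm0 (n := p) -> Q != mnm0 (n := p) ->
    cost (P +m Q) + D P + D Q <= D (P +m Q).
  move=> /tree_exists[t0 ht0] /tree_exists[u0 hu0].
  rewrite -lerBrDl; apply: ge_sup; first by exists (tree_cost cost u0); exists u0.
  move=> _ [u hu ->]; rewrite lerBrDl addrAC -lerBrDl.
  apply: ge_sup; first by exists (tree_cost cost t0); exists t0.
  move=> _ [t ht ->]; rewrite lerBrDl.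
  by have := D_ge (Node t u); rewrite /= ht hu; lra.
exists (fun m => (expR (- D m))%:C%C), (fun m => (expR (cost m - D m))%:C%C), (expR (- c))%:C%C.
split; first split.
- by move=> m; rewrite ler0c expR_ge0.
- by move=> m; rewrite ler0c expR_ge0.
- move=> P Q P0 Q0; rewrite -rmorphM lecR -expRD ler_expR.
  by have := D_add P Q P0 Q0; have := cost_ge0 (P +m Q); lra.
- move=> P Q P0 Q0; rewrite -rmorphM lecR -expRD ler_expR.
  by have := D_add P Q P0 Q0; lra.
- by rewrite ltcR expR_gt0.
- move=> m; rewrite -rmorphXn lecR -expRM_natl ler_expR.
  by have := D_le m; rewrite mulrN lerN2 mulrC.
move=> m hm; split; first by rewrite lecR ler_expR lerDr cost_ge0.
have em := divisor_gt0 hm.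
have inv_le x : (dist x m)^-1 * expR (- D m) <= expR (cost m - D m).
  rewrite expRD ler_wpM2r ?expR_ge0 // expRN lnK ?posrE //.
  rewrite lef_pV2 ?posrE ?divisor_le_dist //.
  exact: lt_le_trans em (divisor_le_dist x m).
have neq x : monomial_value nu m != target x.
  rewrite -subr_eq0 -rnorm_eq0 gt_eqF //.
  exact: lt_le_trans em (divisor_le_dist x m).
move=> i; split; first exact: (neq (i, true)).
- exact: (neq (i, false)).
- by rewrite rnormE -fmorphV -rmorphM lecR; apply: (inv_le (i, true)).
- by rewrite rnormE -fmorphV -rmorphM lecR; apply: (inv_le (i, false)).
Qed.

End BrunoWeights.

(** * Existence of the full sign change *)

Lemma card_eq_inj_onto (T : Type) (A : set T) (F : finType) (f : T -> F) :
  A #= `I_#|F| -> (forall x y, A x -> A y -> f x = f y -> x = y) ->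
  forall y, exists2 x, A x & f x = y.
Proof.
rewrite card_eq_sym => /card_bijP[h [h' hK _]] f_inj y.
pose e (i : 'I_#|F|) : `I_#|F| := SigSub (mem_set (ltn_ord i : `I_#|F| i)).
have e_inj : injective e by move=> i j /(congr1 val) /= /val_inj.
have Ah x : A (val (h x)) by apply: set_mem (valP (h x)).
have g_inj : injective (fun i => f (val (h (e i)))).
  move=> i j hij; apply: e_inj; apply: (can_inj hK); apply: val_inj.
  by apply: f_inj hij; apply: Ah.
have /codomP[i ->] : y \in codom (fun i => f (val (h (e i)))).
  by apply: inj_card_onto; rewrite ?card_ord.
by exists (val (h (e i))).
Qed.

Section FullDeck.
Context (C : numClosedFieldType) (p : nat) (tau : 'I_p -> 'I_p) (c : 'I_p -> C).
Context (E : 'I_p -> fps C (p + p)).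
Hypotheses (tauK : involutive tau) (c_neq0 : forall j, c j != 0).
Hypothesis E2 : forall j m, (mdeg m <= 2)%N -> E j m = mcoeff m (lform tau c j ^+ 2).

Lemma deck_transformationP F : deck_transformation E F ->
  [/\ vanishes_at0 F, forall i, convergent (F i),
      forall i, F (lshift p i) = fps_var C (lshift p i) &
      forall j, fps_comp (E j) F = E j].
Proof.
case=> [[F0 Fc _] hF]; split => // i.
  have := hF (lshift p i); rewrite /pi1 (unsplitK (inl i)) fps_comp_varl // => h.
  exact: funext.
have := hF (rshift p i); rewrite /pi1 (unsplitK (inr i)) => h.
exact: funext.
Qed.

(** For a deck transformation the value false means that the linear form is reversed, by
    [deck_lin_sign]. *)
Definition deck_sign (F : 'I_(p + p) -> fps C (p + p)) : {ffun 'I_p -> bool} :=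
  [ffun j => [forall i, lform_image tau c F j i == mcoeff (mnm1 i) (lform tau c j)]].

Lemma full_deck_exists : max_deck_transformations E ->
  exists T : 'I_p -> fps C (p + p),
    [/\ vanishes_at0 T, forall l, convergent (T l),
        forall l i, T l (mnm1 (lshift p i)) = - (2 / c (tau l)) * (i == tau l)%:R,
        forall l i, T l (mnm1 (rshift p i)) = - (i == l)%:R &
        forall j, fps_comp (E j) (with_T T) = E j].
Proof.
move=> hmax.
have hcard : [set F | deck_transformation E F] #= `I_#|{ffun 'I_p -> bool}|.
  by rewrite card_ffun card_bool card_ord.
have sign_inj F G : deck_transformation E F -> deck_transformation E G ->
    deck_sign F = deck_sign G -> F = G.
  move=> /deck_transformationP[F0 _ Fl EF] /deck_transformationP[G0 _ Gl EG] /ffunP hs.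
  apply: (deck_unique tauK c_neq0 E2) => // [i|j i]; first by rewrite Fl Gl.
  have := hs j; rewrite !ffunE.
  case: (boolP [forall i, _]) => [/forallP hF /esym/forallP hG|].
    by rewrite (eqP (hF i)) (eqP (hG i)).
  have cases H : vanishes_at0 H -> (forall j, fps_comp (E j) H = E j) ->
      ~~ [forall i, lform_image tau c H j i == mcoeff (mnm1 i) (lform tau c j)] ->
      lform_image tau c H j i = - mcoeff (mnm1 i) (lform tau c j).
    move=> H0 EH; case: (deck_lin_sign E2 H0 (EH j)) => // h /negP[].
    by apply/forallP => k; rewrite h.
  by move=> /(cases F F0 EF) -> /esym/negbT/(cases G G0 EG) ->.
have [F dF sF] := card_eq_inj_onto hcard sign_inj [ffun=> false].
have [F0 Fc Fl EF] := deck_transformationP dF.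
have FTE : with_T (fun j => F (rshift p j)) = F.
  apply: funext => i; rewrite /with_T; by case: (split_ordP i) => j -> //; rewrite Fl.
have linF l i : lform_image tau c F (tau l) i = - mcoeff (mnm1 i) (lform tau c (tau l)).
  case: (deck_lin_sign E2 F0 (EF (tau l))) => // h.
  move/ffunP/(_ (tau l)): sF; rewrite !ffunE => /negbT/negP[].
  by apply/forallP => k; rewrite h.
exists (fun j => F (rshift p j)); split => //.
(* Reversing z + c w while fixing z means z + c T = - (z + c w) to first order, that is T = - w - (2
   / c) z. *)
- move=> l i; have := linF l (lshift p i).
  rewrite /lform_image tauK Fl lform_Ul fps_var_U.
  rewrite eq_lshift [tau l == i]eq_sym; set d := (i == tau l)%:R => e.
  apply: (mulfI (c_neq0 (tau l))); apply: (addrI d); rewrite e.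
  by field; apply: c_neq0.
- move=> l i; have := linF l (rshift p i).
  rewrite /lform_image tauK Fl lform_Ur fps_var_U eq_lrshift add0r tauK => /eqP.
  by rewrite -mulrN (inj_eq (mulfI (c_neq0 _))) => /eqP.
- by rewrite FTE.
Qed.

End FullDeck.

Local Close Scope classical_set_scope.
Local Close Scope card_scope.

(** * The multipliers of the quadric *)

Section Pairing.
Context (e h s : nat).

(* E_j involves z_j and conj z_(partner j); on paper, s <-> s + s_*. *)
Definition partner (j : 'I_(quadric_dim e h s)) : 'I_(quadric_dim e h s) :=
  match fintype.split j with
  | inl _ => j
  | inr k => match fintype.split k with inl a => idx_s' e h a | inr a => idx_s e h a end
  end.

Lemma partner_h a : partner (idx_h e s a) = idx_h e s a.
Proof. by rewrite /partner /idx_h (unsplitK (inl _)). Qed.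

Lemma partner_s a : partner (idx_s e h a) = idx_s' e h a.
Proof. by rewrite /partner /idx_s (unsplitK (inr _)) (unsplitK (inl _)). Qed.

Lemma partner_s' a : partner (idx_s' e h a) = idx_s e h a.
Proof. by rewrite /partner /idx_s' (unsplitK (inr _)) (unsplitK (inr _)). Qed.

Lemma partner_e a : partner (idx_e h s a) = idx_e h s a.
Proof. by rewrite /partner /idx_e (unsplitK (inl _)). Qed.

Lemma idx_ind (P : 'I_(quadric_dim e h s) -> Prop) :
  (forall a, P (idx_e h s a)) -> (forall a, P (idx_h e s a)) ->
  (forall a, P (idx_s e h a)) -> (forall a, P (idx_s' e h a)) -> forall j, P j.
Proof.
move=> He Hh Hs Hs' j; case: (split_ordP j) => k ->; case: (split_ordP k) => a ->.
- exact: He.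
- exact: Hh.
- exact: Hs.
- exact: Hs'.
Qed.

Lemma partnerK : involutive partner.
Proof.
by apply: idx_ind => a; rewrite ?partner_e ?partner_h ?partner_s ?partner_s' ?partner_e ?partner_h ?partner_s.
Qed.

Context (C : numClosedFieldType).
Context (gammae : 'I_e -> C) (gammah : 'I_h -> C) (gammas : 'I_s -> C).

Definition half_slope (j : 'I_(quadric_dim e h s)) : C :=
  match fintype.split j with
  | inl k => match fintype.split k with inl a => gammae a | inr a => gammah a end
  | inr k => match fintype.split k with inl a => gammas a | inr a => 1 - (gammas a)^* end
  end.

Lemma half_slope_e a : half_slope (idx_e h s a) = gammae a.
Proof. by rewrite /half_slope /idx_e (unsplitK (inl _)) (unsplitK (inl _)). Qed.

Lemma half_slope_h a : half_slope (idx_h e s a) = gammah a.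
Proof. by rewrite /half_slope /idx_h (unsplitK (inl _)) (unsplitK (inr _)). Qed.

Lemma half_slope_s a : half_slope (idx_s e h a) = gammas a.
Proof. by rewrite /half_slope /idx_s (unsplitK (inr _)) (unsplitK (inl _)). Qed.

Lemma half_slope_s' a : half_slope (idx_s' e h a) = 1 - (gammas a)^*.
Proof. by rewrite /half_slope /idx_s' (unsplitK (inr _)) (unsplitK (inr _)). Qed.

Lemma quadric_lform j :
  quadric gammae gammah gammas j = lform partner (fun j => 2 * half_slope j) j ^+ 2.
Proof.
rewrite /quadric /lform /partner /half_slope.
case: (split_ordP j) => k ->; case: (split_ordP k) => a -> //.
Qed.

Lemma half_slope_neq0 : quadric_parameters gammae gammah gammas ->
  forall j, half_slope j != 0.
Proof.
case=> He Hh Hs; apply: idx_ind => a.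
- by rewrite half_slope_e gt_eqF //; case/andP: (He a).
- by rewrite half_slope_h gt_eqF // (lt_trans _ (Hh a)) // invr_gt0 ltr0n.
- rewrite half_slope_s; apply/eqP => h0; have [] := Hs a.
  by rewrite h0 raddf0 lt_gtF // invr_gt0 ltr0n.
- rewrite half_slope_s' subr_eq0 eq_sym; apply/eqP => h0; have [_] := Hs a.
  have -> : gammas a = 1 by rewrite -[LHS]conjCK h0 rmorph1.
  by rewrite (Creal_ImP _ _) ?ltxx // rpred1.
Qed.

End Pairing.

Section Multipliers.
Context (C : numClosedFieldType) (h s : nat).
Local Notation p := (quadric_dim 0 h s).
Context (gammae : 'I_0 -> C) (gammah : 'I_h -> C) (gammas : 'I_s -> C).
Context (lambda mu nu : 'I_p -> C) (eps : 'I_p -> int).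
Hypothesis hgamma : quadric_parameters gammae gammah gammas.
Hypothesis lambda_h : forall a, let l := lambda (idx_h 0 s a) in
  `|l| = 1 /\ gammah a = (l + l^*)^-1.
Hypothesis lambda_s : forall a, let l := lambda (idx_s 0 h a) in
  1 < `|l| /\ gammas a = (1 + l ^- 2)^-1.
Hypothesis lambda_s' : forall a,
  lambda (idx_s' 0 h a) = ((lambda (idx_s 0 h a))^*)^-1.
Hypothesis hmu : forall j, mu j = lambda j ^+ 2.
Hypothesis mu_neqV : forall j, mu j != (mu j)^-1.
Hypothesis heps : forall j, eps j = 1 \/ eps j = -1.
Hypothesis hnu : forall j, nu j = mu j ^ eps j.
Hypothesis hnu_s : forall a, nu (idx_s' 0 h a) = ((nu (idx_s 0 h a))^*)^-1.

Lemma nu_cases j : nu j = mu j \/ nu j = (mu j)^-1.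
Proof. by rewrite hnu; case: (heps j) => ->; [left|right]. Qed.

Lemma nu_neqV j : nu j != (nu j)^-1.
Proof. by case: (nu_cases j) => ->; rewrite ?invrK // eq_sym. Qed.

Lemma lambda_neq0 j : lambda j != 0.
Proof.
move: j; apply: idx_ind => a; first by case: a.
- by case: (lambda_h a) => h1 _; rewrite -normr_eq0 h1 oner_eq0.
- by case: (lambda_s a) => h1 _; rewrite -normr_gt0 (lt_trans ltr01).
- rewrite lambda_s' invr_eq0 conjC_eq0.
  by case: (lambda_s a) => h1 _; rewrite -normr_gt0 (lt_trans ltr01).
Qed.

Lemma nu_neq0 j : nu j != 0.
Proof.
have : mu j != 0 by rewrite hmu expf_neq0 // lambda_neq0.
by case: (nu_cases j) => ->; rewrite ?invr_eq0.
Qed.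

Lemma nu_conj j : (nu (partner j))^* = (nu j)^-1.
Proof.
move: j; apply: idx_ind => a; first by case: a.
- rewrite partner_h; set j := idx_h 0 s a.
  have l1 : (lambda j)^* = (lambda j)^-1.
    by case: (lambda_h a) => h1 _; rewrite [RHS]invC_norm h1 expr1n invr1 mul1r.
  have m1 : (mu j)^* = (mu j)^-1 by rewrite hmu rmorphXn /= l1 exprVn.
  by case: (nu_cases j) => ->; rewrite ?fmorphV /= m1.
- by rewrite partner_s hnu_s fmorphV /= conjCK.
- by rewrite partner_s' hnu_s invrK.
Qed.

Let g j := 2 / (2 * half_slope gammae gammah gammas j).

Lemma gE j : g j = (half_slope gammae gammah gammas j)^-1.
Proof. by rewrite /g invfM mulrA divff ?mul1r // pnatr_eq0. Qed.

Lemma nu_sym j (x : C) : (x = mu j) ->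
  (1 + nu j) * (1 + (nu j)^-1) = (1 + x) * (1 + x^-1).
Proof.
move=> ->; case: (nu_cases j) => ->; first by [].
by rewrite invrK mulrC.
Qed.

(** At a hyperbolic index, gamma^-2 = (lambda + lambda^-1)^2 = (1 + mu)(1 + mu^-1). For a complex
    pair, gamma^-1 = 1 + mu^-1 and (1 - gamma)^-1 = 1 + mu. The product is symmetric in mu and
    mu^-1, so it is the same for either sign [eps]. *)
Lemma g_nu j : g j * (g (partner j))^* = (1 + nu j) * (1 + (nu j)^-1).
Proof.
have g_s a : g (idx_s 0 h a) * (g (idx_s' 0 h a))^* =
    (1 + nu (idx_s 0 h a)) * (1 + (nu (idx_s 0 h a))^-1).
  have l0 := lambda_neq0 (idx_s 0 h a).
  rewrite !gE half_slope_s half_slope_s' fmorphV rmorphB rmorph1 /= conjCK.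
  rewrite (nu_sym (esym (hmu _))).
  have := half_slope_neq0 hgamma (idx_s 0 h a).
  rewrite half_slope_s; case: (lambda_s a) => _ ->.
  set L := lambda _ ^+ 2; have L0 : L != 0 by rewrite expf_neq0.
  rewrite invr_eq0 => D0.
  have L1 : 1 + L != 0 by rewrite -(divfK L0 (1 + L)) mulf_neq0 // mulrDl divff // addrC mul1r.
  have -> : 1 - (1 + L^-1)^-1 = (1 + L)^-1 by field; rewrite L1 L0.
  by rewrite !invrK mulrC.
move: j; apply: idx_ind => a; first by case: a.
- rewrite partner_h gE half_slope_h; case: (lambda_h a) => h1 h2.
  have l0 := lambda_neq0 (idx_h 0 s a).
  rewrite (nu_sym (esym (hmu _))) h2 invrK rmorphD /= conjCK.
  set l := lambda _ in l0 h1 h2 *.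
  have -> : l^* = l^-1 by rewrite [RHS]invC_norm h1 expr1n invr1 mul1r.
  by field.
- by rewrite partner_s g_s.
- rewrite partner_s' -[LHS]conjCK rmorphM /= conjCK mulrC g_s rmorphM !rmorphD !rmorph1 /=.
  rewrite hnu_s invrK fmorphV /= mulrC //.
Qed.

(** By [g_nu] and [nu_conj] the ratio q satisfies the cocycle condition of [antilinear_scale]; 1 +
    nu j is nonzero because -1 is its own inverse. *)
Lemma scale_exists : exists a : 'I_p -> C, forall j,
  a j != 0 /\ (1 + nu j) * (a (partner j))^* = - g j * a j.
Proof.
have nu1 j : 1 + nu j != 0.
  rewrite addrC addr_eq0; apply/eqP => nj.
  by have := nu_neqV j; rewrite nj invrN invr1 eqxx.
pose q j := - g j / (1 + nu j).
have [|a ha] := @antilinear_scale _ _ (@partner 0 h s) q (@partnerK 0 h s).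
  move=> j; rewrite /q fmorph_div rmorphN rmorphD rmorph1 /= mulf_div mulrNN g_nu nu_conj.
  rewrite divff // mulf_neq0 //.
  by rewrite -nu_conj -[1](rmorph1 Num.conj) -rmorphD conjC_eq0.
exists a => j; have [a0 ->] := ha j; split => //.
by rewrite /q mulrA [X in X * _]mulrC divfK.
Qed.

End Multipliers.

Unset Implicit Arguments.
Set Strict Implicit.

Theorem theorem11p5 (R : realType) (e h s : nat)
    (gammae : 'I_e -> R[i]) (gammah : 'I_h -> R[i]) (gammas : 'I_s -> R[i])
    (lambda mu nu : 'I_(quadric_dim e h s) -> R[i])
    (eps : 'I_(quadric_dim e h s) -> int)
    (E : 'I_(quadric_dim e h s) ->
         fps R[i] (quadric_dim e h s + quadric_dim e h s))
    (p_gt0 : (0 < quadric_dim e h s)%N)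
    (hgamma : quadric_parameters gammae gammah gammas)
    (hlambda : lambda_parameters gammae gammah gammas lambda)
    (hmu : forall j, mu j = lambda j ^+ 2)
    (mu_distinct : uniq ([seq mu j | j : 'I_(quadric_dim e h s)] ++
                         [seq (mu j)^-1 | j : 'I_(quadric_dim e h s)]))
    (hE : higher_order_perturbation gammae gammah gammas E)
    (hdeck : max_deck_transformations E)
    (no_elliptic : e = 0%N)
    (heps : forall j, eps j = 1 \/ eps j = -1)
    (hnu : forall j, nu j = mu j ^ eps j)
    (hnu_s : forall a : 'I_s,
       nu (idx_s' e h a) = (Num.conj (nu (idx_s e h a)))^-1)
    (hbruno : bruno_condition nu) :
  exists K : 'I_(quadric_dim e h s) ->
             fps R[i] (quadric_dim e h s + quadric_dim e h s),
    attached E K /\ forall k, convergent (K k).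
Proof.
subst e; have [_ lh ls ls'] := hlambda; have [E_conv E_quadric] := hE.
have lambda_h a : let l := lambda (idx_h 0 s a) in `|l| = 1 /\ gammah a = (l + l^*)^-1.
  by case: (lh a) => h1 _ h2; split.
have lambda_s a : let l := lambda (idx_s 0 h a) in 1 < `|l| /\ gammas a = (1 + l ^- 2)^-1.
  by case: (ls a) => h1 _ h2; split.
have mu_neqV j : mu j != (mu j)^-1.
  apply/eqP => mj; move: mu_distinct; rewrite cat_uniq => /and3P[_ /hasPn hn _].
  have /hn/negP[] : (mu j)^-1 \in [seq (mu j)^-1 | j : 'I_(quadric_dim 0 h s)].
    by apply/fintype.imageP; exists j.
  by rewrite -mj; apply/fintype.imageP; exists j.
have nuV := nu_neqV mu_neqV heps hnu.
have nu0 := nu_neq0 lambda_h lambda_s ls' hmu heps hnu.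
have nuC := nu_conj lambda_h hmu heps hnu hnu_s.
have gnu := g_nu hgamma lambda_h lambda_s ls' hmu heps hnu hnu_s.
have [a ha] := scale_exists hgamma lambda_h lambda_s ls' hmu mu_neqV heps hnu hnu_s.
pose c j := 2 * half_slope gammae gammah gammas j.
have c0 j : c j != 0 by rewrite mulf_neq0 ?pnatr_eq0 ?half_slope_neq0.
have E2 j m : (mdeg m <= 2)%N -> E j m = mcoeff m (lform (@partner 0 h s) c j ^+ 2).
  by move=> hm; rewrite E_quadric // quadric_lform.
have [T [T0 T_conv T_Ul T_Ur ET]] := full_deck_exists (@partnerK 0 h s) c0 E2 hdeck.
have [v [v2 [rho [[v_ge0 v2_ge0 vv vv2] rho0 rho_v small_div]]]] :=
  bruno_weights p_gt0 nu0 hbruno.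
have [z [z0 z_conv z_jac z_T]] := invariant_manifold (@partnerK 0 h s) nu0 nuC nuV gnu
  T0 T_conv T_Ul T_Ur v_ge0 v2_ge0 vv vv2 rho0 rho_v small_div (fun j => proj2 (ha j)).
apply: (attached_exists (@partnerK 0 h s) _ _ (fun j => proj1 (ha j)) E_conv _ T0 ET
  z0 z_conv z_jac z_T) => [j|j|j m hm].
- by apply/eqP => nj; have := nuV j; rewrite nj invr1 eqxx.
- by rewrite nuC divff.
by rewrite E2 1?ltnW // expr2 (vanish_orderM (vanish_order_lform _ _ _) (vanish_order_lform _ _ _)).
Qed.
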